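(* Let $n\ge1$ and let $\lambda$ be a partition of $n$. The graded multiplicity $$H_{B_n}(\lambda,t)=\sum_{k\ge0}\dim\mathrm{Hom}_{\mathfrak{H}^{\mathfrak c}_{B_n}}\big(K^\lambda,\ \mathcal{C}l_n\otimes S^kV\big)\,t^k$$ of the irreducible $\mathfrak{H}^{\mathfrak c}_{B_n}$-module $K^\lambda$ in $\mathcal{C}l_n\otimes S^*V$ is $$H_{B_n}(\lambda,t)=hs_\lambda(1,t^2,t^4,\dots;\ t,t^3,t^5,\dots)=t^{2n(\lambda)}\prod_{\square\in\lambda}\frac{1+t^{2c_\square+1}}{1-t^{2h_\square}}.$$
   Context: All algebras and modules are over $\mathbb{C}$. Modules over a superalgebra $A$ are $\mathbb{Z}_2$-graded; $\mathrm{Hom}_A(M,N)$ is spanned by all homogeneous (even and odd) linear maps $f$ with $f(am)=(-1)^{|f||a|}af(m)$. For a partition $\lambda$: $n(\lambda)=\sum_i(i-1)\lambda_i$; for a cell $\square$ in row $i$, column $j$, $c_\square=j-i$ and $h_\square$ is the hook length. The super Schur function is $hs_\lambda(x;y)=\sum_{\mu\subseteq\lambda}s_\mu(x)\,s_{\lambda'/\mu'}(y)$, where $s_\mu$ and $s_{\lambda'/\mu'}$ are (skew) Schur functions and $'$ denotes conjugation. $B_n=\mathbb{Z}_2^n\rtimes S_n$ acts on $V=\mathbb{C}^n$ by signed permutations of the standard basis. $\mathcal{C}l_n$ is the Clifford superalgebra with odd generators $c_1,\dots,c_n$, $c_i^2=1$, $c_ic_j=-c_jc_i$ ($i\neq j$),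 on which $B_n$ acts by automorphisms through signed permutations of the $c_i$. $\mathfrak{H}^{\mathfrak c}_{B_n}=\mathcal{C}l_n\rtimes B_n$ is the semidirect (smash) product superalgebra with elements of $B_n$ even. For a $B_n$-module $M$, $\mathcal{C}l_n\otimes M$ is an $\mathfrak{H}^{\mathfrak c}_{B_n}$-module with $\mathcal{C}l_n$ acting by left multiplication on the first factor and $B_n$ diagonally. $K^\lambda=\mathcal{C}l_n\otimes S^\lambda$, where $S^\lambda$ is the Specht module of $S_n$ (with $S^{(n)}$ trivial) regarded as a $B_n$-module through $B_n\to S_n$. *)

(* Defs.v *)
From HB Require Import structures.
From mathcomp Require Import all_boot all_order all_algebra all_fingroup.
From mathcomp Require Import falgebra fraction mpoly.
From mathcomp Require Import boolp.

Set Implicit Arguments.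
Unset Strict Implicit.
Unset Printing Implicit Defensive.

Import GRing.Theory.
Local Open Scope ring_scope.

Section Span.
Variables (F : fieldType) (vT : vectType F) (P : vT -> Prop).

Lemma vspan_subproof : exists s : seq vT,
  (forall v, v \in s -> P v) /\ (forall v, P v -> v \in <<s>>%VS).
Proof.
pose Q k := `[< exists s : seq vT, (forall v, v \in s -> P v) /\ \dim <<s>> = k >].
have Q0 : exists k, Q k.
  by exists (\dim <<[::] : seq vT>>)%VS; apply/asboolP; exists [::]; split.
have Qub k : Q k -> (k <= \dim {:vT})%N.
  by move=> /asboolP[s [_ <-]]; apply/dimvS/subvf.
case: (ex_maxnP Q0 Qub) => k /asboolP[s [sP sk]] kmax.
exists s; split=> // v Pv.
have Qv : Q (\dim <<v :: s>>)%VS.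
  apply/asboolP; exists (v :: s); split=> // w.
  by rewrite inE => /predU1P[->|/sP].
have := kmax _ Qv; rewrite -sk => le_dim.
have sub : (<<s>> <= <<v :: s>>)%VS.
  by apply/sub_span => w ws; rewrite inE ws orbT.
have /eqP -> : (<<s>> == <<v :: s>>)%VS by rewrite eqEdim sub.
by apply/memv_span; rewrite mem_head.
Qed.

Definition vspan : {vspace vT} := <<projT1 (cid vspan_subproof)>>%VS.

Lemma vspan_mem v : P v -> v \in vspan.
Proof. by case: (projT2 (cid vspan_subproof)) => _; apply. Qed.

Lemma vspan_sub (W : {vspace vT}) :
  (forall v, P v -> v \in W) -> (vspan <= W)%VS.
Proof.
case: (projT2 (cid vspan_subproof)) => sP _ WP.
by apply/span_subvP => v /sP /WP.
Qed.

Lemma vspanP v : P 0 -> (forall k u w, P u -> P w -> P (k *: u + w)) ->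
  v \in vspan <-> P v.
Proof.
move=> P0 PD; split; last exact: vspan_mem.
rewrite /vspan; case: (cid vspan_subproof) => /= s [sP _] vs.
rewrite (coord_span (X := in_tuple s) vs).
apply: big_ind => [//|u w Pu Pw|i _]; first by rewrite -[u]scale1r; apply: PD.
by rewrite -[_ *: _]addr0; apply: PD => //; apply/sP/mem_nth.
Qed.

End Span.

(* Degrees in Z/2 are booleans: false is even, true is odd. *)
Record superalg (F : fieldType) := SuperAlg {
  salg :> falgType F;
  sadeg : bool -> {vspace salg};
  sadeg_full : (sadeg false + sadeg true = fullv)%VS;
  sadeg_cap : (sadeg false :&: sadeg true = 0)%VS;
  sadeg1 : 1 \in sadeg false;
  sadegM : forall p q a b,
    a \in sadeg p -> b \in sadeg q -> a * b \in sadeg (p (+) q)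
}.

Record supermod (F : fieldType) (A : superalg F) := SuperMod {
  smod :> vectType F;
  smdeg : bool -> {vspace smod};
  sact : {linear A -> 'End(smod)};
  smdeg_full : (smdeg false + smdeg true = fullv)%VS;
  smdeg_cap : (smdeg false :&: smdeg true = 0)%VS;
  sact1 : sact 1 = \1%VF;
  sactM : forall a b, sact (a * b) = (sact a \o sact b)%VF;
  sact_deg : forall p q a m,
    a \in sadeg A p -> m \in smdeg q -> sact a m \in smdeg (p (+) q)
}.

Section SuperHom.
Variables (F : fieldType) (A : superalg F) (M N : supermod A).

Definition is_superhom (p : bool) (f : 'Hom(M, N)) : Prop :=
  (forall q m, m \in smdeg M q -> f m \in smdeg N (p (+) q)) /\
  (forall q a m, a \in sadeg A q ->
     f (sact M a m) = (-1) ^+ (p && q) *: sact N a (f m)).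

(* All homogeneous maps count, so the dimension adds the even and odd parts. *)
Definition superHom : {vspace 'Hom(M, N)} :=
  vspan (fun f => exists p, is_superhom p f).

End SuperHom.

Record grep (F : fieldType) (G : finGroupType) := GRep {
  gmod :> vectType F;
  gact : G -> 'End(gmod);
  gact1 : gact 1%g = \1%VF;
  gactM : forall g h, gact (g * h)%g = (gact g \o gact h)%VF
}.

(* (e, s) is the signed permutation e_i |-> (-1)^(e i) e_(s i), and products
   are compositions of maps (the right factor acts first); recall that the
   library's product of permutations composes in the opposite order. *)
Definition hypoct (n : nat) : Type := ({ffun 'I_n -> bool} * 'S_n)%type.

Section Hypoct.
Variable n : nat.
Implicit Types g h : hypoct n.

HB.instance Definition _ :=
  Finite.copy (hypoct n) ({ffun 'I_n -> bool} * 'S_n)%type.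

Definition hmul g h : hypoct n :=
  ([ffun i => h.1 i (+) g.1 (h.2 i)], (h.2 * g.2)%g).
Definition hone : hypoct n := ([ffun=> false], 1%g).
Definition hinv g : hypoct n := ([ffun i => g.1 ((g.2)^-1%g i)], (g.2)^-1%g).

Lemma hmulA : associative hmul.
Proof.
move=> g h k; congr (_, _) => /=; last by rewrite mulgA.
by apply/ffunP=> i; rewrite !ffunE permM addbA.
Qed.

Lemma hmul1 : left_id hone hmul.
Proof.
case=> e s; congr (_, _) => /=; last by rewrite mulg1.
by apply/ffunP=> i; rewrite !ffunE addbF.
Qed.

Lemma hmulV : left_inverse hone hinv hmul.
Proof.
case=> e s; congr (_, _) => /=; last by rewrite mulgV.
by apply/ffunP=> i; rewrite !ffunE /= permK addbb.
Qed.

HB.instance Definition _ := Finite_isGroup.Build (hypoct n) hmulA hmul1 hmulV.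

Lemma hmul2E g h : (g * h)%g.2 = (h.2 * g.2)%g. Proof. by []. Qed.
Lemma hmul1E g h i : (g * h)%g.1 i = h.1 i (+) g.1 (h.2 i).
Proof. by rewrite [LHS]ffunE. Qed.
Lemma hone2E : (1%g : hypoct n).2 = 1%g. Proof. by []. Qed.
Lemma hone1E i : (1%g : hypoct n).1 i = false. Proof. by rewrite ffunE. Qed.

End Hypoct.

(* Coordinates with respect to the basis c_A = c_(i_1) ... c_(i_k), where
   A = {i_1 < ... < i_k}; c_A c_B is +/- c_(A + B), with A + B the symmetric
   difference and with the sign counting the pairs a > b, a in A, b in B. *)
Definition cliff (F : fieldType) (n : nat) : Type := {ffun {set 'I_n} -> F}.

Definition csum n (A B : {set 'I_n}) : {set 'I_n} :=
  [set i | (i \in A) (+) (i \in B)].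

Definition csign n (A B : {set 'I_n}) : bool :=
  odd (\sum_(i in A) #|[set j : 'I_n | (j \in B) && (j < i)%N]|).

Section Csum.
Variable n : nat.
Implicit Types A B C : {set 'I_n}.

Lemma csumA A B C : csum A (csum B C) = csum (csum A B) C.
Proof. by apply/setP => i; rewrite !inE addbA. Qed.
Lemma csumC A B : csum A B = csum B A.
Proof. by apply/setP => i; rewrite !inE addbC. Qed.
Lemma csum0 A : csum set0 A = A.
Proof. by apply/setP => i; rewrite !inE. Qed.
Lemma csumK A : involutive (csum A).
Proof. by move=> B; apply/setP => i; rewrite !inE addKb. Qed.
Lemma csumv A : csum A A = set0.
Proof. by apply/setP => i; rewrite !inE addbb. Qed.

Lemma csignE A B : csign A B =
  \big[addb/false]_(i : 'I_n) \big[addb/false]_(j : 'I_n | (j < i)%N) ((i \in A) && (j \in B)).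
Proof.
rewrite /csign (big_morph odd oddD (erefl : odd 0 = false)) big_mkcond /=.
apply: eq_bigr => i _; case: (i \in A) => /=; last by rewrite big1.
rewrite -sum1_card (big_morph odd oddD (erefl : odd 0 = false)).
rewrite big_mkcond [RHS]big_mkcond /=.
by apply: eq_bigr => j _; rewrite inE andbC; case: ltnP => _; case: (j \in B).
Qed.

Lemma csignDl A B C : csign (csum A B) C = csign A C (+) csign B C.
Proof.
rewrite !csignE -big_split /=; apply: eq_bigr => i _.
by rewrite -big_split /=; apply: eq_bigr => j _; rewrite inE andb_addl.
Qed.
Lemma csignDr A B C : csign A (csum B C) = csign A B (+) csign A C.
Proof.
rewrite !csignE -big_split /=; apply: eq_bigr => i _.
by rewrite -big_split /=; apply: eq_bigr => j _; rewrite inE andb_addr.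
Qed.
Lemma csign0l A : csign set0 A = false.
Proof. by have := csignDl set0 set0 A; rewrite csumv addbb. Qed.
Lemma csign0r A : csign A set0 = false.
Proof. by have := csignDr A set0 set0; rewrite csumv addbb. Qed.

End Csum.

Section Cliff.
Variables (F : fieldType) (n : nat).
Local Notation Cl := (cliff F n).

HB.instance Definition _ := Vector.copy Cl {ffun {set 'I_n} -> F^o}.

Definition cmul (a b : Cl) : Cl :=
  [ffun C => \sum_A (-1) ^+ csign A (csum A C) * (a A * b (csum A C))].
Definition cone : Cl := [ffun C => (C == set0)%:R].

Lemma cmulA : associative cmul.
Proof.
move=> a b c; apply/ffunP => D; rewrite !ffunE.
under eq_bigr do rewrite ffunE !mulr_sumr.
under [RHS]eq_bigr do rewrite ffunE mulr_suml mulr_sumr.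
rewrite [RHS]exchange_big /=; apply: eq_bigr => A _.
rewrite (reindex_inj (can_inj (csumK A))) /=; apply: eq_bigr => E _.
have -> : csum (csum A E) (csum A D) = csum E D.
  by rewrite (csumC A E) -csumA csumK.
have sgn : (-1) ^+ csign A (csum A D) * (-1) ^+ csign (csum A E) (csum E D)
   = (-1) ^+ csign E (csum E D) * (-1) ^+ csign A (csum A E) :> F.
  rewrite -!signr_addb; congr (_ ^+ nat_of_bool _); rewrite csignDl !csignDr.
  by do !case: csign.
by rewrite (mulrCA (a A)) [LHS]mulrA sgn -!mulrA.
Qed.

Lemma cmul1l : left_id cone cmul.
Proof.
move=> a; apply/ffunP => C; rewrite ffunE (bigD1 set0) //= big1 => [|A /negPf nA].
  by rewrite csum0 csign0l ffunE eqxx !mul1r addr0.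
by rewrite ffunE nA mul0r mulr0.
Qed.

Lemma cmul1r : right_id cone cmul.
Proof.
move=> a; apply/ffunP => C; rewrite ffunE (bigD1 C) //= big1 => [|A nA].
  by rewrite csumv csign0r ffunE eqxx mul1r mulr1 addr0.
rewrite ffunE; case: eqP => [E|]; last by rewrite !mulr0.
by case/eqP: nA; rewrite -[C](csumK A) E csumC csum0.
Qed.

Lemma cmulDl : left_distributive cmul +%R.
Proof.
move=> a b c; apply/ffunP => C; rewrite !ffunE -big_split /=.
by apply: eq_bigr => A _; rewrite ffunE mulrDl mulrDr.
Qed.

Lemma cmulDr : right_distributive cmul +%R.
Proof.
move=> a b c; apply/ffunP => C; rewrite !ffunE -big_split /=.
by apply: eq_bigr => A _; rewrite ffunE !mulrDr.
Qed.

Lemma cone_neq0 : cone != 0.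
Proof.
by apply/eqP => /ffunP/(_ set0)/eqP; rewrite !ffunE eqxx oner_eq0.
Qed.

HB.instance Definition _ := GRing.Zmodule_isNzRing.Build Cl
  cmulA cmul1l cmul1r cmulDl cmulDr cone_neq0.

Lemma cmulZl (k : F) (a b : Cl) : k *: (a * b) = (k *: a) * b.
Proof.
apply/ffunP => C; rewrite !ffunE scaler_sumr; apply: eq_bigr => A _.
by rewrite ffunE /GRing.scale /= mulrCA !mulrA.
Qed.

Lemma cmulZr (k : F) (a b : Cl) : k *: (a * b) = a * (k *: b).
Proof.
apply/ffunP => C; rewrite !ffunE scaler_sumr; apply: eq_bigr => A _.
by rewrite ffunE /GRing.scale /= mulrCA (mulrCA k).
Qed.

HB.instance Definition _ := GRing.Lmodule_isLalgebra.Build F Cl cmulZl.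
HB.instance Definition _ := GRing.Lalgebra_isAlgebra.Build F Cl cmulZr.
HB.instance Definition _ := Algebra_isFalgebra.Build F Cl.

Definition cbase (A : {set 'I_n}) : Cl := [ffun B => (B == A)%:R].
Definition cgen (i : 'I_n) : Cl := cbase [set i].

Lemma cliffE (a : Cl) : a = \sum_A a A *: cbase A.
Proof.
apply/ffunP => B; rewrite sum_ffunE (bigD1 B) //= big1 => [|A nA].
  by rewrite !ffunE eqxx /GRing.scale /= mulr1 addr0.
by rewrite !ffunE eq_sym (negPf nA) scaler0.
Qed.

Lemma cbaseM A B : cbase A * cbase B = (-1) ^+ csign A B *: cbase (csum A B).
Proof.
apply/ffunP => C; rewrite !ffunE (bigD1 A) //= big1 => [|D nD]; last first.
  by rewrite !ffunE (negPf nD) mul0r mulr0.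
rewrite !ffunE eqxx mul1r addr0 /GRing.scale /=.
have -> : (csum A C == B) = (C == csum A B).
  by apply/eqP/eqP => [<-|->]; rewrite csumK.
by case: eqP => [->|]; rewrite ?csumK ?mulr0.
Qed.

Lemma cbase0 : cbase set0 = 1. Proof. by []. Qed.

Lemma csign11 (i j : 'I_n) : csign [set i] [set j] = (j < i)%N.
Proof.
rewrite /csign big_set1; case: ltnP => ji.
  rewrite (_ : [set _ | _] = [set j]) ?cards1 //; apply/setP => k.
  by rewrite !inE; case: eqP => // ->.
rewrite (_ : [set _ | _] = set0) ?cards0 //; apply/setP => k.
by rewrite !inE; case: eqP => // ->; rewrite ltnNge ji.
Qed.

Lemma cgen_sqr i : cgen i * cgen i = 1.
Proof. by rewrite cbaseM csumv csign11 ltnn scale1r. Qed.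

Lemma cgen_anti i j : i != j -> cgen i * cgen j = - (cgen j * cgen i).
Proof.
move=> ij; rewrite !cbaseM !csign11 csumC -scaleNr; congr (_ *: _).
by have := ij; rewrite -val_eqE /= neq_ltn; case: ltngtP; rewrite ?opprK.
Qed.

End Cliff.

(* This is multiplicative when the d i satisfy the Clifford relations. *)
Section CliffEval.
Variables (F : fieldType) (n : nat) (A : algType F) (d : 'I_n -> A).

Definition ceval (a : cliff F n) : A :=
  \sum_(B : {set 'I_n}) a B *: \prod_(i in B) d i.

Lemma ceval_is_linear : linear ceval.
Proof.
move=> k a b; rewrite /ceval scaler_sumr -big_split /=; apply: eq_bigr => B _.
by rewrite !ffunE scalerDl scalerA.
Qed.
HB.instance Definition _ := GRing.isLinear.Build F (cliff F n) A _ ceval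
  ceval_is_linear.

Lemma ceval_base B : ceval (cbase F B) = \prod_(i in B) d i.
Proof.
rewrite /ceval (bigD1 B) //= [X in _ + X]big1 => [|C nC].
  by rewrite ffunE eqxx scale1r addr0.
by rewrite ffunE (negPf nC) scale0r.
Qed.

Lemma ceval_gen i : ceval (cgen F i) = d i.
Proof. by rewrite ceval_base big_set1. Qed.

Lemma ceval1 : ceval 1 = 1.
Proof. by rewrite -cbase0 ceval_base big_set0. Qed.

Hypothesis d_sqr : forall i, d i * d i = 1.
Hypothesis d_anti : forall i j, i != j -> d i * d j = - (d j * d i).

Let P (r : seq 'I_n) (B : {set 'I_n}) := \prod_(i <- r | i \in B) d i.
Let sg (r : seq 'I_n) (B C : {set 'I_n}) : bool :=
  \big[addb/false]_(i <- r) \big[addb/false]_(j <- r | (j < i)%N)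
    ((i \in B) && (j \in C)).
Let ct (r : seq 'I_n) (B : {set 'I_n}) : bool :=
  \big[addb/false]_(i <- r) (i \in B).

Let P_comm r i B : i \notin r -> P r B * d i = (-1) ^+ ct r B *: (d i * P r B).
Proof.
elim: r => [|j r IH]; first by rewrite /P /ct !big_nil mulr1 mul1r scale1r.
rewrite inE negb_or => /andP[ij ir]; rewrite /P /ct !big_cons -/(P r B) -/(ct r B).
case: ifP => jB; last by rewrite addFb IH.
have ji : j != i by rewrite eq_sym.
rewrite -mulrA IH // -scalerAr (mulrA (d j)) (d_anti ji) mulNr scalerN -mulrA.
by rewrite signr_addb mulN1r scaleNr.
Qed.

Let PM r B C : sorted ltn (map val r) ->
  P r B * P r C = (-1) ^+ sg r B C *: P r (csum B C).
Proof.
elim: r => [|i r IH] /= srt; first by rewrite /P /sg !big_nil mulr1 scale1r.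
have /allP lt_ir := order_path_min ltn_trans srt.
have ir : i \notin r.
  by apply/negP => /(map_f val)/lt_ir; rewrite ltnn.
have Pi D : P (i :: r) D = d i ^+ (i \in D) * P r D.
  by rewrite /P big_cons; case: (i \in D); rewrite ?mul1r.
have sgi : sg (i :: r) B C = ((i \in C) && ct r B) (+) sg r B C.
  rewrite /sg big_cons big_cons ltnn big1_seq ?addFb => [|j /andP[ji jr]].
    rewrite /ct big_distrr -big_split /=; apply: eq_big_seq => j jr.
    by rewrite big_cons (lt_ir _ (map_f val jr)) andbC.
  by have := lt_ir _ (map_f val jr); rewrite /= ltnNge ltnW.
have {}IH := IH (path_sorted srt).
rewrite !Pi sgi inE signr_addb -scalerA (scalerAr _ (d i ^+ _)) -IH.
case: (i \in C) => /=; last by rewrite scale1r addbF mul1r !mulrA.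
rewrite addbT -mulrA (mulrA (P r B)) P_comm // -scalerAl -scalerAr.
congr (_ *: _); rewrite -mulrA; case: (i \in B) => /=; last by rewrite !mul1r.
by rewrite mulrA d_sqr.
Qed.

Lemma ceval_prodM (B C : {set 'I_n}) : (\prod_(i in B) d i) * (\prod_(i in C) d i) =
  (-1) ^+ csign B C *: \prod_(i in csum B C) d i.
Proof.
rewrite csignE; apply: (PM B C).
rewrite /index_enum -enumT val_enum_ord; exact: iota_ltn_sorted.
Qed.

Lemma cevalM a b : ceval (a * b) = ceval a * ceval b.
Proof.
rewrite [a]cliffE [b]cliffE mulr_suml !linear_sum mulr_suml.
apply: eq_bigr => B _; rewrite mulr_sumr !linear_sum mulr_sumr.
apply: eq_bigr => C _.
rewrite -scalerAl -scalerAr cbaseM !linearZ /= !ceval_base -ceval_prodM.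
by rewrite -scalerAl -scalerAr.
Qed.

End CliffEval.

Lemma prod_cgen (F : fieldType) n (A : {set 'I_n}) :
  \prod_(i in A) cgen F i = cbase F A.
Proof.
move: {2}#|A| (leqnn #|A|) => m; elim: m A => [|m IH] A.
  by rewrite leqn0 cards_eq0 => /eqP->; rewrite big_set0.
case: (set_0Vmem A) => [-> _|[x xA] Am]; first by rewrite big_set0.
have EA : A = csum [set x] (A :\ x).
  by apply/setP => i; rewrite !inE; case: eqP => // ->; rewrite xA.
have := ceval_prodM (@cgen_sqr F n) (@cgen_anti F n) [set x] (A :\ x).
rewrite -EA big_set1 (IH (A :\ x)); last first.
  by move: Am; rewrite (cardsD1 x) xA add1n ltnS.
move/(congr1 (fun u => (-1) ^+ csign [set x] (A :\ x) *: u)).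
rewrite cbaseM -EA !scalerA -signr_addb addbb !scale1r.
by [].
Qed.

Section CliffAct.
Variables (F : fieldType) (n : nat).
Implicit Types (g h : hypoct n) (a b : cliff F n).

Definition cact_gen g (i : 'I_n) : cliff F n := (-1) ^+ g.1 i *: cgen F (g.2 i).

Definition cact g : cliff F n -> cliff F n := ceval (cact_gen g).
HB.instance Definition _ g := GRing.Linear.on (cact g).

Lemma cact_gen_sqr g i : cact_gen g i * cact_gen g i = 1.
Proof.
by rewrite -scalerAl -scalerAr scalerA -signr_addb addbb scale1r cgen_sqr.
Qed.

Lemma cact_gen_anti g i j : i != j ->
  cact_gen g i * cact_gen g j = - (cact_gen g j * cact_gen g i).
Proof.
move=> ij; rewrite -!scalerAl -!scalerAr !scalerA cgen_anti ?(inj_eq perm_inj) //.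
by rewrite scalerN mulrC.
Qed.

Lemma cactM g a b : cact g (a * b) = cact g a * cact g b.
Proof. exact: (cevalM (cact_gen_sqr g) (@cact_gen_anti g)). Qed.

Lemma cact1 g : cact g 1 = 1. Proof. exact: ceval1. Qed.

Lemma cact_cgen g i : cact g (cgen F i) = (-1) ^+ g.1 i *: cgen F (g.2 i).
Proof. exact: ceval_gen. Qed.

Lemma cactE g a :
  cact g a = \sum_A a A *: \prod_(i in A) cact g (cgen F i).
Proof.
rewrite /cact {1}/ceval; apply: eq_bigr => A _; congr (_ *: _).
by apply: eq_bigr => i _; rewrite ceval_gen.
Qed.

Lemma cact_id a : cact 1%g a = a.
Proof.
rewrite [in RHS](cliffE a) /cact /ceval; apply: eq_bigr => A _.
congr (_ *: _); rewrite -prod_cgen; apply: eq_bigr => i _.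
by rewrite /cact_gen hone1E hone2E perm1 scale1r.
Qed.

Lemma cact_comp g h a : cact (g * h)%g a = cact g (cact h a).
Proof.
rewrite cactE (cactE h) linear_sum; apply: eq_bigr => A _.
rewrite [RHS]linearZ /=; congr (_ *: _).
rewrite (big_morph (cact g) (cactM g) (cact1 g)); apply: eq_bigr => i _.
rewrite !cact_cgen linearZ /= cact_cgen hmul1E ?hmul2E permM.
by rewrite scalerA signr_addb.
Qed.

End CliffAct.

(* The function x stands for the sum of the elements (x g) g, and
   (a g) (b h) = (a (g b)) (g h) for a, b in the Clifford algebra. *)
Definition hclif (F : fieldType) (n : nat) : Type := {ffun hypoct n -> cliff F n}.

Section Hclif.
Variables (F : fieldType) (n : nat).
Local Notation H := (hclif F n).
Implicit Types (g h : hypoct n) (x y z : H).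

HB.instance Definition _ := Vector.copy H {ffun hypoct n -> cliff F n}.

Definition hcmul x y : H :=
  [ffun k => \sum_g x g * cact g (y (g^-1 * k)%g)].
Definition hcone : H := [ffun k => (k == 1%g)%:R].

Lemma hcmulA : associative hcmul.
Proof.
move=> x y z; apply/ffunP => k; rewrite !ffunE.
under eq_bigr do rewrite ffunE linear_sum mulr_sumr.
under [RHS]eq_bigr do rewrite ffunE mulr_suml.
rewrite [RHS]exchange_big /=; apply: eq_bigr => g _.
rewrite [RHS](reindex_inj (mulgI g)) /=; apply: eq_bigr => h _.
by rewrite mulKg cactM mulrA invMg mulgA -cact_comp.
Qed.

Lemma hcmul1l : left_id hcone hcmul.
Proof.
move=> x; apply/ffunP => k; rewrite ffunE (bigD1 1%g) //=.
rewrite [X in _ + X]big1 => [|g /negPf ng]; last by rewrite ffunE ng mul0r.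
by rewrite ffunE eqxx invg1 mul1g cact_id mul1r addr0.
Qed.

Lemma hcmul1r : right_id hcone hcmul.
Proof.
move=> x; apply/ffunP => k; rewrite ffunE (bigD1 k) //=.
rewrite [X in _ + X]big1 => [|g ng].
  by rewrite ffunE mulVg eqxx cact1 mulr1 addr0.
rewrite ffunE; case: eqP => [E|]; last by rewrite linear0 mulr0.
by case/eqP: ng; rewrite -[k](mulKVg g) E mulg1.
Qed.

Lemma hcmulDl : left_distributive hcmul +%R.
Proof.
move=> x y z; apply/ffunP => k; rewrite !ffunE -big_split /=.
by apply: eq_bigr => g _; rewrite ffunE mulrDl.
Qed.

Lemma hcmulDr : right_distributive hcmul +%R.
Proof.
move=> x y z; apply/ffunP => k; rewrite !ffunE -big_split /=.
by apply: eq_bigr => g _; rewrite ffunE linearD mulrDr.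
Qed.

Lemma hcone_neq0 : hcone != 0.
Proof.
by apply/eqP => /ffunP/(_ 1%g)/eqP; rewrite !ffunE eqxx oner_eq0.
Qed.

HB.instance Definition _ := GRing.Zmodule_isNzRing.Build H
  hcmulA hcmul1l hcmul1r hcmulDl hcmulDr hcone_neq0.

Lemma hcmulZl (c : F) x y : c *: (x * y) = (c *: x) * y.
Proof.
apply/ffunP => k; rewrite !ffunE scaler_sumr; apply: eq_bigr => g _.
by rewrite ffunE scalerAl.
Qed.

Lemma hcmulZr (c : F) x y : c *: (x * y) = x * (c *: y).
Proof.
apply/ffunP => k; rewrite !ffunE scaler_sumr; apply: eq_bigr => g _.
by rewrite ffunE linearZ /= scalerAr.
Qed.

HB.instance Definition _ := GRing.Lmodule_isLalgebra.Build F H hcmulZl.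
HB.instance Definition _ := GRing.Lalgebra_isAlgebra.Build F H hcmulZr.
HB.instance Definition _ := Algebra_isFalgebra.Build F H.

Lemma hcmulE x y k : (x * y) k = \sum_g x g * cact g (y (g^-1 * k)%g).
Proof. by rewrite [LHS]ffunE. Qed.
Lemma hconeE k : (1 : H) k = (k == 1%g)%:R.
Proof. by rewrite [LHS]ffunE. Qed.

End Hclif.

Section Parity.
Variables (F : fieldType) (n : nat).
Implicit Types (a b : cliff F n) (A B C : {set 'I_n}) (g : hypoct n).

Definition is_cdeg (p : bool) a : Prop := forall B, odd #|B| != p -> a B = 0.

Lemma odd_csum A B : odd #|csum A B| = odd #|A| (+) odd #|B|.
Proof.
have E (C : {set 'I_n}) : odd #|C| = \big[addb/false]_(i : 'I_n) (i \in C).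
  rewrite -sum1_card (big_morph odd oddD (erefl : odd 0 = false)) big_mkcond.
  by apply: eq_bigr => i _; case: (i \in C).
by rewrite !E -big_split; apply: eq_bigr => i _; rewrite inE.
Qed.

Lemma is_cdeg0 p : is_cdeg p 0. Proof. by move=> B _; rewrite ffunE. Qed.

Lemma is_cdegD p a b : is_cdeg p a -> is_cdeg p b -> is_cdeg p (a + b).
Proof. by move=> pa pb B pB; rewrite ffunE pa ?pb ?addr0. Qed.

Lemma is_cdegZ p (k : F) a : is_cdeg p a -> is_cdeg p (k *: a).
Proof. by move=> pa B pB; rewrite ffunE pa ?scaler0. Qed.

Lemma is_cdeg_base A : is_cdeg (odd #|A|) (cbase F A).
Proof. by move=> B nB; rewrite ffunE; case: (B =P A) nB => // ->; rewrite eqxx. Qed.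

Lemma is_cdeg1 : is_cdeg false 1.
Proof. by have := @is_cdeg_base set0; rewrite cards0. Qed.

Lemma is_cdegM p q a b : is_cdeg p a -> is_cdeg q b -> is_cdeg (p (+) q) (a * b).
Proof.
move=> pa qb C pqC; rewrite [LHS]ffunE big1 // => A _.
case: (boolP (odd #|A| == p)) => [/eqP Ap|/pa ->]; last by rewrite mul0r mulr0.
rewrite qb ?mulr0 //; apply: contra pqC => /eqP <-.
by rewrite odd_csum Ap addKb.
Qed.

Lemma is_cdeg_act p g a : is_cdeg p a -> is_cdeg p (cact g a).
Proof.
move=> pa; rewrite cactE; apply: big_ind => [||A _].
- exact: is_cdeg0.
- by move=> *; apply: is_cdegD.
case: (boolP (odd #|A| == p)) => [/eqP <-|/pa ->]; last first.
  by rewrite scale0r; apply: is_cdeg0.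
apply: is_cdegZ; rewrite -sum1_card (big_morph odd oddD (erefl : odd 0 = false)).
elim/big_rec2: _ => [|i b c _ cb]; first exact: is_cdeg1.
apply: is_cdegM => //; rewrite cact_cgen; apply: is_cdegZ.
by have := @is_cdeg_base [set g.2 i]; rewrite cards1.
Qed.

Definition hdeg (p : bool) : {vspace hclif F n} :=
  vspan (fun x : hclif F n => forall g, is_cdeg p (x g)).

Lemma hdegP p (x : hclif F n) : x \in hdeg p <-> forall g, is_cdeg p (x g).
Proof.
apply: vspanP => [g|k u w pu pw g]; first by rewrite ffunE; apply: is_cdeg0.
by rewrite !ffunE; apply: is_cdegD => //; apply: is_cdegZ.
Qed.

Lemma hdeg_full : (hdeg false + hdeg true = fullv)%VS.
Proof.
apply/eqP; rewrite eqEsubv subvf; apply/subvP => x _.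
pose y p : hclif F n :=
  [ffun g => [ffun B : {set 'I_n} => if odd #|B| == p then x g B else 0] : cliff F n].
have -> : x = y false + y true.
  apply/ffunP => g; apply/ffunP => B; rewrite !ffunE.
  by case: (odd _); rewrite ?addr0 ?add0r.
by apply: memv_add; apply/hdegP => g B /negPf pB; rewrite !ffunE pB.
Qed.

Lemma hdeg_cap : (hdeg false :&: hdeg true = 0)%VS.
Proof.
apply/eqP; rewrite -subv0; apply/subvP => x.
rewrite memv_cap => /andP[/hdegP x0 /hdegP x1]; rewrite memv0.
apply/eqP/ffunP => g; apply/ffunP => B; rewrite !ffunE.
by case: (boolP (odd #|B|)) => oB; [apply: x0|apply: x1]; rewrite ?oB // (negPf oB).
Qed.

Lemma hdeg1 : 1 \in hdeg false.
Proof.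
apply/hdegP => g; rewrite hconeE; case: eqP => _; first exact: is_cdeg1.
exact: is_cdeg0.
Qed.

Lemma hdegM p q x y : x \in hdeg p -> y \in hdeg q -> x * y \in hdeg (p (+) q).
Proof.
move=> /hdegP px /hdegP qy; apply/hdegP => k; rewrite hcmulE.
apply: big_ind => [||g _]; [exact: is_cdeg0|by move=> *; apply: is_cdegD|].
by apply: is_cdegM => //; apply: is_cdeg_act.
Qed.

Definition hclif_superalg : superalg F :=
  SuperAlg hdeg_full hdeg_cap hdeg1 hdegM.

End Parity.

(* Cl_n (x) M, as coordinates in M with respect to the basis c_A of Cl_n *)
Definition ctens (F : fieldType) (n : nat) (M : vectType F) : Type :=
  {ffun {set 'I_n} -> M}.

HB.instance Definition _ (F : fieldType) n (M : vectType F) :=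
  Vector.copy (ctens n M) {ffun {set 'I_n} -> M}.

Section Tensor.
Variables (F : fieldType) (n : nat) (M : grep F (hypoct n)).
Local Notation H := (hclif_superalg F n).
Local Notation CM := (ctens n M).
Implicit Types (a b : cliff F n) (v : M) (g h : hypoct n) (m : CM).

Definition tens a v : CM := [ffun B => a B *: v].

(* (x g) (c_B (x) v) = x (g c_B) (x) (g v) for x in Cl_n and g in B_n *)
Definition tact_fun (x : H) m : CM :=
  \sum_g \sum_B tens (x g * cact g (cbase F B)) (gact M g (m B)).

Lemma tensDl a b v : tens (a + b) v = tens a v + tens b v.
Proof. by apply/ffunP => B; rewrite !ffunE scalerDl. Qed.
Lemma tensZl (k : F) a v : tens (k *: a) v = k *: tens a v.
Proof. by apply/ffunP => B; rewrite !ffunE scalerA. Qed.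
Lemma tensZr (k : F) a v : tens a (k *: v) = k *: tens a v.
Proof. by apply/ffunP => B; rewrite !ffunE !scalerA mulrC. Qed.
Lemma tensDr a v w : tens a (v + w) = tens a v + tens a w.
Proof. by apply/ffunP => B; rewrite !ffunE scalerDr. Qed.
Lemma tens_sumr I (r : seq I) P a (f : I -> M) :
  tens a (\sum_(i <- r | P i) f i) = \sum_(i <- r | P i) tens a (f i).
Proof.
apply: (big_morph (tens a)); first exact: tensDr.
by apply/ffunP => B; rewrite !ffunE scaler0.
Qed.
Lemma tens_suml I (r : seq I) P (f : I -> cliff F n) v :
  tens (\sum_(i <- r | P i) f i) v = \sum_(i <- r | P i) tens (f i) v.
Proof.
apply: (big_morph (tens^~ v)) => [a b|]; first exact: tensDl.
by apply/ffunP => B; rewrite !ffunE scale0r.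
Qed.

Lemma ctensE m : m = \sum_B tens (cbase F B) (m B).
Proof.
apply/ffunP => B; rewrite sum_ffunE (bigD1 B) //= big1 => [|A nA].
  by rewrite !ffunE eqxx scale1r addr0.
by rewrite !ffunE eq_sym (negPf nA) scale0r.
Qed.

Lemma tact_is_linear x : linear (tact_fun x).
Proof.
move=> k m1 m2; rewrite /tact_fun scaler_sumr -big_split /=.
apply: eq_bigr => g _; rewrite scaler_sumr -big_split /=; apply: eq_bigr => B _.
by rewrite !ffunE linearP tensDr tensZr.
Qed.
HB.instance Definition _ x := GRing.isLinear.Build F CM CM _ (tact_fun x)
  (tact_is_linear x).

Lemma tact_fun_sum x I (r : seq I) (P : pred I) (f : I -> CM) :
  tact_fun x (\sum_(i <- r | P i) f i) = \sum_(i <- r | P i) tact_fun x (f i).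
Proof. exact: linear_sum. Qed.

Definition tact (x : H) : 'End(CM) := linfun (tact_fun x).

Lemma tactE x m : tact x m = tact_fun x m. Proof. exact: lfunE. Qed.

Lemma tact_linear : linear tact.
Proof.
move=> k x y; apply/lfunP => m; rewrite !lfunE /= lfunE /= !tactE /tact_fun.
rewrite scaler_sumr -big_split /=; apply: eq_bigr => g _.
rewrite scaler_sumr -big_split /=; apply: eq_bigr => B _.
by rewrite !ffunE mulrDl -scalerAl tensDl tensZl.
Qed.
HB.instance Definition _ := GRing.isLinear.Build F H 'End(CM) _ tact tact_linear.

Lemma tact_tens x a v :
  tact_fun x (tens a v) = \sum_g tens (x g * cact g a) (gact M g v).
Proof.
apply: eq_bigr => g _; rewrite {2}[a]cliffE linear_sum mulr_sumr tens_suml.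
apply: eq_bigr => B _.
by rewrite ffunE !linearZ /= -scalerAr tensZl tensZr.
Qed.

Lemma tact1 : tact 1 = \1%VF.
Proof.
apply/lfunP => m; rewrite tactE id_lfunE [m in RHS]ctensE /tact_fun.
rewrite (bigD1 1%g) //= [X in _ + X]big1 => [|g /negPf ng].
  rewrite addr0; apply: eq_bigr => B _.
  by rewrite hconeE eqxx mul1r cact_id gact1 lfunE.
rewrite big1 // => B _; rewrite hconeE ng mul0r.
by apply/ffunP => C; rewrite !ffunE scale0r.
Qed.

Lemma tactM x y : tact (x * y) = (tact x \o tact y)%VF.
Proof.
apply/lfunP => m; rewrite comp_lfunE !tactE [m]ctensE !tact_fun_sum.
apply: eq_bigr => B _; set a := cbase F B; set v := m B.
rewrite !tact_tens tact_fun_sum.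
under [RHS]eq_bigr do rewrite tact_tens.
rewrite [RHS]exchange_big /=.
under eq_bigr do rewrite hcmulE mulr_suml tens_suml.
rewrite exchange_big /=; apply: eq_bigr => g _.
rewrite (reindex_inj (mulgI g)) /=; apply: eq_bigr => h _.
by rewrite mulKg cactM mulrA cact_comp gactM comp_lfunE.
Qed.

(* M is purely even *)
Definition tdeg (p : bool) : {vspace CM} :=
  vspan (fun m : CM => forall B : {set 'I_n}, odd #|B| != p -> m B = 0).

Lemma tdegP p m :
  m \in tdeg p <-> forall B : {set 'I_n}, odd #|B| != p -> m B = 0.
Proof.
apply: vspanP => [B _|k u w pu pw B pB]; first by rewrite ffunE.
by rewrite !ffunE pu ?pw // scaler0 addr0.
Qed.

Lemma tdeg_full : (tdeg false + tdeg true = fullv)%VS.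
Proof.
apply/eqP; rewrite eqEsubv subvf; apply/subvP => m _.
pose y p : CM := [ffun B : {set 'I_n} => if odd #|B| == p then m B else 0].
have -> : m = y false + y true.
  by apply/ffunP => B; rewrite !ffunE; case: (odd _); rewrite ?addr0 ?add0r.
by apply: memv_add; apply/tdegP => B /negPf pB; rewrite !ffunE pB.
Qed.

Lemma tdeg_cap : (tdeg false :&: tdeg true = 0)%VS.
Proof.
apply/eqP; rewrite -subv0; apply/subvP => m.
rewrite memv_cap => /andP[/tdegP m0 /tdegP m1]; rewrite memv0.
apply/eqP/ffunP => B; rewrite !ffunE.
by case: (boolP (odd #|B|)) => oB; [apply: m0|apply: m1]; rewrite ?oB // (negPf oB).
Qed.

Lemma tact_deg p q (x : H) m :
  x \in sadeg H p -> m \in tdeg q -> tact x m \in tdeg (p (+) q).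
Proof.
move=> /hdegP px /tdegP qm; rewrite tactE.
apply: memv_suml => g _; apply: memv_suml => B _.
case: (boolP (odd #|B| == q)) => [/eqP <-|/qm ->]; last first.
  by rewrite linear0 (_ : tens _ 0 = 0) ?mem0v //; apply/ffunP => C;
     rewrite !ffunE scaler0.
apply/tdegP => C pC; rewrite ffunE.
by rewrite (is_cdegM (px g) (is_cdeg_act g (@is_cdeg_base F n B))) ?scale0r.
Qed.

Definition cliff_tensor : supermod H :=
  SuperMod tdeg_full tdeg_cap tact1 tactM tact_deg.

End Tensor.

(* S^k V is realized as the space of homogeneous polynomials of degree k in
   the basis vectors of V, which are the variables 'X_i. *)
Section Sym.
Variables (F : fieldType) (n : nat).
Implicit Types (g h : hypoct n) (p : {mpoly F[n]}).

Definition sym_var g : n.-tuple {mpoly F[n]} :=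
  [tuple (-1) ^+ g.1 i *: 'X_(g.2 i) | i < n].

Lemma sym_var1 p : p \mPo sym_var 1%g = p.
Proof.
rewrite -[RHS]comp_mpoly_id; congr (_ \mPo _).
by apply: eq_from_tnth => i; rewrite !tnth_mktuple hone1E hone2E perm1 scale1r.
Qed.

Lemma sym_varM g h p : p \mPo sym_var (g * h)%g = (p \mPo sym_var h) \mPo sym_var g.
Proof.
rewrite comp_mpolyEX (comp_mpolyEX p) linear_sum /=; apply: eq_bigr => m _.
rewrite linearZ /=; congr (_ *: _).
rewrite !comp_mpolyX rmorph_prod /=; apply: eq_bigr => i _.
rewrite rmorphXn /= !tnth_mktuple linearZ /= comp_mpolyXU -tnth_nth tnth_mktuple.
by rewrite hmul1E permM scalerA signr_addb.
Qed.

Lemma sym_var_homog g k p : p \is k.-homog -> p \mPo sym_var g \is k.-homog.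
Proof.
move=> /dhomogP pk; rewrite comp_mpolyEX big_seq; apply: rpred_sum => m /pk <-.
apply: rpredZ; rewrite comp_mpolyX /= mdegE.
elim/big_rec2: _ => [|i q b _ bq]; first exact: dhomog1.
apply: dhomogM => //; rewrite -[X in X.-homog]mul1n; apply: dhomogMn.
by rewrite tnth_mktuple; apply: rpredZ; rewrite dhomogX; apply/eqP/mdeg1.
Qed.

End Sym.

Section SymRep.
Variables (F : fieldType) (n k : nat).
Implicit Types (g h : hypoct n.+1) (p q : dhomog n.+1 F k).

Definition sym_act_fun g p : dhomog n.+1 F k :=
  DHomog (sym_var_homog g (dhomog_is_dhomog p)).

Lemma sym_act_is_linear g : linear (sym_act_fun g).
Proof. by move=> c p q; apply/val_inj; rewrite /= linearP. Qed.
HB.instance Definition _ g := GRing.isLinear.Build F _ _ _ (sym_act_fun g)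
  (sym_act_is_linear g).

Definition sym_act g : 'End(dhomog n.+1 F k) := linfun (sym_act_fun g).

Lemma sym_act1 : sym_act 1%g = \1%VF.
Proof. by apply/lfunP => p; rewrite !lfunE; apply/val_inj/sym_var1. Qed.

Lemma sym_actM g h : sym_act (g * h)%g = (sym_act g \o sym_act h)%VF.
Proof.
by apply/lfunP => p; rewrite comp_lfunE !lfunE; apply/val_inj/sym_varM.
Qed.

Definition sym_rep : grep F (hypoct n.+1) := GRep sym_act1 sym_actM.

End SymRep.

Definition is_partition (n : nat) (lam : seq nat) : bool :=
  [&& sorted geq lam, 0%N \notin lam & sumn lam == n].

(* Rows and columns are numbered from 0. *)
Definition cell (lam : seq nat) : finType :=
  {i : 'I_(size lam) & 'I_(nth 0%N lam i)} : finType.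

Definition row lam (c : cell lam) : 'I_(size lam) := tag c.
Definition col lam (c : cell lam) : nat := tagged c.

(* Trailing zeros in lam are harmless in all that follows. *)
Definition conj_part (lam : seq nat) : seq nat :=
  mkseq (fun j => count (fun r => j < r)%N lam) (head 0%N lam).

Definition content lam (c : cell lam) : int := (col c)%:Z - (row c : nat)%:Z.

Definition hook lam (c : cell lam) : nat :=
  ((nth 0 lam (row c) - (col c).+1) +
   (nth 0 (conj_part lam) (col c) - (row c).+1)).+1.

Definition nfun (lam : seq nat) : nat := \sum_(i < size lam) i * nth 0 lam i.

(* A tableau sends each number to the cell containing it.  Its tabloid is the
   word w giving the row of each number, and the Specht module is spanned by
   the polytabloids in the permutation module on words.  A permutation s sends
   the word w to w o s^-1. *)
Section Specht.
Variables (F : fieldType) (n : nat) (lam : seq nat).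
Local Notation word := {ffun 'I_n -> 'I_(size lam)}.
Local Notation pmod := {ffun word -> F^o}.
Implicit Types (T : {ffun 'I_n -> cell lam}) (s t : 'S_n) (w : word) (u : pmod).

Definition is_tableau T : bool :=
  injectiveb T && [forall c, c \in codom T].

Definition tabloid T : word := [ffun i => row (T i)].

Definition word_act s w : word := [ffun i => w ((s^-1)%g i)].

Definition col_stab T s : bool := [forall i, col (T (s i)) == col (T i)].

Definition polytabloid T : pmod :=
  [ffun w => \sum_(s : 'S_n | col_stab T s && (w == word_act s (tabloid T)))
     (-1) ^+ s].

Definition specht : {vspace pmod} :=
  <<[seq polytabloid T | T in is_tableau]>>%VS.

Definition pmod_act_fun s u : pmod := [ffun w => u (word_act (s^-1)%g w)].

Lemma pmod_act_is_linear s : linear (pmod_act_fun s).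
Proof. by move=> k u v; apply/ffunP => w; rewrite !ffunE. Qed.
HB.instance Definition _ s := GRing.isLinear.Build F pmod pmod _ (pmod_act_fun s)
  (pmod_act_is_linear s).

Lemma word_actM s t w : word_act s (word_act t w) = word_act (t * s)%g w.
Proof. by apply/ffunP => i; rewrite !ffunE invMg permM. Qed.

Lemma word_act1 w : word_act 1%g w = w.
Proof. by apply/ffunP => i; rewrite !ffunE invg1 perm1. Qed.

Definition tab_act s T : {ffun 'I_n -> cell lam} := [ffun i => T ((s^-1)%g i)].

Lemma tab_act_tableau s T : is_tableau T -> is_tableau (tab_act s T).
Proof.
case/andP=> /injectiveP Ti /forallP Ts; apply/andP; split.
  by apply/injectiveP => i j; rewrite !ffunE => /Ti/perm_inj.
apply/forallP => c; have /codomP[i ->] := Ts c.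
by apply/codomP; exists (s i); rewrite ffunE permK.
Qed.

Lemma pmod_act_polytabloid s T :
  pmod_act_fun s (polytabloid T) = polytabloid (tab_act s T).
Proof.
apply/ffunP => w; rewrite !ffunE.
rewrite [RHS](reindex_inj (conjg_inj s)) /=; apply: eq_big => [t|t _]; last first.
  by rewrite odd_permJ.
congr (_ && _).
  apply/forallP/forallP => H i.
    by have := H ((s^-1)%g i); rewrite !ffunE conjgE !permM permK.
  by have := H (s i); rewrite !ffunE conjgE !permM !permK.
apply/eqP/eqP => [E|->]; apply/ffunP => i.
  have /ffunP/(_ ((s^-1)%g i)) := E.
  by rewrite !ffunE invgK permKV => ->; rewrite conjgE !invMg invgK !permM permK.
by rewrite !ffunE invgK conjgE !invMg invgK !permM permK permK.
Qed.

Lemma specht_stable s u : u \in specht -> pmod_act_fun s u \in specht.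
Proof.
rewrite -[pmod_act_fun s u](lfunE (pmod_act_fun s)) => us.
have := memv_img (linfun (pmod_act_fun s)) us; apply/subvP.
rewrite /specht limg_span; apply/span_subvP => v /mapP[_ /imageP[T TT ->] ->].
rewrite lfunE /= pmod_act_polytabloid; apply/memv_span/imageP.
by exists (tab_act s T) => //; apply: tab_act_tableau.
Qed.

Definition specht_act_fun (g : hypoct n) (u : subvs_of specht) :
    subvs_of specht :=
  vsproj specht (pmod_act_fun g.2 (vsval u)).

Lemma specht_act_is_linear g : linear (specht_act_fun g).
Proof. by move=> k u v; rewrite /specht_act_fun !linearP. Qed.
HB.instance Definition _ g := GRing.isLinear.Build F _ _ _ (specht_act_fun g)
  (specht_act_is_linear g).

Definition specht_act (g : hypoct n) : 'End(subvs_of specht) :=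
  linfun (specht_act_fun g).

Lemma specht_actE g (u : subvs_of specht) :
  vsval (specht_act g u) = pmod_act_fun g.2 (vsval u).
Proof. by rewrite lfunE /= vsprojK // specht_stable ?subvsP. Qed.

Lemma specht_act1 : specht_act 1%g = \1%VF.
Proof.
apply/lfunP => u; apply/subvs_inj; rewrite specht_actE id_lfunE.
by apply/ffunP => w; rewrite ffunE hone2E invg1 word_act1.
Qed.

Lemma specht_actM g h : specht_act (g * h)%g = (specht_act g \o specht_act h)%VF.
Proof.
apply/lfunP => u; apply/subvs_inj; rewrite comp_lfunE !specht_actE.
by apply/ffunP => w; rewrite !ffunE hmul2E invMg word_actM.
Qed.

(* the Specht module of S_n, inflated along (e, s) |-> s *)
Definition specht_rep : grep F (hypoct n) := GRep specht_act1 specht_actM.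

End Specht.

(* The value at an infinite alphabet is the limit in N of these polynomials
   in N variables. *)
Section Schur.
Variables (R : comNzRingType) (N : nat).

Definition skew (lam mu : seq nat) : finType :=
  {c : cell lam | (nth 0%N mu (row c) <= col c)%N} : finType.

Definition is_ssyt lam mu (T : {ffun skew lam mu -> 'I_N}) : bool :=
  [forall c, forall d,
    ((row (val c) == row (val d)) && (col (val c) <= col (val d))%N
       ==> (T c <= T d)%N)
    && ((col (val c) == col (val d)) && (row (val c) < row (val d))%N
       ==> (T c < T d)%N)].

Definition skew_schur (lam mu : seq nat) (x : 'I_N -> R) : R :=
  \sum_(T : {ffun skew lam mu -> 'I_N} | is_ssyt T) \prod_c x (T c).

Definition schur (lam : seq nat) : ('I_N -> R) -> R := skew_schur lam [::].

(* Partitions contained in lam are padded with zeros to the length of lam. *)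
Definition is_subpart (lam mu : seq nat) : bool :=
  sorted geq mu && [forall i : 'I_(size lam), nth 0 mu i <= nth 0 lam i]%N.

Definition super_schur (lam : seq nat) (x y : 'I_N -> R) : R :=
  \sum_(mu : (size lam).-tuple 'I_(sumn lam).+1
        | is_subpart lam (map val mu))
     schur (map val mu) x *
     skew_schur (conj_part lam) (conj_part (map val mu)) y.

End Schur.

Local Notation "x %:F" := (@FracField.tofrac _ x).

Section Series.
Implicit Types (f : nat -> int) (r : {fraction {poly int}}).

(* The series \sum_k (f k) t^k is the t-adic limit of the polynomials u N. *)
Definition tadic_lim (u : nat -> {poly int}) f : Prop :=
  forall k, exists N0, forall N, (N0 <= N)%N -> (u N)`_k = f k.

(* The series \sum_k (f k) t^k is the expansion of the rational function r:
   q f = p for some fraction p / q equal to r.  Such an f is unique, since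
   formal power series over the integers form a domain. *)
Definition is_expansion r f : Prop :=
  exists p q : {poly int},
    [/\ q != 0, r = p%:F / q%:F &
        forall k, \sum_(i < k.+1) q`_i * f (k - i)%N = p`_k].

End Series.

Definition tvar : {fraction {poly int}} := 'X%:F.

(* The rank is n.+1 >= 1: the library has dhomog as a vector space only for a
   nonzero number of variables. *)
Definition graded_mult (F : fieldType) (n : nat) (lam : seq nat) (k : nat) : nat :=
  \dim (superHom (cliff_tensor (specht_rep F n.+1 lam))
                 (cliff_tensor (sym_rep F n k))).

(* Main.v *)
From HB Require Import structures.
From mathcomp Require Import all_boot all_order all_algebra.
From mathcomp Require Import fingroup perm.
From mathcomp Require Import falgebra fraction mpoly.
From mathcomp Require Import zify ring.
Require Import Defs.

(** Write M for the Specht module S^lam inflated to B_n and N for S^k V.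

    The module Cl_n (x) M is induced from the B_n-module M, so a superhomomorphism
    from Cl_n (x) M to Cl_n (x) N is the same as a B_n-equivariant map from M to
    Cl_n (x) N (dim_superHom).  Sign changes act trivially on M, so only the vectors
    of Cl_n (x) N that they fix can be reached; these have the basis c_A x^mu, with A
    the set of places where mu is odd.  Such a basis vector is a word of length n in
    the letters 0, 1, 2, ..., the exponents, and S_n permutes places, with a sign
    when two odd letters change places.

    The multiplicity of S^lam in this signed permutation module is the number of
    fillings of lam by letters, of degree k in total, that increase weakly along rows
    and columns, where an even letter may repeat in a row only and an odd letter in a
    column only (dim_eqHom).  The order of the letters is arbitrary.  At most that
    many: a map is determined by the image of one polytabloid, on which column
    permutations act by their sign and which satisfies the Garnir relations; an
    extremal word in the support of that image must then be such a filling
    (upper_bound).  At least that many: a word gives a map, by summing over the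
    group, and the coefficients of the images of the polytabloid on these fillings
    form a triangular matrix with positive integers on the diagonal (young_free).

    Now let the letters 0, 2, ..., 2N precede 1, 3, ..., 2N + 1.  In a filling the even
    letters occupy a subdiagram mu and form a tableau of shape mu; the odd ones form
    the conjugate of a tableau on lam / mu.  Weighting each letter d by t^d gives the
    super Schur polynomial in 1, t^2, ..., t^2N and t, t^3, ..., t^(2N + 1)
    (super_schur_fill), and letters of degree above k do not matter for the
    coefficient of t^k.  This is the first equality.

    For the second, the fillings by the first K letters are counted by the
    Jacobi-Trudi determinant of the h_m, where sum_m h_m X^m is the product of
    1 / (1 - z X) over even letters and of 1 + z X over odd ones (fill_jt).  Indeed,
    removing the largest letter from a filling removes a horizontal or a vertical strip,
    and the determinant satisfies the same recursion, by row operations and by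
    multilinearity.  Put q = t^2 and u = - t.  By the q-binomial theorem, h_m agrees up
    to high powers of t with the product over i < m of (1 - u q^i) / (1 - q^(i + 1))
    (hseq_cong).  For these h_m the entries of a row are, up to a factor, the values at
    one point of fixed polynomials, so the determinant is a product of row factors, a
    Vandermonde determinant and a constant that the empty partition detects
    (jt_ratio).  Finally, with beta_i = lam_i + l - i, rows numbered from 1 to l, the
    hook lengths in row i and the differences beta_i - beta_k for k > i are together the
    numbers from 1 to beta_i (hook_perm), which turns the Vandermonde factors into hook
    lengths (jt_product). *)

Set Implicit Arguments.
Unset Strict Implicit.
Unset Printing Implicit Defensive.

Import GRing.Theory.
Local Open Scope ring_scope.

(** * Frobenius reciprocity for the smash product *)

Section Smash.
Variables (F : fieldType) (n : nat).
Local Notation H := (hclif_superalg F n).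
Implicit Types (g h : hypoct n) (a b : cliff F n) (x : H).

Definition hgrp g : hclif F n := [ffun h => (h == g)%:R].
Definition hcl a : hclif F n := [ffun h => if h == 1%g then a else 0].

Lemma hclM a b : hcl a * hcl b = hcl (a * b).
Proof.
apply/ffunP => k; rewrite hcmulE (bigD1 1%g) //= big1 => [|g /negPf ng].
  by rewrite !ffunE eqxx invg1 mul1g cact_id addr0; case: eqP; rewrite ?mulr0.
by rewrite ffunE ng mul0r.
Qed.

Lemma hgrp_mull g x k : (hgrp g * x : hclif F n) k = cact g (x (g^-1 * k)%g).
Proof.
rewrite hcmulE (bigD1 g) // big1 => [|h /negPf nh]; last by rewrite ffunE nh mul0r.
by rewrite /= addr0 ffunE eqxx mul1r.
Qed.

Lemma hcl_mull a x k : (hcl a * x : hclif F n) k = a * x k.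
Proof.
rewrite hcmulE (bigD1 1%g) // big1 => [|h /negPf nh]; last by rewrite ffunE nh mul0r.
by rewrite /= addr0 ffunE eqxx cact_id invg1 mul1g.
Qed.

Lemma hgrp_hcl g b : hgrp g * hcl b = hcl (cact g b) * hgrp g.
Proof.
apply/ffunP => k; rewrite hgrp_mull hcl_mull ffunE [hgrp g k]ffunE -eq_mulVg1 eq_sym.
by case: (k == g); rewrite ?mulr1 // linear0 mulr0.
Qed.

Lemma hclif_sum (x : hclif F n) : x = \sum_g hcl (x g) * hgrp g.
Proof.
apply/ffunP => k; rewrite sum_ffunE (bigD1 k) //= big1 => [|h /negPf nh].
  rewrite addr0 hcmulE (bigD1 1%g) //= big1 => [|h /negPf nh]; last first.
    by rewrite ffunE nh mul0r.
  by rewrite !ffunE invg1 mul1g cact_id !eqxx mulr1 addr0.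
rewrite hcmulE big1 // => g _; rewrite !ffunE; case: eqP => [->|]; last by rewrite mul0r.
by rewrite invg1 mul1g cact_id eq_sym nh mulr0.
Qed.

Lemma hgrp_deg g : hgrp g \in sadeg H false.
Proof.
apply/hdegP => h; rewrite ffunE; case: (h == g); [exact: is_cdeg1|exact: is_cdeg0].
Qed.

Lemma hcl_deg p a : is_cdeg p a -> hcl a \in sadeg H p.
Proof. by move=> pa; apply/hdegP => h; rewrite ffunE; case: eqP => // _; apply: is_cdeg0. Qed.

Lemma hcl_linear : linear hcl.
Proof. by move=> k a b; apply/ffunP => h; rewrite !ffunE; case: eqP; rewrite ?scaler0 ?addr0. Qed.
HB.instance Definition _ := GRing.isLinear.Build F _ _ _ hcl hcl_linear.

End Smash.

Section Frobenius.
Variables (F : fieldType) (n : nat) (M N : grep F (hypoct n)).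
Local Notation H := (hclif_superalg F n).
Local Notation CM := (cliff_tensor M).
Local Notation CN := (cliff_tensor N).
Implicit Types (g h : hypoct n) (a b : cliff F n).

Lemma ctensP (L : grep F (hypoct n)) (m1 m2 : cliff_tensor L) :
  (forall B, (m1 : ctens n L) B = (m2 : ctens n L) B) -> m1 = m2.
Proof. by move=> E; exact: (proj1 (@ffunP _ _ m1 m2) E). Qed.

Lemma ctens_linear (L : grep F (hypoct n)) k (u w : cliff_tensor L) B :
  (k *: u + w : ctens n L) B = k *: (u : ctens n L) B + (w : ctens n L) B.
Proof. by rewrite !ffunE. Qed.

Lemma smdegP (L : grep F (hypoct n)) p (m : cliff_tensor L) :
  m \in smdeg (cliff_tensor L) p <->
  forall B : {set 'I_n}, odd #|B| != p -> (m : ctens n L) B = 0.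
Proof. exact: (@tdegP F n L p m). Qed.

Lemma tact_hgrp (L : grep F (hypoct n)) g (m : ctens n L) :
  tact L (hgrp F g) m = \sum_B tens (cact g (cbase F B)) (gact L g (m B)).
Proof.
rewrite tactE /tact_fun (bigD1 g) //= [X in _ + X]big1 => [|h /negPf nh].
  by rewrite addr0; apply: eq_bigr => B _; rewrite ffunE eqxx mul1r.
apply: big1 => B _; rewrite ffunE nh mul0r.
by apply/ffunP => C; rewrite !ffunE scale0r.
Qed.

Lemma tact_hcl (L : grep F (hypoct n)) a b (v : L) :
  tact L (hcl a) (tens b v) = tens (a * b) v.
Proof.
rewrite tactE tact_tens (bigD1 1%g) //= big1 => [|h /negPf nh].
  by rewrite ffunE eqxx cact_id gact1 id_lfunE addr0.
by rewrite ffunE nh mul0r; apply/ffunP => C; rewrite !ffunE scale0r.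
Qed.

Lemma tact_hgrp1 (L : grep F (hypoct n)) g (v : L) :
  tact L (hgrp F g) (tens 1 v) = tens 1 (gact L g v).
Proof.
rewrite tactE tact_tens (bigD1 g) //= big1 => [|h /negPf nh].
  by rewrite ffunE eqxx cact1 mul1r addr0.
by rewrite ffunE nh mul0r; apply/ffunP => C; rewrite !ffunE scale0r.
Qed.

Definition is_eqhom (phi : 'Hom(M, CN)) : Prop :=
  forall g v, phi (gact M g v) = sact CN (hgrp F g) (phi v).

Definition eqHom : {vspace 'Hom(M, CN)} := vspan is_eqhom.

Lemma eqHomP phi : phi \in eqHom <-> is_eqhom phi.
Proof.
apply: vspanP => [g v|k u w pu pw g v]; first by rewrite !zero_lfunE linear0.
by rewrite !add_lfunE !scale_lfunE pu pw linearP.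
Qed.

(** M is purely even, so a homogeneous map has the parity of its values, and the
    sign in f(a m) = (-1)^(|f||a|) a f(m) can be read off the value f(m) of the
    map at an element of M.  This makes the sign a linear operator, so that f
    need not be split into its homogeneous parts. *)
Definition twist (b : bool) (m : CN) : CN :=
  [ffun B : {set 'I_n} => (-1) ^+ (b && odd #|B|) *: m B] : ctens n N.

Lemma twist_linear (c : bool) : linear (twist c).
Proof.
move=> k u w; apply: ctensP => B; rewrite !ffunE scalerDr !scalerA.
by rewrite (mulrC k).
Qed.
HB.instance Definition _ (c : bool) := GRing.isLinear.Build F CN CN _ (twist c) (twist_linear c).

Lemma twist_deg (c p : bool) m : m \in smdeg CN p -> twist c m = (-1) ^+ (c && p) *: m.
Proof.
move=> /smdegP pm; apply: ctensP => B; rewrite !ffunE.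
by have [->//|/pm ->] := eqVneq (odd #|B|) p; rewrite !scaler0.
Qed.

Definition part_deg (p : bool) (m : CN) : CN :=
  [ffun B : {set 'I_n} => if odd #|B| == p then m B else 0] : ctens n N.

Lemma part_deg_linear (p : bool) : linear (part_deg p).
Proof.
by move=> k u w; apply: ctensP => B; rewrite !ffunE; case: ifP; rewrite ?scaler0 ?addr0.
Qed.
HB.instance Definition _ (p : bool) := GRing.isLinear.Build F CN CN _ (part_deg p)
  (part_deg_linear p).

Lemma part_deg_sum m : m = part_deg false m + part_deg true m.
Proof. by apply: ctensP => B; rewrite !ffunE; case: odd; rewrite ?addr0 ?add0r. Qed.

Lemma part_degP p m : part_deg p m \in smdeg CN p.
Proof. by apply/smdegP => B /negPf pB; rewrite ffunE pB. Qed.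

Lemma deg_inj m0 m1 : m0 \in smdeg CN false -> m1 \in smdeg CN true ->
  part_deg false (m0 + m1) = m0 /\ part_deg true (m0 + m1) = m1.
Proof.
move=> /smdegP d0 /smdegP d1; split; apply: ctensP => B; rewrite !ffunE.
  by case: (boolP (odd _)) => oB /=; [rewrite d0 ?oB|rewrite d1 ?oB ?addr0 // (negPf oB)].
by case: (boolP (odd _)) => oB /=; [rewrite d0 ?oB ?add0r|rewrite d1 // (negPf oB)].
Qed.

(** Group elements are even, so they commute with the projections on the two
    parities; the homogeneous parts of an equivariant map are therefore
    equivariant. *)
Lemma part_deg_equiv p g m :
  part_deg p (sact CN (hgrp F g) m) = sact CN (hgrp F g) (part_deg p m).
Proof.
have [E0 E1] := deg_inj (sact_deg (hgrp_deg F g) (part_degP false m))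
                        (sact_deg (hgrp_deg F g) (part_degP true m)).
by rewrite {1}[m]part_deg_sum linearD; case: p.
Qed.

(** The only possible extension of phi from 1 (x) M: a superhomomorphism sends
    c_B (x) v, which is c_B applied to 1 (x) v, to the signed c_B phi(v). *)
Definition ext_fun (phi : 'Hom(M, CN)) (m : CM) : CN :=
  \sum_(B : {set 'I_n}) sact CN (hcl (cbase F B)) (twist (odd #|B|) (phi ((m : ctens n M) B))).

Lemma ext_fun_linear phi : linear (ext_fun phi).
Proof.
move=> k u w; rewrite /ext_fun scaler_sumr -big_split /=; apply: eq_bigr => B _.
by rewrite ctens_linear (linearP phi) (linearP (twist _)) (linearP (sact CN _)).
Qed.
HB.instance Definition _ phi := GRing.isLinear.Build F CM CN _ (ext_fun phi)
  (ext_fun_linear phi).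

Definition ext phi : 'Hom(CM, CN) := linfun (ext_fun phi).

Lemma ext_linear : linear ext.
Proof.
move=> k u w; apply/lfunP => m; rewrite add_lfunE scale_lfunE !lfunE /= /ext_fun.
rewrite scaler_sumr -big_split /=; apply: eq_bigr => B _.
by rewrite add_lfunE scale_lfunE (linearP (twist _)) (linearP (sact CN _)).
Qed.
HB.instance Definition _ := GRing.isLinear.Build F _ _ _ ext ext_linear.

Lemma twist0 m : twist false m = m.
Proof. by apply: ctensP => B; rewrite !ffunE scale1r. Qed.

Lemma hcl_cbase0 : hcl (cbase F set0) = 1 :> hclif F n.
Proof.
by apply/ffunP => g; rewrite hconeE ffunE cbase0; case: eqP.
Qed.

Lemma ext_tens1 phi v : ext phi (tens 1 v : ctens n M) = phi v.
Proof.
rewrite lfunE /= /ext_fun (bigD1 set0) //= [X in _ + X]big1 => [|B /negPf nB].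
  by rewrite addr0 !ffunE eqxx scale1r cards0 hcl_cbase0 tact1 id_lfunE twist0.
by rewrite !ffunE nB scale0r (linear0 phi) (linear0 (twist _)) (linear0 (sact CN _)).
Qed.

Lemma ext_tens p q (phi : 'Hom(M, CN)) b v : (forall v, phi v \in smdeg CN p) -> is_cdeg q b ->
  ext phi (tens b v : ctens n M) = (-1) ^+ (p && q) *: sact CN (hcl b) (phi v).
Proof.
move=> phip qb; rewrite lfunE /= /ext_fun {2}[b]cliffE.
rewrite (linear_sum (@hcl F n)) (linear_sum (sact CN)) sum_lfunE scaler_sumr.
apply: eq_bigr => B _; rewrite ffunE (linearZ_LR phi) (linearZ_LR (twist _)) (linearZ_LR (sact CN _)) /=.
rewrite (twist_deg _ (phip _)) (linearZ_LR (sact CN _)) (linearZ_LR (@hcl F n)) (linearZ_LR (sact CN)) /=.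
rewrite scale_lfunE !scalerA.
have [<-|/qb ->] := eqVneq (odd #|B|) q; last by rewrite mul0r mulr0.
by rewrite andbC mulrC.
Qed.

(** The smash product is spanned by products of a Clifford element, for which
    the rule holds by construction, and a group element, for which it is the
    equivariance of phi; hgrp_hcl moves one past the other. *)
Lemma ext_superhom p phi : is_eqhom phi -> (forall v, phi v \in smdeg CN p) ->
  is_superhom p (ext phi).
Proof.
move=> ephi phip; split=> [q m qm|q x m qx].
  rewrite lfunE /=; apply: memv_suml => B _.
  have [<-|oB] := eqVneq (odd #|B|) q; last first.
    by move/smdegP: qm => ->; rewrite ?linear0 ?mem0v.
  rewrite (twist_deg _ (phip _)) linearZ rpredZ // addbC.
  exact: sact_deg (hcl_deg (@is_cdeg_base F n B)) (phip _).
rewrite [m](ctensE (m : ctens n M)) (linear_sum (sact CM x)) !(linear_sum (ext phi)).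
rewrite (linear_sum (sact CN x)) scaler_sumr.
apply: eq_bigr => B _; set c := cbase F B; set v := (m : ctens n M) B.
have cd : is_cdeg (odd #|B|) c := @is_cdeg_base F n B.
rewrite [in RHS]/= (ext_tens v phip cd) [in LHS]/= tactE tact_tens (linear_sum (ext phi)).
rewrite (linearZ_LR (sact CN x)) scalerA -signr_addb -andb_addr.
transitivity (\sum_g (-1) ^+ (p && (q (+) odd #|B|)) *:
   sact CN (hcl (x g) * hcl (cact g c) * hgrp F g) (phi v)).
  apply: eq_bigr => g _.
  have xg : is_cdeg q (x g) by move/hdegP: qx => /(_ g).
  rewrite /= (ext_tens _ phip (is_cdegM xg (is_cdeg_act g cd))) ephi hclM.
  by rewrite (sactM CN) comp_lfunE.
transitivity ((-1) ^+ (p && (q (+) odd #|B|)) *: sact CN (x * hcl c) (phi v)); last first.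
  by rewrite (sactM CN) comp_lfunE.
rewrite -scaler_sumr -sum_lfunE -(linear_sum (sact CN)).
congr (_ *: sact CN _ _); rewrite {2}(hclif_sum x) mulr_suml.
by apply: eq_bigr => g _; rewrite -!mulrA hgrp_hcl.
Qed.

Lemma superHom_ind (P : 'Hom(CM, CN) -> Prop) :
  P 0 -> (forall k u w, P u -> P w -> P (k *: u + w)) ->
  (forall p f, is_superhom p f -> P f) -> forall f, f \in superHom CM CN -> P f.
Proof.
move=> P0 PD Ph f fH; have := vspanP f P0 PD => -[+ _]; apply.
apply: (subvP (vspan_sub _)) fH => g [p /Ph Pg]; exact: vspan_mem.
Qed.

(** The tensors c_B (x) v come from 1 (x) v by Clifford multiplication, so a
    superhomomorphism is determined by its restriction to 1 (x) M. *)
Lemma superHom_tens (f : 'Hom(CM, CN)) : f \in superHom CM CN ->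
  forall B v, f (tens (cbase F B) v : ctens n M) =
    sact CN (hcl (cbase F B)) (twist (odd #|B|) (f (tens 1 v : ctens n M))).
Proof.
move=> fH B v; elim/superHom_ind: f / fH => [|k u w Hu Hw|p f [fdeg fact]].
- by rewrite !zero_lfunE (linear0 (twist _)) linear0.
- by rewrite !add_lfunE !scale_lfunE Hu Hw (linearP (twist _)) (linearP (sact CN _)).
have f1 : f (tens 1 v : ctens n M) \in smdeg CN p.
  rewrite -[p]addbF; apply: fdeg; apply/smdegP => C; rewrite eqbF_neg negbK => oC.
  by rewrite !ffunE; case: eqP oC => [->|]; rewrite ?cards0 // scale0r.
rewrite (twist_deg _ f1) (linearZ_LR (sact CN _)) /= andbC.
by rewrite -(fact _ _ _ (hcl_deg (@is_cdeg_base F n B))) tact_hcl mulr1.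
Qed.

Lemma superHom_hgrp (f : 'Hom(CM, CN)) : f \in superHom CM CN ->
  forall g m, f (sact CM (hgrp F g) m) = sact CN (hgrp F g) (f m).
Proof.
move=> fH g m; elim/superHom_ind: f / fH => [|k u w Hu Hw|p f [fdeg fact]].
- by rewrite !zero_lfunE linear0.
- by rewrite !add_lfunE !scale_lfunE Hu Hw (linearP (sact CN _)).
by rewrite (fact _ _ _ (hgrp_deg F g)) andbF scale1r.
Qed.

Definition tens1 (v : M) : CM := tens 1 v.

Lemma tens1_linear : linear tens1.
Proof. by move=> k u w; rewrite /tens1 tensDr tensZr. Qed.
HB.instance Definition _ := GRing.isLinear.Build F _ _ _ tens1 tens1_linear.

Definition res (f : 'Hom(CM, CN)) : 'Hom(M, CN) := (f \o linfun tens1)%VF.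

Lemma resE f v : res f v = f (tens 1 v : ctens n M).
Proof. by rewrite comp_lfunE lfunE. Qed.

Lemma ext_superHom phi : phi \in eqHom -> ext phi \in superHom CM CN.
Proof.
move=> /eqHomP ephi.
pose phip p := (linfun (part_deg p) \o phi)%VF.
have phipE p v : phip p v = part_deg p (phi v) by rewrite comp_lfunE lfunE.
have -> : phi = phip false + phip true.
  apply/lfunP => v; rewrite add_lfunE !phipE; exact: part_deg_sum.
rewrite (linearD ext); apply: memvD; apply: vspan_mem;
  [exists false|exists true]; apply: ext_superhom => [g v|v].
- by rewrite !phipE ephi part_deg_equiv.
- by rewrite phipE part_degP.
- by rewrite !phipE ephi part_deg_equiv.
- by rewrite phipE part_degP.
Qed.

(** Frobenius reciprocity: extension and restriction are inverse to each other.
    The even and the odd superhomomorphisms are the extensions of the maps with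
    values of even and of odd degree. *)
Lemma dim_superHom : \dim (superHom CM CN) = \dim eqHom.
Proof.
pose E : 'Hom('Hom(M, CN), 'Hom(CM, CN)) := linfun ext.
have EE phi : E phi = ext phi by exact: lfunE.
have inj : (lker E == 0)%VS.
  apply/lker0P => u w; rewrite !EE => uw; apply/lfunP => v.
  by rewrite -!ext_tens1 uw.
rewrite -(limg_dim_eq (f := E) (U := eqHom)); last first.
  by move/eqP: inj => ->; rewrite capv0.
congr (\dim _); apply/eqP; rewrite eqEsubv; apply/andP; split; last first.
  apply/subvP => _ /memv_imgP[phi phiH ->]; rewrite EE; exact: ext_superHom.
apply/subvP => f fH; apply/memv_imgP; exists (res f).
  apply/eqHomP => g v; rewrite !resE -(superHom_hgrp fH) -tact_hgrp1 //.
apply/lfunP => m; rewrite EE [RHS]lfunE /= /ext_fun.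
rewrite {1}[m](ctensE (m : ctens n M)) (linear_sum f); apply: eq_bigr => B _.
by rewrite resE -(superHom_tens fH).
Qed.

End Frobenius.

Lemma swap_arith (S T c p q : nat) :
  (S + (c * p + (q + c * q)) = T + (c * q + (p + c * p)))%N -> (S + q = T + p)%N.
Proof. by lia. Qed.

Lemma squeeze_arith (S T p q z : nat) : (S + q = T + p)%N -> (q <= z)%N -> (z <= p)%N ->
  (T <= S)%N /\ (S = T -> q = z /\ p = z).
Proof. by move=> E qz zp; split; [|move=> ST; split]; lia. Qed.

(** * Signs of permutations on the Clifford algebra *)

Section CliffSign.
Variables (F : fieldType) (n : nat).
Implicit Types (s t : 'S_n) (A : {set 'I_n}).

Definition hperm s : hypoct n := ([ffun=> false], s).

Lemma hpermM s t : hperm (s * t)%g = (hperm t * hperm s)%g.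
Proof. by congr (_, _); apply/ffunP => i; rewrite !ffunE. Qed.

Lemma cact_hperm_gen s i : cact (hperm s) (cgen F i) = cgen F (s i).
Proof. by rewrite cact_cgen ffunE scale1r. Qed.

Lemma cbase_insert A i : i \in A ->
  exists e : bool, cbase F A = (-1) ^+ e *: (cgen F i * cbase F (A :\ i)).
Proof.
move=> iA; exists (csign [set i] (A :\ i)).
rewrite cbaseM scalerA -signr_addb addbb scale1r; congr cbase.
by apply/setP => j; rewrite !inE; have [->|] := eqVneq j i; rewrite ?iA.
Qed.

Lemma cact_base_ex s A : exists e : bool,
  cact (hperm s) (cbase F A) = (-1) ^+ e *: cbase F (s @: A).
Proof.
have [m] := ubnP #|A|; elim: m A => // m IH A.
have [->|[i iA]] := set_0Vmem A.
  by exists false; rewrite imset0 cbase0 cact1 scale1r.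
rewrite (cardsD1 i) iA ltnS => /IH[e E].
have [e1 ->] := cbase_insert iA.
have [|e2 E2] := @cbase_insert (s @: A) (s i); first exact: imset_f.
exists (e1 (+) e (+) e2).
rewrite (linearZ_LR (cact _)) /= cactM cact_hperm_gen E E2 -scalerAr !scalerA.
have -> : (s @: A) :\ s i = s @: (A :\ i).
  apply/setP => j; apply/idP/imsetP => [|[k]].
    rewrite !inE => /andP[ji /imsetP[k kA jk]]; exists k => //.
    by rewrite !inE kA andbT; apply: contraNneq ji => <-; rewrite jk.
  by rewrite !inE => /andP[ki kA] ->; rewrite (inj_eq perm_inj) ki imset_f.
by rewrite -!signr_addb -addbA addbb addbF.
Qed.

(** The scalar in s c_A = csgn s A c_(s A).  It is defined as a coordinate,
    which gives the cocycle rule csgnM from the action being one; cact_base_ex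
    shows that it is a sign. *)
Definition csgn s A : F := cact (hperm s) (cbase F A) (s @: A).

Lemma cact_base s A : cact (hperm s) (cbase F A) = csgn s A *: cbase F (s @: A).
Proof.
rewrite /csgn; have [e ->] := cact_base_ex s A.
by rewrite !ffunE eqxx /GRing.scale /= mulr1.
Qed.

Lemma cbase_inj (c d : F) A : c *: cbase F A = d *: cbase F A -> c = d.
Proof. by move/ffunP/(_ A); rewrite !ffunE eqxx /GRing.scale /= !mulr1. Qed.

Lemma csgnM s t A : csgn (s * t)%g A = csgn s A * csgn t (s @: A).
Proof.
apply: (@cbase_inj _ _ ((s * t)%g @: A)); rewrite -cact_base hpermM cact_comp.
rewrite cact_base (linearZ_LR (cact _)) /= cact_base scalerA; congr (_ *: cbase _ _).
by apply/setP => j; apply/imsetP/imsetP => [[_ /imsetP[i iA ->] ->]|[i iA ->]];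
  [exists i; rewrite ?permM|exists (s i); rewrite ?imset_f ?permM].
Qed.

Lemma csgn_fix s A : {in A, forall i, s i = i} -> csgn s A = 1.
Proof.
move=> sA; rewrite /csgn -prod_cgen (big_morph _ (cactM _) (cact1 _ _)).
rewrite (eq_bigr (fun i => cgen F i)) => [|i iA]; last by rewrite cact_hperm_gen sA.
have -> : s @: A = A.
  apply/setP => j; apply/imsetP/idP => [[i iA ->]|jA]; first by rewrite sA.
  by exists j; rewrite ?sA.
by rewrite prod_cgen ffunE eqxx.
Qed.

(** Both generators occur in c_A, and they anticommute. *)
Lemma csgn_tperm i j A : i != j -> i \in A -> j \in A -> csgn (tperm i j) A = -1.
Proof.
move=> ij iA jA; apply: (@cbase_inj _ _ (tperm i j @: A)); rewrite -cact_base.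
have -> : tperm i j @: A = A.
  apply/setP => k; rewrite -[k in LHS](tpermK i j) (mem_imset _ _ (@perm_inj _ _)).
  by case: tpermP => [->|->|//]; rewrite iA jA.
have [e1 ->] := cbase_insert iA.
have [|e2 ->] := @cbase_insert (A :\ i) j; first by rewrite !inE eq_sym ij.
set A' := _ :\ j.
have fixA : {in A', forall k, tperm i j k = k}.
  by move=> k; rewrite !inE => /and3P[kj ki _]; rewrite tpermD // eq_sym.
have A'T : tperm i j @: A' = A'.
  apply/setP => k; apply/imsetP/idP => [[l lA ->]|kA]; first by rewrite fixA.
  by exists k; rewrite ?fixA.
rewrite (linearZ_LR (cact _)) /= cactM (linearZ_LR (cact _)) /= cactM !cact_hperm_gen.
rewrite tpermL tpermR cact_base csgn_fix // A'T scale1r.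
rewrite -!scalerAr !mulrA cgen_anti 1?eq_sym // !mulNr scalerN scaleN1r.
by rewrite scalerN.
Qed.

Lemma csgn1 A : csgn 1%g A = 1.
Proof. by apply: csgn_fix => i _; rewrite perm1. Qed.

(** A permutation of places inside A is a product of transpositions inside A,
    and each of them contributes - 1. *)
Lemma csgn_perm_on s A : perm_on A s -> csgn s A = (-1) ^+ odd_perm s.
Proof.
have [m] := ubnP #|[set i | s i != i]|; elim: m s => // m IH s sm sA.
have [s0|[i]] := set_0Vmem [set i | s i != i].
  have -> : s = 1%g.
    apply/permP => i; rewrite perm1; apply/eqP.
    by have /setP/(_ i) := s0; rewrite !inE => /negbFE.
  by rewrite odd_perm1 csgn1.
rewrite inE => si.
have iA : i \in A by apply: contraR si => /(out_perm sA) ->.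
have siA : s i \in A by rewrite perm_closed.
pose t := (tperm i (s i) * s)%g.
have st : s = (tperm i (s i) * t)%g by rewrite /t mulgA tperm2 mul1g.
have tA : perm_on A t.
  apply: perm_onM => //; apply/subsetP => k; rewrite !inE.
  by case: tpermP => [->|->|_ _]; rewrite ?eqxx // iA ?siA.
rewrite {1}st csgnM csgn_tperm // 1?eq_sym //.
have -> : tperm i (s i) @: A = A.
  apply/setP => k; rewrite -[k in LHS](tpermK i (s i)) (mem_imset _ _ (@perm_inj _ _)).
  by case: tpermP => [->|->|//]; rewrite iA siA.
rewrite IH //; last first.
  rewrite -ltnS; apply: leq_trans sm; rewrite ltnS; apply: proper_card.
  apply/properP; split.
    apply/subsetP => k; rewrite !inE permM; case: tpermP => [->|->|//] //.
    by move=> _; apply: contra si => /eqP/perm_inj ->.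
  by exists (s i); rewrite !inE ?(inj_eq perm_inj) // permM tpermR eqxx.
by rewrite [in RHS]st odd_mul_tperm eq_sym si signr_addb.
Qed.

End CliffSign.

(** * Words with odd letters and semistandard fillings *)

Section SignedWords.
Variables (F : fieldType) (n B : nat) (par : 'I_B -> bool).
Hypothesis charF : forall m, m.+1%:R != 0 :> F.
Local Notation W := {ffun 'I_n -> 'I_B}.
Implicit Types (s t : 'S_n) (w v : W) (a : W -> F).

Definition wcomp w s : W := [ffun i => w (s i)].
Definition odds w : {set 'I_n} := [set i | par (w i)].
(** The action of s on the coordinates with respect to the basis of words, where
    the word w stands for the monomial of exponents w times c_A, with A the
    places of its odd letters. *)
Definition wact s a : W -> F := fun w => csgn F s (odds (wcomp w s)) * a (wcomp w s).

Lemma wcompM w s t : wcomp w (s * t)%g = wcomp (wcomp w t) s.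
Proof. by apply/ffunP => i; rewrite !ffunE permM. Qed.

Lemma wcomp1 w : wcomp w 1%g = w.
Proof. by apply/ffunP => i; rewrite ffunE perm1. Qed.

Lemma odds_wcomp w s : s @: odds (wcomp w s) = odds w.
Proof.
apply/setP => i; rewrite -[i in LHS](permKV s) (mem_imset _ _ (@perm_inj _ _)).
by rewrite !inE ffunE permKV.
Qed.

Lemma wactM s t a : wact (s * t)%g a =1 wact t (wact s a).
Proof. by move=> w; rewrite /wact wcompM csgnM odds_wcomp mulrCA mulrA. Qed.

Variables (row col : 'I_n -> nat).

(** Here b is the parity of letters that may repeat: even in rows, odd in
    columns. *)
Definition let_le (b : bool) (x y : 'I_B) := (x < y)%N || (x == y) && (par x == b).

Definition word_ss w := [forall i, forall j,
  ((row i == row j) && (col i < col j)%N ==> let_le false (w i) (w j)) &&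
  ((col i == col j) && (row i < row j)%N ==> let_le true (w i) (w j))].

Lemma let_le_trans b : transitive (let_le b).
Proof.
move=> y x z /orP[xy|/andP[/eqP -> //]] /orP[yz|/andP[/eqP <- _]]; apply/orP; left=> //.
exact: ltn_trans xy yz.
Qed.

Lemma let_leW b x y : let_le b x y -> (x <= y)%N.
Proof. by case/orP => [/ltnW //|/andP[/eqP -> ]]. Qed.

Hypothesis rc_inj : forall i j, row i = row j -> col i = col j -> i = j.
Hypothesis rc_shape : forall i r c, (r <= row i)%N -> (c <= col i)%N ->
  exists2 j, row j = r & col j = c.

Definition row_stab s := [forall i, row (s i) == row i].
Definition colm_stab s := [forall i, col (s i) == col i].

(** The column of i from i downwards and the column of j up to j.  For j next to
    i in the same row these are one more place than the column of i has, which
    is what makes the Garnir relation hold. *)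
Definition garnir_set i j : {set 'I_n} :=
  [set x | (col x == col i) && (row i <= row x)%N] :|:
  [set x | (col x == col j) && (row x <= row j)%N].

(** Both weights measure how far the large letters are to the right,
    respectively down; comparing words first by colw and then by roww is the
    order used for leading terms. *)
Definition colw w := (\sum_i col i * w i)%N.
Definition roww w := (\sum_i row i * w i)%N.

Lemma wsum_tperm (f : 'I_n -> nat) w i j : i != j ->
  (\sum_k f k * wcomp w (tperm i j) k + (f i * w i + f j * w j) =
   \sum_k f k * w k + (f i * w j + f j * w i))%N.
Proof.
move=> ij; rewrite (bigD1 i) // (bigD1 j) 1?eq_sym //= [in RHS](bigD1 i) //.
rewrite [in RHS](bigD1 j) 1?eq_sym //= !ffunE tpermL tpermR.
rewrite (eq_bigr (fun k => f k * w k)%N) => [|k /andP[ki kj]]; first by lia.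
by rewrite ffunE tpermD // eq_sym.
Qed.

Lemma wsum_stab (f : 'I_n -> nat) w s : (forall i, f (s i) = f i) ->
  (\sum_k f k * wcomp w s k = \sum_k f k * w k)%N.
Proof.
move=> fs; rewrite [RHS](reindex_inj (@perm_inj _ s)) /=.
by apply: eq_bigr => k _; rewrite ffunE fs.
Qed.

Section Upper.
Variable a : W -> F.
Hypothesis a_col : forall s, colm_stab s -> wact s a =1 (fun w => (-1) ^+ odd_perm s * a w).
Hypothesis a_garnir : forall i j, row i = row j -> col j = (col i).+1 ->
  forall w, \sum_(s | perm_on (garnir_set i j) s) (-1) ^+ odd_perm s * wact s a w = 0.

Lemma a_tperm_neq0 w i j : col i = col j -> a w != 0 -> a (wcomp w (tperm i j)) != 0.
Proof.
move=> cij; apply: contraNneq => a0.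
have cs : colm_stab (tperm i j).
  by apply/forallP => k; case: tpermP => [->|->|//]; rewrite cij.
by move: (a_col cs w); rewrite /wact a0 mulr0 => /esym/eqP; rewrite mulf_eq0 signr_eq0.
Qed.

Lemma max_support : (exists w, a w != 0) -> exists w, [/\ a w != 0,
  forall v, a v != 0 -> (colw v <= colw w)%N &
  forall v, a v != 0 -> colw v = colw w -> (roww v <= roww w)%N].
Proof.
case=> w0 aw0.
pose w1 := [arg max_(w > w0 | a w != 0%R) colw w]%N.
have [aw1 max1] : a w1 != 0 /\ forall v, a v != 0 -> (colw v <= colw w1)%N.
  by rewrite /w1; case: arg_maxnP => // w aw mw.
pose P v := (a v != 0) && (colw v == colw w1).
have P1 : P w1 by rewrite /P aw1 eqxx.
pose w2 := [arg max_(w > w1 | P w) roww w]%N; exists w2.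
have [/andP[aw2 /eqP c2] max2] : P w2 /\ forall v, P v -> (roww v <= roww w2)%N.
  by rewrite /w2; case: arg_maxnP => // w aw mw.
split=> // v av; first by rewrite c2 max1.
by move=> cv; apply: max2; rewrite /P av cv c2 eqxx.
Qed.

Variable w : W.
Hypothesis aw : a w != 0.
Hypothesis maxc : forall v, a v != 0 -> (colw v <= colw w)%N.
Hypothesis maxr : forall v, a v != 0 -> colw v = colw w -> (roww v <= roww w)%N.

(** Exchanging two letters of a column in the wrong order would give a word of
    the support with the same colw and a larger roww.  If both are the same even
    letter, then the exchange fixes the word without a sign, while a must change
    sign. *)
Lemma support_col i j : col i = col j -> (row i < row j)%N -> let_le true (w i) (w j).
Proof.
move=> cij rij; have ij : i != j by apply: contraTneq rij => ->; rewrite ltnn.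
have at0 := a_tperm_neq0 cij aw.
have ct : forall k, col (tperm i j k) = col k by move=> k; case: tpermP => [->|->|//].
rewrite /let_le; case: (ltngtP (w i) (w j)) => //= [wji|/val_inj wij].
  have := maxr at0 (wsum_stab w ct); have := wsum_tperm row w ij.
  rewrite /roww; set S1 := (\sum_k _)%N; set S2 := (\sum_k _)%N.
  clearbody S1 S2; nia.
rewrite wij eqxx /= eqb_id; apply: contraT => odd_j.
have cs : colm_stab (tperm i j) by apply/forallP => k; rewrite ct.
have wt : wcomp w (tperm i j) = w.
  by apply/ffunP => k; rewrite ffunE; case: tpermP => [->|->|].
have := a_col cs w; rewrite /wact wt csgn_fix => [|k]; last first.
  by rewrite inE; case: tpermP => [->|->|//]; rewrite ?wij (negPf odd_j).
rewrite odd_tperm ij mul1r expr1 mulN1r => /eqP.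
by rewrite -addr_eq0 -mulr2n -mulr_natr mulf_eq0 (negPf aw) (negPf (charF 1)).
Qed.

Section Garnir.
Variables i j : 'I_n.
Hypothesis rij : row i = row j.
Hypothesis cij : col j = (col i).+1.
Hypothesis bad : ~~ let_le false (w i) (w j).

Let A := [set x | (col x == col i) && (row i <= row x)%N].
Let Bs := [set x | (col x == col j) && (row x <= row j)%N].

Lemma garnir_A x : x \in A -> (w i <= w x)%N.
Proof.
rewrite inE => /andP[/eqP cx]; rewrite leq_eqVlt => /predU1P[rx|rx].
  by rewrite (rc_inj rx (esym cx)).
exact: let_leW (support_col (esym cx) rx).
Qed.

Lemma garnir_B x : x \in Bs -> (w x <= w i)%N /\ (w x = w i -> par (w i)).
Proof.
rewrite inE => /andP[/eqP cx rx].
have wx : (w x <= w j)%N.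
  move: rx; rewrite leq_eqVlt => /predU1P[rx|rx]; first by rewrite (rc_inj rx cx).
  exact: let_leW (support_col cx rx).
move: bad; rewrite /let_le negb_or -leqNgt => /andP[wji pij].
split=> [|wxi]; first exact: leq_trans wji.
have wij : w i = w j by apply/val_inj/eqP; rewrite eqn_leq wji -wxi wx.
by move: pij; rewrite wij eqxx /= eqbF_neg negbK.
Qed.

(** When w violates the row condition at i and j, the letters on the side of i
    are all at least those on the side of j, so that carrying letters across
    never decreases colw.  If colw does not change, then the letters exchanged
    are equal and odd, and their sign compensates that of s; the rest of s is a
    column permutation. *)
Lemma garnir_term s : perm_on (garnir_set i j) s -> (colw w <= colw (wcomp w s))%N /\
  (colw (wcomp w s) = colw w -> (-1) ^+ odd_perm s * wact s a w = a w).
Proof.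
have AB x : x \in A -> x \notin Bs.
  by rewrite !inE cij => /andP[/eqP -> _]; rewrite (ltn_eqF (ltnSn _)).
have [m] := ubnP #|[set x in A | s x \in Bs]|; elim: m s => // m IH s sm sX.
have [D0|[x]] := set_0Vmem [set x in A | s x \in Bs].
  have sA x : x \in A -> s x \in A.
    move=> xA; have /setP/(_ x) := D0; rewrite in_set0 inE xA /= => sB.
    have := perm_closed x sX; rewrite /garnir_set !inE.
    by move: xA sB; rewrite !inE => -> /= ->; rewrite orbF => ->.
  have sAE : s @: A = A.
    apply/eqP; rewrite eqEcard card_imset ?leqnn ?andbT; last exact: perm_inj.
    by apply/subsetP => _ /imsetP[x xA ->]; apply: sA.
  have sc : forall x, col (s x) = col x.
    move=> x; have [xA|xA] := boolP (x \in A).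
      by have := sA _ xA; move: xA; rewrite !inE => /andP[/eqP -> _] /andP[/eqP -> _].
    have sxA : s x \notin A.
      by apply: contra xA; rewrite -{1}sAE (mem_imset _ _ (@perm_inj _ _)).
    have [xB|xB] := boolP (x \in Bs).
      have := perm_closed x sX; rewrite in_setU (negPf sxA) /= in_setU (negPf xA) xB.
      by move: xB; rewrite !inE => /andP[/eqP -> _] /= /andP[/eqP -> _].
    by rewrite (out_perm sX) // in_setU negb_or xA.
  split=> [|_]; first by rewrite /colw (wsum_stab w sc).
  have cs : colm_stab s by apply/forallP => x; rewrite sc.
  by rewrite (a_col cs) mulrA -expr2 sqrr_sign mul1r.
(* s carries x from the first column to the second, hence some y back; undo this exchange. *)
rewrite inE => /andP[xA sxB].
have [y yB syA] : exists2 y, y \in Bs & s y \in A.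
  have /subsetPn[y yB syB] : ~~ (Bs \subset s @^-1: Bs).
    apply/negP => sub; have /eqP E : Bs == s @^-1: Bs.
      rewrite eqEcard sub -(card_imset _ (@perm_inj _ s)) subset_leq_card //.
      by apply/subsetP => _ /imsetP[u uB ->]; rewrite inE in uB.
    by have := AB _ xA; rewrite E inE sxB.
  exists y => //; rewrite inE in syB.
  have := perm_closed y sX; rewrite in_setU (negPf syB) orbF in_setU yB orbT.
  by [].
have xy : x != y by apply: contraTneq yB => <-; apply: AB.
pose t := (tperm x y * s)%g.
have st : s = (tperm x y * t)%g by rewrite /t mulgA tperm2 mul1g.
have tX : perm_on (garnir_set i j) t.
  apply: perm_onM => //; apply/subsetP => k; rewrite !inE.
  by case: tpermP => [->|->|_ _]; rewrite ?eqxx //; [move: xA|move: yB];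
    rewrite !inE => ->; rewrite ?orbT.
have [|Ht1 Ht2] := IH t _ tX.
  rewrite -ltnS; apply: leq_trans sm; rewrite ltnS; apply: proper_card.
  apply/properP; split; last first.
    exists x; first by rewrite in_set xA sxB.
    by rewrite in_set permM tpermL negb_and AB ?orbT.
  apply/subsetP => k; rewrite in_set => /andP[kA]; rewrite in_set kA permM.
  case: tpermP kA => [_ _|-> yA|//]; first by rewrite (negPf (AB _ syA)).
  by have := AB _ yA; rewrite yB.
have cx : col x = col i by move: xA; rewrite inE => /andP[/eqP].
have cy : col y = (col i).+1 by move: yB; rewrite inE => /andP[/eqP ->].
have wst : wcomp w s = wcomp (wcomp w t) (tperm x y) by rewrite {1}st wcompM.
have := wsum_tperm col (wcomp w t) xy; rewrite -wst cx cy.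
rewrite !ffunE /t !permM tpermL tpermR -/t.
have lx := garnir_B sxB; have ly := garnir_A syA.
rewrite !mulSn -!/(colw _) => /swap_arith EC.
have [le_ts eq_ts] := squeeze_arith EC lx.1 ly.
split=> [|Es]; first exact: leq_trans Ht1 le_ts.
have Et : colw (wcomp w t) = colw w.
  by apply/eqP; rewrite eqn_leq Ht1 andbT -Es.
have [/val_inj wsx /val_inj wsy] := eq_ts (etrans Es (esym Et)).
have pari := lx.2 wsx.
have tw : wcomp (wcomp w t) (tperm x y) = wcomp w t.
  apply/ffunP => k; rewrite !ffunE /t !permM tpermK.
  by case: tpermP => [->|->|//]; rewrite wsx wsy.
rewrite -{}Ht2 // {1 2}st odd_mul_tperm xy wactM /wact tw csgn_tperm //.
- by rewrite signr_addb !mulN1r mulrN mulNr mulrN opprK.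
- by rewrite inE ffunE /t permM tpermL wsy.
- by rewrite inE ffunE /t permM tpermR wsx.
Qed.

(** By maximality of w only the terms with the same colw survive in the Garnir
    relation; each equals a w, and the identity contributes one of them, so that
    a positive multiple of a w vanishes. *)
Lemma garnir_false : False.
Proof.
have := a_garnir rij cij w.
have E s : perm_on (garnir_set i j) s -> (-1) ^+ odd_perm s * wact s a w =
    (colw (wcomp w s) == colw w)%:R * a w.
  move=> /garnir_term[le_ws Hs]; have [/Hs ->|ne] := eqVneq (colw _) _.
    by rewrite mul1r.
  rewrite mul0r /wact; have [->|/maxc] := eqVneq (a (wcomp w s)) 0.
    by rewrite !mulr0.
  by move=> le_sw; case/eqP: ne; apply/eqP; rewrite eqn_leq le_sw.
rewrite (eq_bigr _ E) -mulr_suml -natr_sum (bigD1 1%g) ?perm_on1 //=.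
by rewrite wcomp1 eqxx add1n => /eqP; rewrite mulf_eq0 (negPf (charF _)) (negPf aw).
Qed.

End Garnir.

(** Adjacent columns are garnir_false; the general case follows by transitivity
    along the row. *)
Lemma support_row i j : row i = row j -> (col i < col j)%N -> let_le false (w i) (w j).
Proof.
have [m] := ubnP (col j); elim: m j => // m IH j.
rewrite ltnS => cm rij cij.
have [k rk ck] := rc_shape (leqnn (row j)) (leq_pred (col j)).
have bad_kj : let_le false (w k) (w j).
  apply: contraT => bad; case: (@garnir_false k j) => //.
  by rewrite ck prednK // (leq_trans _ cij).
have [ik|ik] := eqVneq (col i) (col k).
  by rewrite (rc_inj (etrans rij (esym rk)) ik).
apply: let_le_trans bad_kj; apply: IH; rewrite ?rk //; last by move: cij ik; rewrite ck; lia.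
by move: cij cm; rewrite ck; lia.
Qed.

Lemma support_ss : word_ss w.
Proof.
apply/forallP => i; apply/forallP => j; apply/andP; split; apply/implyP => /andP[/eqP rc lt].
  exact: support_row.
exact: support_col.
Qed.

End Upper.

(** The words in the support of a nonzero vector with these symmetries include a
    semistandard one, so the semistandard words determine the vector. *)
Lemma upper_bound a :
  (forall s, colm_stab s -> wact s a =1 (fun w => (-1) ^+ odd_perm s * a w)) ->
  (forall i j, row i = row j -> col j = (col i).+1 ->
    forall w, \sum_(s | perm_on (garnir_set i j) s) (-1) ^+ odd_perm s * wact s a w = 0) ->
  (forall w, word_ss w -> a w = 0) -> a =1 (fun=> 0).
Proof.
move=> a_col a_garnir a_ss w; apply/eqP; apply: contraT => aw.
have [v [av mc mr]] : exists w, [/\ a w != 0,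
  forall v, a v != 0 -> (colw v <= colw w)%N &
  forall v, a v != 0 -> colw v = colw w -> (roww v <= roww w)%N].
  by apply: max_support; exists w.
by case/eqP: (av); apply/a_ss/(support_ss a_col a_garnir av mc mr).
Qed.

Definition line_sorted (line pos : 'I_n -> nat) w :=
  forall i j, line i = line j -> (pos i < pos j)%N -> (w i <= w j)%N.

(** If v (s i) were smaller than v i, then s would map the places up to i on its
    line into those strictly before i. *)
Lemma line_sorted_le (line pos : 'I_n -> nat) v s :
  (forall i j, line i = line j -> pos i = pos j -> i = j) ->
  (forall i, line (s i) = line i) -> line_sorted line pos v ->
  line_sorted line pos (wcomp v s) -> forall i, (v i <= v (s i))%N.
Proof.
move=> lp_inj ls sv svs i; rewrite leqNgt; apply/negP => lt_vi.
pose T := [set j | (line j == line i) && (pos j <= pos i)%N].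
have : (#|T| <= #|T :\ i|)%N.
  apply: (@leq_trans #|s @: T|); first by rewrite card_imset //; apply: perm_inj.
  pose S := [set j | (line j == line i) && (v j <= v (s i))%N].
  apply: (@leq_trans #|S|); apply: subset_leq_card; apply/subsetP => j.
    case/imsetP => k; rewrite !inE => /andP[/eqP lk pk] ->; rewrite ls lk eqxx /=.
    move: pk; rewrite leq_eqVlt => /predU1P[pk|pk]; first by rewrite (lp_inj _ _ lk pk).
    by have := svs _ _ lk pk; rewrite !ffunE.
  rewrite !inE => /andP[/eqP lj vj]; rewrite lj eqxx /= andbC.
  have [ji|ji] := leqP (pos j) (pos i).
    by apply: contraTneq vj => ->; rewrite -ltnNge.
  have := leq_trans (sv _ _ (esym lj) ji) vj.
  by rewrite leqNgt lt_vi.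
by rewrite [#|T|](cardsD1 i) inE eqxx leqnn add1n ltnn.
Qed.

Lemma line_sorted_uniq (line pos : 'I_n -> nat) v s :
  (forall i j, line i = line j -> pos i = pos j -> i = j) ->
  (forall i, line (s i) = line i) -> line_sorted line pos v ->
  line_sorted line pos (wcomp v s) -> wcomp v s = v.
Proof.
move=> lp_inj ls sv svs; apply/ffunP => i; apply/val_inj/eqP => /=.
rewrite eqn_leq ffunE (line_sorted_le lp_inj ls sv svs) andbT.
have ls' j : line (s^-1%g j) = line j by rewrite -[in RHS](permKV s j) ls.
have E : wcomp (wcomp v s) s^-1%g = v by rewrite -wcompM mulVg wcomp1.
have := line_sorted_le lp_inj ls' svs; rewrite E => /(_ sv i).
by rewrite !ffunE permKV.
Qed.

Lemma word_ss_row w : word_ss w -> line_sorted row col w.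
Proof.
move=> /forallP ssw i j rij cij; have /forallP/(_ j)/andP[+ _] := ssw i.
by rewrite rij eqxx cij => /let_leW.
Qed.

Lemma word_ss_col w : word_ss w -> line_sorted col row w.
Proof.
move=> /forallP ssw i j rij cij; have /forallP/(_ j)/andP[_] := ssw i.
by rewrite rij eqxx cij => /let_leW.
Qed.

Lemma colm_stabP s i : colm_stab s -> col (s i) = col i.
Proof. by move/forallP/(_ i)/eqP. Qed.

Lemma row_stabP s i : row_stab s -> row (s i) = row i.
Proof. by move/forallP/(_ i)/eqP. Qed.

Lemma cr_inj i j : col i = col j -> row i = row j -> i = j.
Proof. by move=> cij rij; apply: rc_inj. Qed.

Lemma colm_stab_tperm i j s : col i = col j -> colm_stab s -> colm_stab (tperm i j * s)%g.
Proof.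
move=> cij cs; apply/forallP => k; rewrite permM (colm_stabP _ cs).
by case: tpermP => [->|->|//]; rewrite cij.
Qed.

(** The rearrangement inequality: two letters of a column in the wrong order can
    be exchanged to increase roww. *)
Lemma roww_max_sorted v s : colm_stab s ->
  (forall t, colm_stab t -> (roww (wcomp v t) <= roww (wcomp v s))%N) ->
  line_sorted col row (wcomp v s).
Proof.
move=> cs maxs i j cij rij; rewrite leqNgt; apply/negP => ltji.
have ij : i != j by apply: contraTneq rij => ->; rewrite ltnn.
have := maxs _ (colm_stab_tperm cij cs); have := wsum_tperm row (wcomp v s) ij.
rewrite -wcompM -!/(roww _); move: (roww _) (roww _) => S1 S2.
move: ltji rij; rewrite leqNgt; move: (row i) (row j) (wcomp v s i : nat) (wcomp v s j : nat).
by clear; nia.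
Qed.

Lemma roww_rearr v s : word_ss v -> colm_stab s ->
  (roww (wcomp v s) <= roww v)%N /\ (roww (wcomp v s) = roww v -> wcomp v s = v).
Proof.
move=> ssv cs; have sv := word_ss_col ssv.
pose s0 := [arg max_(t > 1%g : 'S_n | colm_stab t) roww (wcomp v t)]%N.
have c1 : colm_stab 1%g by apply/forallP => k; rewrite perm1.
have [cs0 max0] : colm_stab s0 /\
    forall t, colm_stab t -> (roww (wcomp v t) <= roww (wcomp v s0))%N.
  by rewrite /s0; case: arg_maxnP => // t ct mt.
have E0 : wcomp v s0 = v.
  apply: (line_sorted_uniq cr_inj) => //; last exact: roww_max_sorted.
  by move=> i; apply: colm_stabP.
split; first by rewrite -{2}E0 max0.
move=> Es; apply: (line_sorted_uniq cr_inj) => //; first by move=> i; apply: colm_stabP.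
by apply: roww_max_sorted => // t ct; rewrite Es -{2}E0 max0.
Qed.

(** The coefficient of v in the image of a polytabloid under the map attached to
    w: q runs over the column permutations, with sign, and p over the row
    permutations. *)
Definition young_coef w v : F :=
  \sum_(q | colm_stab q) \sum_(p | row_stab p)
    (-1) ^+ odd_perm q * (csgn F (p * q)%g (odds w) * (wcomp v (p * q)%g == w)%:R).

(** If w comes from v by a column and then a row permutation, then the column
    permutation can only lower roww from its maximal value at the sorted columns
    of v, and the row permutation does not change it. *)
Lemma young_coef_tri w v : word_ss w -> word_ss v -> young_coef w v != 0 ->
  v = w \/ (roww w < roww v)%N.
Proof.
move=> ssw ssv nz.
have /existsP[q /existsP[p /and3P[cq rp /eqP E]]] :
    [exists q, exists p, [&& colm_stab q, row_stab p & wcomp v (p * q)%g == w]].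
  apply: contraR nz => /existsPn H; apply/eqP; rewrite /young_coef big1 // => q cq.
  rewrite big1 // => p rp; move/existsPn/(_ p): (H q); rewrite cq rp /= => /negPf ->.
  by rewrite !mulr0.
have [le_q eq_q] := roww_rearr ssv cq.
have Ew : roww w = roww (wcomp v q).
  by rewrite -E wcompM /roww wsum_stab // => i; apply: row_stabP.
move: le_q; rewrite -Ew leq_eqVlt => /predU1P[Er|]; [left|by right].
have Ep : wcomp v p = w by rewrite -E wcompM eq_q // -Ew.
rewrite -Ep; symmetry; apply: (line_sorted_uniq rc_inj).
- by move=> i; apply: row_stabP.
- exact: word_ss_row.
- by rewrite Ep; apply: word_ss_row.
Qed.

(** A pair p, q contributes to the diagonal only if both fix w.  Then q permutes
    equal letters of columns, which are odd, so that its sign cancels the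
    Clifford sign, and p permutes equal letters of rows, which are even.  So all
    contributions are 1, and the identity gives one. *)
Lemma young_coef_diag w : word_ss w -> young_coef w w != 0.
Proof.
move=> ssw; have fixw s i : wcomp w s = w -> w (s i) = w i.
  by move=> E; rewrite -[in RHS]E ffunE.
pose P q p := [&& colm_stab q, row_stab p & wcomp w (p * q)%g == w].
have E q p : colm_stab q -> row_stab p ->
   (-1) ^+ odd_perm q * (csgn F (p * q)%g (odds w) * (wcomp w (p * q)%g == w)%:R) =
   (wcomp w (p * q)%g == w)%:R.
  move=> cq rp; case: eqP => [E|]; last by rewrite !mulr0.
  have [le_q eq_q] := roww_rearr ssw cq.
  have Eq : wcomp w q = w.
    by apply: eq_q; rewrite -{2}E wcompM /roww [RHS]wsum_stab // => i; apply: row_stabP.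
  have Ep : wcomp w p = w by move: E; rewrite wcompM Eq.
  have /forallP ss := ssw.
  have po : p @: odds w = odds w by rewrite -{1}Ep odds_wcomp.
  rewrite csgnM po csgn_fix ?csgn_perm_on ?mul1r ?mulr1 -?expr2 ?sqrr_sign //.
    apply/subsetP => i; rewrite !inE => qi.
    have cqi := colm_stabP i cq.
    case: (ltngtP (row (q i)) (row i)) => [lt|lt|/rc_inj Hi]; last first.
      by move: qi; rewrite (Hi cqi) eqxx.
      have /forallP/(_ (q i))/andP[_] := ss i; rewrite cqi eqxx lt /=.
      by rewrite /let_le (fixw _ _ Eq) ltnn eqxx /= eqb_id.
    have /forallP/(_ i)/andP[_] := ss (q i); rewrite cqi eqxx lt /=.
    by rewrite /let_le (fixw _ _ Eq) ltnn eqxx /= eqb_id.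
  move=> i; rewrite inE => pari; have rpi := row_stabP i rp.
  case: (ltngtP (col (p i)) (col i)) => [lt|lt|/(rc_inj rpi) //].
    have /forallP/(_ i)/andP[+ _] := ss (p i); rewrite rpi eqxx lt /=.
    by rewrite /let_le (fixw _ _ Ep) ltnn eqxx /= pari.
  have /forallP/(_ (p i))/andP[+ _] := ss i; rewrite rpi eqxx lt /=.
  by rewrite /let_le (fixw _ _ Ep) ltnn eqxx /= pari.
rewrite /young_coef.
under eq_bigr => q cq do rewrite (eq_bigr _ (fun p rp => E q p cq rp)) -natr_sum.
have c1 : colm_stab 1%g by apply/forallP => k; rewrite perm1.
have r1 : row_stab 1%g by apply/forallP => k; rewrite perm1.
rewrite -natr_sum (bigD1 1%g) //= (bigD1 1%g) //= mulg1 wcomp1 eqxx -addnA add1n.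
exact: charF.
Qed.

(** Evaluate a linear relation at the word of smallest roww that occurs in
    it. *)
Lemma young_free (c : W -> F) :
  (forall v, word_ss v -> \sum_(w | word_ss w) c w * young_coef w v = 0) ->
  forall w, word_ss w -> c w = 0.
Proof.
move=> H w ssw; apply/eqP; apply: contraT => cw.
pose P w := word_ss w && (c w != 0).
have Pw : P w by rewrite /P ssw.
pose w0 := [arg min_(v < w | P v) roww v]%N.
have [/andP[ss0 c0] min0] : P w0 /\ forall v, P v -> (roww w0 <= roww v)%N.
  by rewrite /w0; case: arg_minnP => // v Pv mv.
have := H _ ss0; rewrite (bigD1 w0) //= big1 => [/eqP|v /andP[ssv ne]]; last first.
  have [->|cv] := eqVneq (c v) 0; first by rewrite mul0r.
  have [->|nz] := eqVneq (young_coef v w0) 0; first by rewrite mulr0.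
  have [E|lt] := young_coef_tri ssv ss0 nz; first by rewrite E eqxx in ne.
  by have := min0 v; rewrite /P ssv cv leqNgt lt => /(_ isT).
by rewrite addr0 mulf_eq0 (negPf c0) (negPf (young_coef_diag ss0)).
Qed.

End SignedWords.

(** * Diagrams of partitions *)

Lemma sorted_nth (s : seq nat) i j : sorted geq s -> (i <= j)%N -> (nth 0 s j <= nth 0 s i)%N.
Proof.
move=> ss ij; have [sj|] := ltnP j (size s); last by move=> sj; rewrite nth_default.
apply: (sorted_leq_nth (leT := geq)) (ij) => //; rewrite ?inE //.
- by move=> x y z; rewrite /geq => yx xz; apply: leq_trans xz yx.
- by move=> x; apply: leqnn.
- exact: leq_ltn_trans ij sj.
Qed.

Lemma mk_cell (s : seq nat) i j : (j < nth 0 s i)%N ->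
  exists2 c : cell s, row c = i :> nat & col c = j.
Proof.
move=> ji; have il : (i < size s)%N by case: ltnP => // li; rewrite nth_default in ji.
by exists (Tagged (fun i : 'I_(size s) => 'I_(nth 0 s i))
  (Ordinal (ji : (j < nth 0 s (Ordinal il))%N))).
Qed.

Lemma cell_inj (s : seq nat) (c d : cell s) :
  row c = row d :> nat -> col c = col d -> c = d.
Proof.
case: c d => [i j] [i' j']; rewrite /row /col /= => /val_inj E.
by move: j'; rewrite -{}E => j' /val_inj ->.
Qed.

(** * Equivariant maps out of the Specht module *)

Section SymCoef.
Variables (F : fieldType) (n : nat).
Implicit Types (g : hypoct n) (p : {mpoly F[n]}) (m : 'X_{1..n}).

Lemma sym_varX g m : 'X_[m] \mPo sym_var F g =
  (-1) ^+ (\sum_i g.1 i * m i)%N *: 'X_[[multinom m ((g.2)^-1%g i) | i < n]].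
Proof.
rewrite comp_mpolyX (mpolyXE _ g.2) expr_sum -scaler_prod.
by apply: eq_bigr => i _; rewrite tnth_mktuple exprZn exprM mnmE permK.
Qed.

(** A signed permutation sends monomials to monomials up to sign, so a
    coefficient of the image is a single coefficient of p. *)
Lemma mcoeff_sym_var g p m : (p \mPo sym_var F g)@_m =
  (-1) ^+ (\sum_i g.1 i * m (g.2 i))%N * p@_[multinom m (g.2 i) | i < n].
Proof.
rewrite comp_mpolyEX [in RHS](mpolyE p) !linear_sum mulr_sumr /=.
apply: eq_bigr => k _; rewrite !mcoeffZ sym_varX mcoeffZ !mcoeffX.
have -> : ([multinom k ((g.2)^-1%g i) | i < n] == m) = (k == [multinom m (g.2 i) | i < n]).
  apply/eqP/eqP => [<-|->]; apply/mnmP => i; rewrite !mnmE ?permK ?permKV //.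
have [->|_] := eqVneq; last by rewrite !mulr0.
by rewrite mulrCA; under eq_bigr do rewrite mnmE.
Qed.

End SymCoef.

Lemma hgrpM (F : fieldType) n (g h : hypoct n) : hgrp F g * hgrp F h = hgrp F (g * h)%g.
Proof.
apply/ffunP => k; rewrite hgrp_mull !ffunE.
rewrite (can2_eq (mulKVg g) (mulKg g)).
by case: eqP => _; rewrite ?cact1 ?linear0.
Qed.

Section Link.
Variables (F : fieldType) (n k B : nat) (deg : 'I_B -> nat).
Hypothesis charF : forall m, m.+1%:R != 0 :> F.
Hypothesis deg_inj : injective deg.
Hypothesis deg_onto : forall d, (d <= k)%N -> exists x, deg x = d.
Local Notation W := {ffun 'I_n.+1 -> 'I_B}.
Local Notation N := (sym_rep F n k).
Local Notation CN := (cliff_tensor N).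
Local Notation par := (fun x : 'I_B => odd (deg x)).
Implicit Types (s t : 'S_n.+1) (v w : W) (m : CN) (e : {ffun 'I_n.+1 -> bool}).

(** Letters are numbered by their position in the order used for fillings, which
    need not be the order of their degrees. *)
Definition mon w : 'X_{1..n.+1} := [multinom deg (w i) | i < n.+1].

(** Coordinates are recorded only at words; a vector fixed by all sign changes
    has no others. *)
Definition word_coef m w : F :=
  (mpoly_of_dhomog ((m : ctens n.+1 N) (odds par w)))@_(mon w).

Lemma word_coef_linear c m1 m2 w : word_coef (c *: m1 + m2) w = c * word_coef m1 w + word_coef m2 w.
Proof. by rewrite /word_coef ctens_linear (linearP (@mpoly_of_dhomog _ _ _)) mcoeffD mcoeffZ. Qed.

Lemma word_coef0 w : word_coef 0 w = 0.
Proof. by rewrite /word_coef ffunE (linear0 (@mpoly_of_dhomog _ _ _)) mcoeff0. Qed.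

Lemma word_coef_sum I (r : seq I) (c : I -> F) (f : I -> CN) w :
  word_coef (\sum_(i <- r) c i *: f i) w = \sum_(i <- r) c i * word_coef (f i) w.
Proof.
elim: r => [|i r IH]; first by rewrite !big_nil word_coef0.
by rewrite !big_cons word_coef_linear IH.
Qed.

Lemma sym_gactE g (p : N) :
  mpoly_of_dhomog (sym_act F k g p) = mpoly_of_dhomog p \mPo sym_var F g.
Proof. by rewrite lfunE. Qed.

Lemma word_coef_hperm s m w :
  word_coef (sact CN (hgrp F (hperm s)) m) w = wact par s (word_coef m) w.
Proof.
rewrite /word_coef tact_hgrp sum_ffunE (bigD1 (odds par (wcomp w s))) //= big1 => [|C nC].
  rewrite addr0 ffunE cact_base odds_wcomp !ffunE eqxx [_ *: 1]mulr1.
  rewrite (linearZ_LR (@mpoly_of_dhomog _ _ _)) mcoeffZ /= sym_gactE mcoeff_sym_var /wact /word_coef.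
  rewrite big1 ?mul1r => [|i _]; last by rewrite ffunE.
  congr (_ * _@__).
  by apply/mnmP => i; rewrite !mnmE ffunE.
rewrite ffunE cact_base !ffunE -{1}(odds_wcomp par w s) (inj_eq (imset_inj (@perm_inj _ s))).
by rewrite eq_sym (negPf nC) [_ *: 0]mulr0 scale0r.
Qed.

Definition hflip e : hypoct n.+1 := (e, 1%g).

Lemma cact_flip e (A : {set 'I_n.+1}) :
  cact (hflip e) (cbase F A) = (-1) ^+ (\sum_(i in A) e i)%N *: cbase F A.
Proof.
rewrite -prod_cgen (big_morph _ (cactM _) (cact1 _ _)) expr_sum -scaler_prod.
by apply: eq_bigr => i _; rewrite cact_cgen perm1.
Qed.

Lemma flip_coef e m (A : {set 'I_n.+1}) mu :
  (mpoly_of_dhomog ((sact CN (hgrp F (hflip e)) m : ctens n.+1 N) A))@_mu =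
  (-1) ^+ (\sum_(i in A) e i)%N * ((-1) ^+ (\sum_i e i * mu i)%N *
    (mpoly_of_dhomog ((m : ctens n.+1 N) A))@_mu).
Proof.
rewrite tact_hgrp sum_ffunE (bigD1 A) //= big1 => [|C nC].
  rewrite addr0 ffunE cact_flip !ffunE eqxx [_ *: 1]mulr1.
  rewrite (linearZ_LR (@mpoly_of_dhomog _ _ _)) mcoeffZ /= sym_gactE mcoeff_sym_var.
  have -> : (\sum_i (hflip e).1 i * mu ((hflip e).2 i) = \sum_i e i * mu i)%N.
    by apply: eq_bigr => i _; rewrite /= perm1.
  congr (_ * (_ * _@__)).
  by apply/mnmP => i; rewrite !mnmE /= perm1.
by rewrite ffunE cact_flip !ffunE eq_sym (negPf nC) [_ *: 0]mulr0 scale0r.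
Qed.

Definition flip_inv m := forall e, sact CN (hgrp F (hflip e)) m = m.

(** The sign change at i acts on c_A x^mu by - 1 if exactly one of the following
    holds: mu_i is odd, or i lies in A. *)
Lemma flip_inv_parity m (A : {set 'I_n.+1}) (mu : 'X_{1..n.+1}) i : flip_inv m -> odd (mu i) != (i \in A) ->
  (mpoly_of_dhomog ((m : ctens n.+1 N) A))@_mu = 0.
Proof.
move=> inv; have := flip_coef [ffun j => j == i] m A mu; rewrite inv.
set c := _@_mu.
have -> : (\sum_(j in A) [ffun j => j == i] j = (i \in A))%N.
  case: (boolP (i \in A)) => iA; last first.
    by rewrite big1 // => j jA; rewrite ffunE; case: eqP jA iA => // -> ->.
  by rewrite (bigD1 i) //= big1 ?ffunE ?eqxx // => j /andP[_ /negPf]; rewrite ffunE => ->.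
rewrite (bigD1 i) //= [X in (_ + X)%N]big1 => [|j /negPf ji]; last first.
  by rewrite ffunE ji.
rewrite ffunE eqxx mul1n addn0 mulrA -exprD -signr_odd oddD oddb.
case: (i \in A); case: (odd (mu i)) => //= + _; rewrite expr1 mulN1r => /eqP;
by rewrite -addr_eq0 -mulr2n -mulr_natr mulf_eq0 (negPf (charF 1)) orbF => /eqP.
Qed.

Lemma word_coef_inj m : flip_inv m -> word_coef m =1 (fun=> 0) -> m = 0.
Proof.
move=> inv m0; apply: ctensP => A; rewrite [RHS]ffunE.
apply/val_inj/mpolyP => mu; rewrite (linear0 (@mpoly_of_dhomog _ _ _)) mcoeff0 /=.
have [dk|dk] := eqVneq (mdeg mu) k; last first.
  by apply: dhomog_nemf_coeff dk; apply: dhomog_is_dhomog.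
have [/existsP[i ni]|] := boolP [exists i, odd (mu i) != (i \in A)].
  exact: flip_inv_parity ni.
move=> /existsPn Hp.
have muk i : (mu i <= k)%N by rewrite -dk mdegE (bigD1 i) //= leq_addr.
have /fin_all_exists[f fP] i := deg_onto (muk i).
pose w : W := [ffun i => f i].
have -> : A = odds par w.
  by apply/setP => i; rewrite inE ffunE fP; have := Hp i; rewrite negbK => /eqP.
have -> : mu = mon w by apply/mnmP => i; rewrite mnmE ffunE fP.
exact: m0.
Qed.

Definition wdeg w := (\sum_i deg (w i))%N.

Definition bas w : CN := tens (cbase F (odds par w)) (indhomog k 'X_[mon w] : N).

Lemma bas_val w : wdeg w = k -> mpoly_of_dhomog (indhomog k 'X_[F, mon w]) = 'X_[mon w].
Proof.
move=> wk; rewrite /indhomog val_insubd ifT // dhomogX -wk; apply/eqP.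
by rewrite [LHS]mdegE; apply: eq_bigr => i _; rewrite mnmE.
Qed.

Lemma word_coef_bas w v : wdeg w = k -> word_coef (bas w) v = (v == w)%:R.
Proof.
move=> wk; rewrite /word_coef /bas !ffunE (linearZ_LR (@mpoly_of_dhomog _ _ _)) mcoeffZ /= bas_val // mcoeffX.
have [->|ne] := eqVneq v w; first by rewrite !eqxx mulr1.
have [E|_] := eqVneq (mon w) (mon v); last by rewrite mulr0.
case/eqP: ne; apply/ffunP => i; apply: deg_inj.
by move/mnmP/(_ i): E; rewrite !mnmE.
Qed.

Lemma bas_flip w : wdeg w = k -> flip_inv (bas w).
Proof.
move=> wk e; apply: ctensP => A; apply/val_inj/mpolyP => mu /=.
rewrite flip_coef /bas !ffunE (linearZ_LR (@mpoly_of_dhomog _ _ _)) mcoeffZ /= bas_val // mcoeffX.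
have [->|_] := eqVneq A (odds par w); last by rewrite mul0r !mulr0.
have [<-|_] := eqVneq (mon w) mu; last by rewrite !mulr0.
rewrite mulrA -exprD -signr_odd big_mkcond -big_split /=.
rewrite (big_morph odd oddD (erefl : odd 0 = false)) big1 ?mul1r // => i _.
by rewrite inE mnmE; case: ifP => od; rewrite oddD oddM od; case: (e i).
Qed.

Section SpechtLink.
Variable lam : seq nat.
Hypothesis lam_sorted : sorted geq lam.
Variable T0 : {ffun 'I_n.+1 -> cell lam}.
Hypothesis T0_tab : is_tableau T0.
Local Notation M := (specht_rep F n.+1 lam).

Definition trow (i : 'I_n.+1) : nat := row (T0 i).
Definition tcol (i : 'I_n.+1) : nat := col (T0 i).

Lemma trc_inj i j : trow i = trow j -> tcol i = tcol j -> i = j.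
Proof.
by move=> r c; case/andP: T0_tab => /injectiveP T0i _; apply/T0i/cell_inj.
Qed.

Lemma T0_onto c : exists i, T0 i = c.
Proof.
by case/andP: T0_tab => _ /forallP/(_ c)/codomP[i ->]; exists i.
Qed.

Lemma has_cell r c : (c < nth 0 lam r)%N -> exists2 i, trow i = r & tcol i = c.
Proof.
by case/mk_cell => d dr dc; have [i E] := T0_onto d; exists i; rewrite /trow /tcol E.
Qed.

Lemma tcol_lt i : (tcol i < nth 0 lam (trow i))%N.
Proof. exact: ltn_ord. Qed.

Lemma trc_shape i r c : (r <= trow i)%N -> (c <= tcol i)%N ->
  exists2 j, trow j = r & tcol j = c.
Proof.
move=> ri ci; apply: has_cell; apply: leq_ltn_trans ci _.
exact: leq_trans (tcol_lt i) (sorted_nth lam_sorted ri).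
Qed.

Local Notation t0 := (tabloid T0).
Local Notation poly0 := (polytabloid F T0).

Lemma poly0_specht : poly0 \in specht F n.+1 lam.
Proof. by apply/memv_span/imageP; exists T0. Qed.

Definition gen0 : M := vsproj (specht F n.+1 lam) poly0.

Lemma gen0E : vsval gen0 = poly0.
Proof. by rewrite vsprojK ?poly0_specht. Qed.

Lemma colm_stabE s : colm_stab tcol s = col_stab T0 s.
Proof. by []. Qed.

Lemma col_stabM s t : colm_stab tcol s -> colm_stab tcol t -> colm_stab tcol (s * t)%g.
Proof.
move=> cs ct; apply/forallP => i; rewrite permM.
by rewrite (colm_stabP _ ct) (colm_stabP _ cs).
Qed.

Lemma col_stabV s : colm_stab tcol s -> colm_stab tcol s^-1%g.
Proof.
by move=> cs; apply/forallP => i; rewrite -[X in _ == tcol X](permKV s) (colm_stabP _ cs).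
Qed.

Lemma gen0_col s : colm_stab tcol s -> pmod_act_fun s poly0 = (-1) ^+ odd_perm s *: poly0.
Proof.
move=> cs; apply/ffunP => w; rewrite !ffunE /GRing.scale /= mulr_sumr.
rewrite [RHS](reindex_inj (mulIg s)) /=; apply: eq_big => [q|q _]; last first.
  by rewrite odd_permM signr_addb mulrCA -expr2 sqrr_sign mulr1.
congr (_ && _).
  rewrite -!colm_stabE; apply/idP/idP => cq; first exact: col_stabM.
  by rewrite -[q](mulgK s); apply: col_stabM => //; apply: col_stabV.
rewrite -word_actM; apply/eqP/eqP => [<-|->].
  by rewrite word_actM mulVg word_act1.
by rewrite word_actM mulgV word_act1.
Qed.

Lemma word_act_inj s : injective (@word_act n.+1 lam s).
Proof.
by apply: (can_inj (g := word_act s^-1%g)) => w; rewrite word_actM mulgV word_act1.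
Qed.

Lemma word_act_t0 p : (word_act p t0 == t0) = row_stab trow p.
Proof.
apply/eqP/forallP => [E i|E].
  by move/ffunP/(_ (p i)): E; rewrite !ffunE permK /trow => ->.
apply/ffunP => i; rewrite !ffunE; apply/val_inj/eqP => /=.
by have := E (p^-1%g i); rewrite permKV eq_sym.
Qed.

(** The cells of the Garnir set lie in columns at least that of i, so the values
    of the tabloid on them are rows that meet the column of i.  These are fewer
    than the cells of the Garnir set, so two of the cells get the same row. *)
Lemma garnir_pigeon i j q : trow i = trow j -> tcol j = (tcol i).+1 ->
  colm_stab tcol q ->
  exists x y, [/\ x \in garnir_set trow tcol i j, y \in garnir_set trow tcol i j,
     x != y & word_act q t0 x = word_act q t0 y].
Proof.
move=> rij cij cq; set X := garnir_set _ _ _ _.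
pose f x := word_act q t0 x.
have [finj|/dinjectivePn[x xX [y]]] := boolP (dinjectiveb f (mem X)); last first.
  by rewrite inE => /andP[yx yX] E; exists x, y; rewrite eq_sym; split.
pose A := [set x | (tcol x == tcol i) && (trow i <= trow x)%N].
pose Bs := [set x | (tcol x == tcol j) && (trow x <= trow j)%N].
pose R : {set 'I_(size lam)} := [set r : 'I_(size lam) | (tcol i < nth 0 lam r)%N].
pose U : {set 'I_(size lam)} := [set r in R | (trow i <= r)%N].
pose V : {set 'I_(size lam)} := [set r : 'I_(size lam) | (r <= trow i)%N].
have AB : [disjoint A & Bs].
  rewrite disjoint_subset; apply/subsetP => x; rewrite !inE cij => /andP[/eqP -> _].
  by rewrite (ltn_eqF (ltnSn _)).
have cX : (#|U| + #|V| <= #|X|)%N.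
  rewrite (cardsU A Bs) (disjoint_setI0 AB) cards0 subn0; apply: leq_add.
    apply: leq_trans (leq_imset_card (fun x => row (T0 x)) _); apply: subset_leq_card.
    apply/subsetP => r; rewrite !inE => /andP[rc ri].
    have [x xr xc] := has_cell rc; apply/imsetP; exists x; last exact: val_inj.
    by rewrite inE xc eqxx xr.
  apply: leq_trans (leq_imset_card (fun x => row (T0 x)) _); apply: subset_leq_card.
  apply/subsetP => r; rewrite !inE => ri.
  have [|x xr xc] := @has_cell r (tcol j).
    by apply: leq_trans (tcol_lt j) (sorted_nth lam_sorted _); rewrite -rij.
  apply/imsetP; exists x; last exact: val_inj.
  by rewrite inE xc eqxx xr -rij.
have RUV : (#|R| < #|U| + #|V|)%N.
  rewrite -cardsUI -addn1; apply: leq_add.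
    apply/subset_leq_card/subsetP => r; rewrite !inE => -> /=.
    by case: (leqP (trow i) r) => // /ltnW.
  rewrite card_gt0; apply/set0Pn; exists (row (T0 i)).
  by rewrite !inE /trow leqnn !andbT; apply: tcol_lt.
have : (#|f @: X| <= #|R|)%N.
  apply/subset_leq_card/subsetP => _ /imsetP[x xX ->]; rewrite inE /f !ffunE.
  have := tcol_lt (q^-1%g x); rewrite (colm_stabP _ (col_stabV cq)).
  apply: leq_trans; move: xX; rewrite !inE => /orP[/andP[/eqP -> _] //|/andP[/eqP -> _]].
  by rewrite cij.
rewrite card_in_imset; last by apply/dinjectiveP.
by rewrite leqNgt (leq_trans RUV cX).
Qed.

(** For each column permutation q the exchange of the two places with the same
    row in q t0 fixes q t0 and changes the sign, so the terms of the alternating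
    sum cancel in pairs. *)
Lemma gen0_garnir i j : trow i = trow j -> tcol j = (tcol i).+1 ->
  \sum_(s | perm_on (garnir_set trow tcol i j) s)
     (-1) ^+ odd_perm s *: pmod_act_fun s poly0 = 0.
Proof.
move=> rij cij; apply/ffunP => w; rewrite sum_ffunE [RHS]ffunE.
under eq_bigr do rewrite !ffunE /GRing.scale /= mulr_sumr.
rewrite (exchange_big_dep (col_stab T0)) /=; last by move=> s q _ /andP[].
apply: big1 => q cq.
have [x [y [xX yX xy E]]] := garnir_pigeon rij cij cq.
(* Composing with the transposition of x and y maps the sum to its opposite. *)
set S := \sum_(_ | _) _; have : S = - S.
  rewrite {1}/S (reindex_inj (mulgI (tperm x y))) /= -sumrN; apply: eq_big => [s|s _].
    have tX : perm_on (garnir_set trow tcol i j) (tperm x y).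
      apply/subsetP => k0; rewrite !inE; case: tpermP => [->|->|]; rewrite ?eqxx //.
        by move: xX; rewrite !inE.
      by move: yX; rewrite !inE.
    congr (_ && _).
      apply/idP/idP => sX; last exact: perm_onM.
      by rewrite -[s](mulKg (tperm x y)) tpermV; apply: perm_onM.
    rewrite cq /=; have e u : (word_act u^-1%g w == word_act q t0) = (w == word_act u (word_act q t0)).
      by apply/eqP/eqP => [<-|->]; rewrite word_actM ?mulVg ?mulgV word_act1.
    rewrite !e -word_actM; congr (_ == word_act _ _).
    apply/ffunP => l; rewrite [LHS]ffunE tpermV.
    by case: tpermP => [->|->|//]; rewrite E.
  by rewrite odd_mul_tperm xy signr_addb -mulrA mulN1r.
move/eqP; rewrite -addr_eq0 -mulr2n -mulr_natr mulf_eq0 (negPf (charF 1)) orbF.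
by move/eqP.
Qed.

Definition sym_elt s m : CN := sact CN (hgrp F (hperm s)) m.

(** The Specht module lies in the permutation module on tabloids s t0, and the
    map sends s t0 to the sum of the g w with g t0 = s t0.  Summing over all of
    S_n, instead of coset representatives of the row stabilizer, makes it
    visibly equivariant. *)
Definition phiw_fun w (u : M) : CN :=
  \sum_s (vsval u : {ffun {ffun 'I_n.+1 -> 'I_(size lam)} -> F^o}) (word_act s t0) *:
     sym_elt s (bas w).

Lemma phiw_linear w : linear (phiw_fun w).
Proof.
move=> c u v; rewrite /phiw_fun scaler_sumr -big_split /=; apply: eq_bigr => s _.
by rewrite !ffunE scalerDl scalerA.
Qed.
HB.instance Definition _ w := GRing.isLinear.Build F M CN _ (phiw_fun w) (phiw_linear w).

Definition phiw w : 'Hom(M, CN) := linfun (phiw_fun w).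

Lemma phiwE w u : phiw w u = phiw_fun w u. Proof. exact: lfunE. Qed.

Lemma specht_gactE g (u : M) : vsval (gact M g u) = pmod_act_fun g.2 (vsval u).
Proof. exact: specht_actE. Qed.

Lemma sact_hgrpM g h gh m : gh = (g * h)%g ->
  sact CN (hgrp F g) (sact CN (hgrp F h) m) = sact CN (hgrp F gh) m.
Proof. by move=> ->; rewrite -hgrpM (sactM CN) comp_lfunE. Qed.

Lemma hypoct_split (g : hypoct n.+1) s :
  (g * hperm s)%g = (hperm (s * g.2) * hflip [ffun i => g.1 (s i)])%g.
Proof.
congr (_, _); last by rewrite /= mul1g.
by apply/ffunP => i; rewrite ffunE [RHS]ffunE /= !ffunE addbF.
Qed.

(** A signed permutation times s is a permutation times a sign change, and the
    latter fixes m. *)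
Lemma sym_elt_flip g s m : flip_inv m ->
  sact CN (hgrp F g) (sym_elt s m) = sym_elt (s * g.2)%g m.
Proof.
move=> inv; apply: etrans (sact_hgrpM m (erefl _)) _.
apply: etrans (esym (sact_hgrpM m (hypoct_split g s))) _.
by rewrite inv.
Qed.

Lemma phiw_equiv w : wdeg w = k -> phiw w \in eqHom M N.
Proof.
move=> wk; apply/eqHomP => g u; rewrite !phiwE /phiw_fun (linear_sum (sact CN _)) specht_gactE.
rewrite (reindex_inj (mulIg g.2)) /=; apply: eq_bigr => s _.
rewrite (linearZ_LR (sact CN _)) /= ffunE word_actM mulgK; congr (_ *: _).
exact/esym/sym_elt_flip/bas_flip.
Qed.

Lemma word_coef_phiw w v : wdeg w = k ->
  word_coef (phiw w gen0) v = young_coef F par trow tcol w v.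
Proof.
move=> wk; rewrite phiwE /phiw_fun word_coef_sum gen0E.
transitivity (\sum_s \sum_(q | col_stab T0 q && (word_act s t0 == word_act q t0))
  (-1) ^+ odd_perm q * (csgn F s (odds par w) * (wcomp v s == w)%:R)).
  apply: eq_bigr => s _; rewrite ffunE mulr_suml; apply: eq_bigr => q _.
  rewrite /sym_elt word_coef_hperm /wact word_coef_bas //.
  by case: eqP => [->|]; rewrite ?mulr0.
rewrite (exchange_big_dep (col_stab T0)) /=; last by move=> s q _ /andP[].
apply: eq_bigr => q cq; rewrite (reindex_inj (mulIg q)) /=; apply: eq_bigl => p.
by rewrite cq /= -word_actM (inj_eq (@word_act_inj q)) word_act_t0.
Qed.

(** Semistandard fillings of the diagram, as words read through the tableau
    T0. *)
Definition ss_words : {set W} :=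
  [set w | word_ss par trow tcol w && (wdeg w == k)].

Local Notation sub_ss := {w : W | w \in ss_words}.
Local Notation target := {ffun sub_ss -> F^o}.

Definition eval_fun (phi : 'Hom(M, CN)) : target := [ffun w => word_coef (phi gen0) (val w)].

Lemma eval_linear : linear eval_fun.
Proof.
by move=> c u v; apply/ffunP => w; rewrite !ffunE add_lfunE scale_lfunE word_coef_linear.
Qed.
HB.instance Definition _ := GRing.isLinear.Build F _ _ _ eval_fun eval_linear.

Definition comb_fun (c : target) : 'Hom(M, CN) := \sum_w c w *: phiw (val w).

Lemma comb_funE c u : comb_fun c u = \sum_w c w *: phiw (val w) u.
Proof. by rewrite /comb_fun sum_lfunE; apply: eq_bigr => w _; rewrite scale_lfunE. Qed.

Lemma comb_linear : linear comb_fun.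
Proof.
move=> k0 c d; rewrite /comb_fun scaler_sumr -big_split /=; apply: eq_bigr => w _.
by rewrite !ffunE scalerDl scalerA.
Qed.
HB.instance Definition _ := GRing.isLinear.Build F _ _ _ comb_fun comb_linear.

Lemma dim_target : \dim {: target} = #|ss_words|.
Proof. by rewrite dimvf /dim /= muln1 card_sig; apply: eq_card => w; rewrite !inE. Qed.

Lemma ss_wordP (w : sub_ss) : word_ss par trow tcol (val w) /\ wdeg (val w) = k.
Proof. by have := valP w; rewrite inE => /andP[? /eqP]. Qed.

(** The maps attached to semistandard words are independent already at the
    polytabloid gen0. *)
Lemma dim_eqHom_ge : (#|ss_words| <= \dim (eqHom M N))%N.
Proof.
rewrite -dim_target -(limg_dim_eq (f := linfun comb_fun)); last first.
  apply/eqP; rewrite -subv0; apply/subvP => c; rewrite memv_cap memv_ker memv0 lfunE /=.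
  case/andP => _ /eqP c0; apply/eqP/ffunP => w; rewrite ffunE.
  pose c' (v : W) : F := if insub v is Some v' then c v' else 0.
  have cE (v : sub_ss) : c v = c' (val v) by rewrite /c' valK.
  have [ssw wk] := ss_wordP w; rewrite cE.
  apply: (young_free charF trc_inj (par := par)) ssw => v ssv.
  transitivity (word_coef (comb_fun c gen0) v); last by rewrite c0 zero_lfunE word_coef0.
  rewrite comb_funE word_coef_sum (bigID (mem ss_words)) /= [X in _ + X]big1 ?addr0; last first.
    by move=> u /andP[_ nu]; rewrite /c' insubN ?mul0r.
  rewrite (eq_bigr (fun u => c' (val u) * young_coef F par trow tcol (val u) v)); last first.
    by move=> u _; have [_ uk] := ss_wordP u; rewrite cE word_coef_phiw.
  rewrite -(big_sub (mem ss_words) (fun u => c' u * young_coef F par trow tcol u v)).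
  by apply: eq_bigl => u; rewrite inE; case: (word_ss _ _ _ u).
apply: dimvS; apply/subvP => _ /memv_imgP[c _ ->]; rewrite lfunE /=.
apply: memv_suml => w _; apply: memvZ; apply: phiw_equiv.
by have [] := ss_wordP w.
Qed.

(** The polytabloid gen0 generates the Specht module: permutations act
    transitively on tableaux. *)
Lemma eqHom_gen0 phi : phi \in eqHom M N -> phi gen0 = 0 -> phi = 0.
Proof.
move=> /eqHomP ephi phi0; apply/lfunP => u; rewrite zero_lfunE.
pose proj := linfun (vsproj (specht F n.+1 lam)).
have : (specht F n.+1 lam <= lker (phi \o proj))%VS.
  apply/span_subvP => _ /imageP[T TT ->]; rewrite memv_ker comp_lfunE lfunE /=.
  have [s ->] : exists s, T = tab_act s T0.
    case/andP: TT => /injectiveP Ti _; have /fin_all_exists[f fP] i := T0_onto (T i).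
    have f_inj : injective f by move=> i j fij; apply: Ti; rewrite -!fP fij.
    exists (perm f_inj)^-1%g; apply/ffunP => i.
    by rewrite ffunE invgK permE fP.
  have -> : vsproj (specht F n.+1 lam) (polytabloid F (tab_act s T0)) = gact M (hperm s) gen0.
    apply/subvs_inj; rewrite specht_gactE gen0E -pmod_act_polytabloid vsprojK //.
    exact/specht_stable/poly0_specht.
  by rewrite ephi phi0 linear0.
move/subvP/(_ _ (subvsP u)); rewrite memv_ker comp_lfunE lfunE /= vsvalK.
by move/eqP.
Qed.

(** A map is determined by the coordinates at semistandard words of its value at
    gen0.  This value is fixed by sign changes and inherits the column symmetry
    and the Garnir relations of gen0. *)
Lemma dim_eqHom_le : (\dim (eqHom M N) <= #|ss_words|)%N.
Proof.
rewrite -dim_target -(limg_dim_eq (f := linfun eval_fun)); first exact/dimvS/subvf.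
apply/eqP; rewrite -subv0; apply/subvP => phi; rewrite memv_cap memv_ker memv0 lfunE /=.
case/andP => phiH /eqP phi0; apply/eqP/(eqHom_gen0 phiH).
have ephi : @is_eqhom F n.+1 M N phi by apply/eqHomP.
have phi_s s : phi (vsproj (specht F n.+1 lam) (pmod_act_fun s poly0)) =
    sym_elt s (phi gen0).
  apply: etrans (ephi (hperm s) gen0); congr (phi _).
  apply/subvs_inj; rewrite specht_gactE gen0E vsprojK //.
  exact/specht_stable/poly0_specht.
apply: word_coef_inj => [e|].
  apply: etrans (esym (ephi (hflip e) gen0)) _; congr (phi _).
  apply/subvs_inj; rewrite specht_gactE gen0E /=.
  by apply/ffunP => w; rewrite ffunE invg1 word_act1.
apply: (@upper_bound F n.+1 B par charF trow tcol trc_inj trc_shape).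
- move=> s cs w; rewrite -word_coef_hperm -/(sym_elt _ _) -phi_s gen0_col //.
  by rewrite !linearZ /= -[_ *: _]addr0 word_coef_linear word_coef0 addr0.
- move=> i j rij cij w; under eq_bigr do rewrite -word_coef_hperm.
  rewrite -big_filter -word_coef_sum big_filter.
  pose psi := (phi \o linfun (vsproj (specht F n.+1 lam)))%VF.
  rewrite (eq_bigr (fun s => psi ((-1) ^+ odd_perm s *: pmod_act_fun s poly0))) => [|s _].
    by rewrite -(linear_sum psi) gen0_garnir // (linear0 psi) word_coef0.
  by rewrite (linearZ_LR psi) /= comp_lfunE lfunE /= phi_s.
- move=> w ssw; have [wk|wk] := eqVneq (wdeg w) k.
    have wS : w \in ss_words by rewrite inE ssw wk eqxx.
    by move/ffunP/(_ (exist _ w wS)): phi0; rewrite !ffunE.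
  rewrite /word_coef; apply: (dhomog_nemf_coeff (dhomog_is_dhomog _)).
  by rewrite /= mdegE; under eq_bigr do rewrite mnmE.
Qed.

Lemma dim_eqHom : \dim (eqHom M N) = #|ss_words|.
Proof. by apply/eqP; rewrite eqn_leq dim_eqHom_le dim_eqHom_ge. Qed.

End SpechtLink.

End Link.

(** * Generating functions of fillings *)

Section Fillings.
Variables (X : finType) (rw cl : X -> nat) (B' : nat) (par : 'I_B'.+1 -> bool).
Variables (R : comNzRingType) (z : 'I_B'.+1 -> R).
Local Notation B := B'.+1.
Implicit Types (S : {set X}) (T : {ffun X -> 'I_B}) (c d : X).

Definition pre_row c d := (rw c == rw d) && (cl c < cl d)%N.
Definition pre_col c d := (cl c == cl d) && (rw c < rw d)%N.

Definition fill_ss S T := [forall c in S, forall d in S,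
  (pre_row c d ==> let_le par false (T c) (T d)) &&
  (pre_col c d ==> let_le par true (T c) (T d))].

(** Fillings of a set of cells are functions on all cells that take a default
    value elsewhere, so that the fillings of all subsets live in one finite
    type. *)
Definition fill_in S (lo hi : nat) T :=
  [forall c, if c \in S then (lo <= T c < hi)%N else T c == ord0].

Definition fill_gf S lo hi : R :=
  \sum_(T | fill_in S lo hi T && fill_ss S T) \prod_(c in S) z (T c).

Definition lower_in S S' := (S' \subset S) &&
  [forall c in S', forall d in S :\: S', ~~ (pre_row d c || pre_col d c)].

Definition fill_restr S T : {ffun X -> 'I_B} := [ffun c => if c \in S then T c else ord0].
Definition fill_glue S T1 T2 : {ffun X -> 'I_B} := [ffun c => if c \in S then T1 c else T2 c].

Lemma fill_ssP S T : reflect (forall c d, c \in S -> d \in S ->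
   (pre_row c d -> let_le par false (T c) (T d)) /\
   (pre_col c d -> let_le par true (T c) (T d))) (fill_ss S T).
Proof.
apply: (iffP forall_inP) => [H c d cS dS|H c cS].
  by have /forall_inP/(_ d dS)/andP[/implyP ? /implyP ?] := H c cS.
apply/forall_inP => d dS; have [? ?] := H c d cS dS.
by apply/andP; split; apply/implyP.
Qed.

Lemma fill_inP S lo hi T : reflect
  (forall c, if c \in S then (lo <= T c < hi)%N else T c == ord0) (fill_in S lo hi T).
Proof. exact: forallP. Qed.

Lemma lower_inP S S' : reflect (S' \subset S /\ forall c d, c \in S' -> d \in S ->
   d \notin S' -> ~~ (pre_row d c || pre_col d c)) (lower_in S S').
Proof.
apply: (iffP andP) => -[sub H]; split=> //.
  move=> c d cS dS dS'; move/forall_inP/(_ c cS)/forall_inP/(_ d): H.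
  by apply; rewrite inE dS'.
apply/forall_inP => c cS; apply/forall_inP => d; rewrite inE => /andP[dS' dS].
exact: H.
Qed.

(** The cells with letters below mid are a lower set, and a letter below mid may
    precede a letter from mid on without further condition. *)
Lemma fill_split S lo mid hi : (lo <= mid <= hi)%N ->
  fill_gf S lo hi =
  \sum_(S' | lower_in S S') fill_gf S' lo mid * fill_gf (S :\: S') mid hi.
Proof.
case/andP=> lm mh; pose low T := [set c in S | (T c < mid)%N].
rewrite {1}/fill_gf (partition_big low (lower_in S)) /=; last first.
  move=> T /andP[/fill_inP Tin /fill_ssP Tss]; apply/lower_inP; split.
    by apply/subsetP => c; rewrite inE => /andP[].
  move=> c d; rewrite !inE => /andP[cS cm] dS; rewrite dS /= -leqNgt => md.
  apply/negP => dc; have : (T d <= T c)%N.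
    by have [H1 H2] := Tss _ _ dS cS; case/orP: dc => [/H1|/H2] /let_leW.
  by rewrite leqNgt (leq_trans cm md).
apply: eq_bigr => S' /lower_inP[sub low_S'].
rewrite /fill_gf big_distrlr pair_big /=.
rewrite (reindex_onto (fun p : {ffun X -> 'I_B} * {ffun X -> 'I_B} => fill_glue S' p.1 p.2)
  (fun T => (fill_restr S' T, fill_restr (S :\: S') T))) /=; last first.
  move=> T /andP[/andP[/fill_inP Tin _] _]; apply/ffunP => c; rewrite !ffunE !inE.
  by case: (c \in S') => //=; have := Tin c; case: (c \in S) => //= /eqP ->.
apply: eq_big => [[T1 T2]|[T1 T2]] /=.
  apply/idP/idP.
    case/andP => /andP[/andP[/fill_inP Tin /fill_ssP Tss] /eqP lowE] /eqP[E1 E2].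
    have T1E c : c \in S' -> fill_glue S' T1 T2 c = T1 c by move=> cS; rewrite ffunE cS.
    have T2E c : c \notin S' -> fill_glue S' T1 T2 c = T2 c by move=> /negPf cS; rewrite ffunE cS.
    have T1m c : c \in S' -> (T1 c < mid)%N by move=> cS; move: (cS); rewrite -{1}lowE inE T1E // => /andP[].
    have T2m c : c \in S -> c \notin S' -> (mid <= T2 c)%N.
      by move=> cS cS'; move: (cS'); rewrite -{1}lowE inE cS T2E //= -leqNgt.
    apply/andP; split; apply/andP; split.
    - apply/fill_inP => c; case: ifP => cS.
        by have := Tin c; rewrite (subsetP sub) // T1E // T1m // => /andP[->].
      by rewrite -E1 ffunE cS.
    - apply/fill_ssP => c d cS dS; rewrite -!T1E //.
      by apply: Tss; apply: (subsetP sub).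
    - apply/fill_inP => c; rewrite inE; case: (boolP (c \in S')) => cS' /=.
        by rewrite -E2 ffunE inE cS'.
      case: ifP => cS; last by rewrite -E2 ffunE inE cS andbF.
      by have := Tin c; rewrite cS T2E // T2m // => /andP[_ ->].
    - apply/fill_ssP => c d; rewrite !inE => /andP[cS' cS] /andP[dS' dS].
      by rewrite -!T2E //; apply: Tss.
  case/andP => /andP[/fill_inP in1 /fill_ssP ss1] /andP[/fill_inP in2 /fill_ssP ss2].
  have T1m c : c \in S' -> (lo <= T1 c < mid)%N by move=> cS; have := in1 c; rewrite cS.
  have T2m c : c \in S -> c \notin S' -> (mid <= T2 c < hi)%N.
    by move=> cS cS'; have := in2 c; rewrite inE cS' cS.
  apply/andP; split; last first.
    apply/eqP; congr (_, _); apply/ffunP => c; rewrite !ffunE.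
      by have := in1 c; case: (c \in S') => // /eqP.
    by have := in2 c; rewrite inE; case: (c \in S'); case: (c \in S) => //= /eqP.
  apply/andP; split; last first.
    apply/eqP/setP => c; rewrite !inE ffunE; have := T1m c; have := T2m c.
    case: (boolP (c \in S')) => cS'; first by move=> _ /(_ isT)/andP[_ ->]; rewrite (subsetP sub).
    case: (c \in S) => //= /(_ isT isT)/andP[+ _] _.
    by rewrite leqNgt => /negPf.
  apply/andP; split.
    apply/fill_inP => c; rewrite ffunE; case: (boolP (c \in S')) => cS'.
      rewrite (subsetP sub) //; have /andP[-> H] := T1m c cS'; exact: leq_trans H mh.
    case: ifP => cS; first by have /andP[H ->] := T2m c cS cS'; rewrite (leq_trans lm).
    by have := in2 c; rewrite inE cS andbF.
  apply/fill_ssP => c d cS dS; rewrite !ffunE.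
  case: (boolP (c \in S')) => cS'; case: (boolP (d \in S')) => dS'.
  - exact: ss1.
  - have /andP[_ H1] := T1m c cS'; have /andP[H2 _] := T2m d dS dS'.
    by split=> _; rewrite /let_le (leq_trans H1 H2).
  - by have := low_S' d c dS' cS cS'; rewrite negb_or => /andP[/negP ? /negP ?].
  - by apply: ss2; rewrite inE ?cS' ?dS'.
move=> _; rewrite [LHS](bigID (mem S')) /=; congr (_ * _).
  apply: eq_big => [c|c /andP[_ cS]]; last by rewrite ffunE cS.
  by rewrite andbC; case: (boolP (c \in S')) => // /(subsetP sub) ->.
apply: eq_big => [c|c /andP[_ /negPf cS]]; last by rewrite ffunE cS.
by rewrite inE andbC.
Qed.

Definition strip_set (b : bool) S := [forall c in S, forall d in S,
  (pre_row c d ==> ~~ b) && (pre_col c d ==> b)].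

Lemma fill_single S (x : 'I_B) : fill_gf S x x.+1 = (strip_set (par x) S)%:R * z x ^+ #|S|.
Proof.
rewrite /fill_gf; pose T0 : {ffun X -> 'I_B} := [ffun c => if c \in S then x else ord0].
have Tin T : fill_in S x x.+1 T = (T == T0).
  apply/fill_inP/eqP => [H|->].
    apply/ffunP => c; rewrite ffunE; have := H c; case: (c \in S) => [|/eqP //].
    by rewrite ltnS => Hc; apply/val_inj/eqP; rewrite eqn_leq andbC.
  by move=> c; rewrite ffunE; case: (c \in S); rewrite ?leqnn.
have E : fill_ss S T0 = strip_set (par x) S.
  apply: eq_forallb => c; case: (boolP (c \in S)) => cS //=.
  apply: eq_forallb => d; case: (boolP (d \in S)) => dS //=.
  by rewrite !ffunE cS dS /let_le ltnn eqxx /= eqb_id eqbF_neg.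
rewrite (eq_bigl (fun T => (T == T0) && strip_set (par x) S)) => [|T]; last first.
  by rewrite Tin; have [->|//] := eqVneq T T0; rewrite E.
case: (strip_set _ _); last by rewrite mul0r big_pred0 // => T; rewrite andbF.
under eq_bigl do rewrite andbT.
rewrite big_pred1_eq mul1r -prodr_const; apply: eq_bigr => c cS.
by rewrite ffunE cS.
Qed.

Lemma fill_empty S lo : fill_gf S lo lo = (S == set0)%:R.
Proof.
have [->|[c cS]] := set_0Vmem S.
  rewrite eqxx /fill_gf (big_pred1 [ffun=> ord0]) => [|T]; first by rewrite big_set0.
  apply/andP/eqP => [[/fill_inP H _]|->].
    by apply/ffunP => c; have := H c; rewrite inE ffunE => /eqP.
  split; first by apply/fill_inP => c; rewrite inE ffunE.
  by apply/fill_ssP => c d; rewrite inE.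
rewrite (_ : (S == set0) = false); last by apply/eqP => S0; rewrite S0 inE in cS.
rewrite /fill_gf big_pred0 // => T; apply/negP => /andP[/fill_inP/(_ c)].
by rewrite cS; case: ltnP.
Qed.

(** Fillings of an abstract shape Y with N + 1 letters correspond to fillings of
    a set S of cells by the letters from lo on.  This is used for a straight
    shape, embedded as it is, and for a skew shape, embedded by
    transposition. *)
Lemma fill_transfer (Y : finType) (f : Y -> X) S lo N (ssY : {ffun Y -> 'I_N.+1} -> bool)
    (zz : 'I_N.+1 -> R) :
  injective f -> S = f @: setT -> (lo + N.+1 <= B)%N ->
  (forall (T : {ffun Y -> 'I_N.+1}) (G : {ffun X -> 'I_B}),
     (forall y, G (f y) = (lo + T y)%N :> nat) -> fill_ss S G = ssY T) ->
  (forall (t : 'I_N.+1) (x : 'I_B), x = (lo + t)%N :> nat -> zz t = z x) ->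
  \sum_(T | ssY T) \prod_y zz (T y) = fill_gf S lo (lo + N.+1).
Proof.
move=> f_inj SE loB ssE zE; rewrite /fill_gf.
pose emb (T : {ffun Y -> 'I_N.+1}) : {ffun X -> 'I_B} :=
  [ffun c => if [pick y | f y == c] is Some y then inord (lo + T y) else ord0].
pose inv (G : {ffun X -> 'I_B}) : {ffun Y -> 'I_N.+1} := [ffun y => inord (G (f y) - lo)].
have fS y : f y \in S by rewrite SE imset_f.
have embE (T : {ffun Y -> 'I_N.+1}) y : emb T (f y) = (lo + T y)%N :> nat.
  rewrite ffunE; case: pickP => [y' /eqP/f_inj ->|/(_ y)]; last by rewrite eqxx.
  by rewrite inordK // (leq_trans _ loB) // ltn_add2l.
have embN (T : {ffun Y -> 'I_N.+1}) c : c \notin S -> emb T c = ord0.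
  move=> cS; rewrite ffunE; case: pickP => // y /eqP E.
  by rewrite -E fS in cS.
have embK (T : {ffun Y -> 'I_N.+1}) : inv (emb T) = T.
  by apply/ffunP => y; rewrite ffunE embE addKn inord_val.
rewrite [RHS](reindex_onto emb inv) => [|G /andP[/fill_inP Gin _]]; last first.
  apply/ffunP => c; have := Gin c; case: (boolP (c \in S)) => cS; last first.
    by move=> /eqP ->; rewrite embN.
  case/andP => lc hc; apply/val_inj; move: (cS); rewrite SE => /imsetP[y _ Ey].
  rewrite Ey /= embE ffunE inordK -Ey ?subnKC //.
  by rewrite ltn_subLR.
apply: eq_big => [T|T _].
  rewrite embK eqxx andbT (ssE T) //; case: (ssY T); rewrite ?andbF ?andbT //.
  apply/esym/fill_inP => c; case: (boolP (c \in S)) => cS; last by rewrite embN.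
  move: (cS); rewrite SE => /imsetP[y _ ->]; rewrite embE leq_addr /= ltn_add2l.
  exact: ltn_ord.
rewrite SE big_imset /=; last by move=> ? ? _ _; apply: f_inj.
by apply: eq_big => [y|y _]; [rewrite inE|apply/zE/embE].
Qed.

End Fillings.

Lemma mk_skew (s m : seq nat) i j : (j < nth 0 s i)%N -> (nth 0 m i <= j)%N ->
  exists2 c : skew s m, row (val c) = i :> nat & col (val c) = j.
Proof.
move=> ji mj; have [c rc cc] := mk_cell ji.
have cP : (nth 0 m (row c) <= col c)%N by rewrite rc cc.
by exists (exist _ c cP).
Qed.

Section Shapes.
Variable lam : seq nat.
Hypothesis lam_sorted : sorted geq lam.
Local Notation X := (cell lam).
Local Notation l := (size lam).
Local Notation M := (sumn lam).+1.
Local Notation rw := (fun c : X => row c : nat).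
Local Notation cl := (fun c : X => col c).
Implicit Types (S : {set X}) (mu nu : l.-tuple 'I_M).

Definition part_row mu i : nat := nth 0 (map val mu) i.

Lemma part_rowE mu (i : 'I_l) : part_row mu i = tnth mu i.
Proof.
rewrite /part_row (nth_map ord0) ?size_tuple // (tnth_nth ord0) //.
Qed.

Lemma part_row_default mu i : (l <= i)%N -> part_row mu i = 0%N.
Proof. by move=> li; rewrite /part_row nth_default // size_map size_tuple. Qed.

Definition cells_of mu : {set X} := [set c | (col c < part_row mu (row c))%N].

Definition is_sub mu := is_subpart lam (map val mu).

Lemma part_row_le mu i j : is_sub mu -> (i <= j)%N -> (part_row mu j <= part_row mu i)%N.
Proof. by case/andP => ss _; apply: sorted_nth. Qed.

Lemma part_row_lam mu i : is_sub mu -> (part_row mu i <= nth 0 lam i)%N.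
Proof.
case/andP => _ /forallP H; have [il|il] := ltnP i l; last by rewrite part_row_default.
exact: (H (Ordinal il)).
Qed.

Lemma col_lt (c : X) : (col c < nth 0 lam (row c))%N.
Proof. exact: ltn_ord. Qed.

Lemma nth_sumn (s : seq nat) i : (nth 0 s i <= sumn s)%N.
Proof.
elim: s i => [|x s IH] [|i] //=; first exact: leq_addr.
exact: leq_trans (IH i) (leq_addl _ _).
Qed.

Definition row_card S i := #|[set c in S | row c == i :> nat]|.

Lemma card_row_lt S i m : (m <= nth 0 lam i)%N ->
  (forall c, row c = i :> nat -> (c \in S) = (col c < m)%N) -> row_card S i = m.
Proof.
move=> mi H; have [il|il] := ltnP i l; last first.
  move: mi; rewrite nth_default // leqn0 => /eqP ->; apply: eq_card0 => c.
  rewrite !inE; apply/andP => -[_ /eqP E].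
  by move: il; rewrite -E leqNgt ltn_ord.
have f_ex (j : 'I_m) : exists c : X, row c = i :> nat /\ col c = j.
  by have [c r k] := mk_cell (leq_trans (ltn_ord j) mi); exists c.
have [f fP] := fin_all_exists f_ex.
have f_inj : injective f.
  by move=> j k E; apply/val_inj; rewrite /= -(fP j).2 -(fP k).2 E.
rewrite -[RHS]card_ord -cardsT -(card_imset _ f_inj); apply: eq_card => c.
rewrite !inE; apply/andP/imsetP => [[cS /eqP rc]|[j _ ->]].
  move: cS; rewrite (H _ rc) => cm; exists (Ordinal cm); rewrite ?inE //.
  by apply: cell_inj; rewrite ?(fP _).1 ?(fP _).2.
have [rj cj] := fP j; rewrite H // cj ltn_ord; split=> //; exact/eqP.
Qed.

Lemma cells_row_card mu i : is_sub mu -> row_card (cells_of mu) i = part_row mu i.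
Proof.
move=> smu; apply: card_row_lt => [|c rc]; first exact: part_row_lam.
by rewrite inE rc.
Qed.

(** A lower set meets each row in an initial segment, and the lengths of these
    segments decrease down the rows. *)
Lemma lower_cells S : lower_in rw cl setT S ->
  exists2 mu, is_sub mu & cells_of mu = S.
Proof.
move=> /lower_inP[_ low].
have lowr c d : c \in S -> row d = row c :> nat -> (col d <= col c)%N -> d \in S.
  move=> cS rd; rewrite leq_eqVlt => /predU1P[cd|cd]; first by rewrite (cell_inj rd cd).
  apply: contraT => dS; have := low c d cS (in_setT _) dS.
  by rewrite /pre_row rd eqxx cd.
have lowc c d : c \in S -> col d = col c -> (row d <= row c)%N -> d \in S.
  move=> cS cd; rewrite leq_eqVlt => /predU1P[rd|rd]; first by rewrite (cell_inj rd cd).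
  apply: contraT => dS; have := low c d cS (in_setT _) dS.
  by rewrite /pre_col cd eqxx rd orbT.
have rcl i : (row_card S i <= nth 0 lam i)%N.
  rewrite -(@card_row_lt setT i (nth 0 lam i)) // => [|c <-]; last by rewrite inE col_lt.
  by apply/subset_leq_card/subsetP => c; rewrite !inE => /andP[_ ->].
have inS c : (c \in S) = (col c < row_card S (row c))%N.
  apply/idP/idP => [cS|].
    rewrite -(@card_row_lt [set d : X | (row d == row c) && (col d <= col c)%N] (row c) (col c).+1).
    - apply/subset_leq_card/subsetP => d; rewrite !inE => /andP[/andP[/eqP rd cd] ->].
      by rewrite andbT; apply: lowr cS _ cd; rewrite rd.
    - exact: col_lt.
    - by move=> d /val_inj rd; rewrite inE rd eqxx ltnS.
  apply: contraTT => cS; rewrite -leqNgt.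
  rewrite -(@card_row_lt [set d : X | (row d == row c) && (col d < col c)%N] (row c) (col c)).
  - apply/subset_leq_card/subsetP => d; rewrite !inE => /andP[dS /eqP rd].
    rewrite rd (val_inj rd) !eqxx andbT ltnNge /=; apply: contra cS => cd.
    by apply: lowr dS _ cd; rewrite rd.
  - exact/ltnW/col_lt.
  - by move=> d /val_inj rd; rewrite inE rd eqxx.
pose mu : l.-tuple 'I_M := [tuple inord (row_card S i) | i < l].
have muE i : part_row mu i = row_card S i.
  have [il|il] := ltnP i l; last first.
    apply/esym/eqP; rewrite part_row_default // -leqn0.
    by apply: leq_trans (rcl i) _; rewrite nth_default.
  rewrite (part_rowE mu (Ordinal il)) tnth_mktuple inordK // ltnS.
  exact: leq_trans (rcl i) (nth_sumn _ _).
exists mu; last by apply/setP => c; rewrite inE muE inS.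
apply/andP; split; last by apply/forallP => i; rewrite -/(part_row mu i) muE rcl.
apply/(sortedP 0%N) => i _; rewrite -!/(part_row mu _) !muE /geq /= leqNgt.
set m := row_card S i; apply/negP => mi.
have [c rc cc] := mk_cell (leq_trans mi (rcl i.+1)).
have cS : c \in S by rewrite inS rc cc.
have [d rd cd] : exists2 d : X, row d = i :> nat & col d = m.
  by apply: mk_cell; apply: leq_trans (sorted_nth lam_sorted (leqnSn i)); rewrite -rc -cc col_lt.
have : d \in S by apply: lowc cS _ _; rewrite ?cd ?cc // rd rc.
by rewrite inS rd cd ltnn.
Qed.

Lemma cells_ofP mu c : (c \in cells_of mu) = (col c < part_row mu (row c))%N.
Proof. by rewrite inE. Qed.

Lemma cells_lower mu : is_sub mu -> lower_in rw cl setT (cells_of mu).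
Proof.
move=> smu; apply/lower_inP; split; first exact: subsetT.
move=> c d; rewrite !cells_ofP -leqNgt => cm _ dm; apply/negP => /orP[] /andP[/eqP E lt].
  by move: (leq_ltn_trans dm lt); rewrite E ltnNge (ltnW cm).
have := leq_trans cm (part_row_le smu (ltnW lt)).
by rewrite -E ltnNge dm.
Qed.

Lemma cells_of_inj mu nu : is_sub mu -> is_sub nu -> cells_of mu = cells_of nu -> mu = nu.
Proof.
move=> smu snu E; apply: eq_from_tnth => i; apply/val_inj; rewrite /= -!part_rowE.
by rewrite -!cells_row_card // E.
Qed.

Lemma cells_of_sub mu nu : is_sub mu -> is_sub nu ->
  (cells_of mu \subset cells_of nu) = [forall i : 'I_l, (part_row mu i <= part_row nu i)%N].
Proof.
move=> smu snu; apply/idP/forallP => [sub i|H].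
  rewrite -!cells_row_card //; apply/subset_leq_card/subsetP => c.
  by rewrite in_set => /andP[cS ri]; rewrite in_set ri andbT; apply: (subsetP sub).
apply/subsetP => c; rewrite !cells_ofP => cm; exact: leq_trans cm (H (row c)).
Qed.

(** The subdiagrams are indexed by partitions contained in lam, padded with
    zeros. *)
Lemma big_lower (R : comNzRingType) (P : pred {set X}) (F : {set X} -> R) :
  \sum_(S | lower_in rw cl setT S && P S) F S =
  \sum_(mu | is_sub mu && P (cells_of mu)) F (cells_of mu).
Proof.
pose inv S : l.-tuple 'I_M :=
  odflt [tuple ord0 | _ < l] [pick mu | is_sub mu && (cells_of mu == S)].
rewrite (reindex_onto cells_of inv) /=; last first.
  move=> S /andP[/lower_cells[mu smu <-] _]; rewrite /inv; case: pickP => [nu /andP[_ /eqP]//|].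
  by move/(_ mu); rewrite smu eqxx.
apply: eq_bigl => mu; apply/idP/idP.
  case/andP => /andP[/lower_cells[nu snu E] ->] /eqP; rewrite /inv; case: pickP.
    by move=> nu' /andP[snu' _] /= <-; rewrite snu'.
  by move/(_ nu); rewrite snu E eqxx.
case/andP=> smu Pmu; rewrite Pmu cells_lower //= /inv; case: pickP => [nu|/(_ mu)].
  by case/andP => snu /eqP/(cells_of_inj snu smu) ->.
by rewrite smu eqxx.
Qed.

Lemma conj_lt (s : seq nat) i j : sorted geq s ->
  (j < nth 0 (conj_part s) i)%N = (i < nth 0 s j)%N.
Proof.
move=> ss; have cnt : forall s j, sorted geq s ->
    (j < count (fun r => i < r)%N s)%N = (i < nth 0 s j)%N.
  elim=> [|x s' IH] j' /= xs; first by rewrite nth_nil.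
  have s's := path_sorted xs.
  have [ix|xi] := ltnP i x; first by case: j' => [|j'] /=; rewrite ?add1n ?ltnS ?IH ?ix.
  have le_x k : (nth 0 (x :: s') k <= x)%N by apply: (@sorted_nth (x :: s') 0).
  rewrite ltnNge [RHS]ltnNge (leq_trans (le_x j') xi) add0n; apply/negbTE; rewrite negbK.
  have := IH 0%N s's; rewrite [X in _ = X]ltnNge (leq_trans (le_x 1%N) xi) /=.
  by rewrite lt0n => /negbFE/eqP ->.
have [ih|hi] := ltnP i (head 0 s); first by rewrite nth_mkseq // cnt.
rewrite nth_default ?size_mkseq // ltn0; apply/esym/negbTE; rewrite -leqNgt.
by apply: leq_trans hi; rewrite -nth0; apply: sorted_nth.
Qed.

Section SuperSchur.
Variables (R : comNzRingType) (N : nat).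
Local Notation B' := (N + N.+1)%N.
Variables (x y : 'I_N.+1 -> R) (z : 'I_B'.+1 -> R).
Definition late (s : 'I_B'.+1) := (N.+1 <= s)%N.
Hypothesis zx : forall (t : 'I_N.+1) (s : 'I_B'.+1), s = t :> nat -> x t = z s.
Hypothesis zy : forall (t : 'I_N.+1) (s : 'I_B'.+1), s = (N.+1 + t)%N :> nat -> y t = z s.

Lemma fill_ss_image (Y : finType) (f : Y -> X) S (G : {ffun X -> 'I_B'.+1}) :
  S = f @: setT ->
  fill_ss rw cl late S G = [forall a, forall b,
    (pre_row rw cl (f a) (f b) ==> let_le late false (G (f a)) (G (f b))) &&
    (pre_col rw cl (f a) (f b) ==> let_le late true (G (f a)) (G (f b)))].
Proof.
move=> ->; apply/fill_ssP/'forall_forallP => [H a b|H c d].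
  by have [? ?] := H (f a) (f b) (imset_f _ (in_setT _)) (imset_f _ (in_setT _));
    apply/andP; split; apply/implyP.
case/imsetP => a _ -> /imsetP[b _ ->].
by have /andP[/implyP ? /implyP ?] := H a b.
Qed.

(** Two cells of a row that lie in the same column coincide. *)
Lemma skew_row_weak (s m : seq nat) K (T : {ffun skew s m -> 'I_K}) a b :
  ((row (val a) == row (val b) :> nat) && (col (val a) < col (val b))%N ==> (T a <= T b)%N) =
  ((row (val a) == row (val b) :> nat) && (col (val a) <= col (val b))%N ==> (T a <= T b)%N).
Proof.
have [->|ne] := eqVneq a b; first by rewrite !leqnn !implybT.
congr (_ ==> _); case: eqP => //= r; rewrite [in RHS]leq_eqVlt; case: eqP => // c.
by case/eqP: ne; apply/val_inj/cell_inj.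
Qed.

Lemma schur_fill mu : is_sub mu ->
  schur (map val mu) x = fill_gf rw cl late z (cells_of mu) 0 N.+1.
Proof.
move=> smu; pose Y := skew (map val mu) [::].
have f_ex (c : Y) : exists d : X, row d = row (val c) :> nat /\ col d = col (val c).
  have [|d rd cd] := @mk_cell lam (row (val c)) (col (val c)); last by exists d.
  by apply: leq_trans (part_row_lam _ smu); apply: ltn_ord.
have [f fP] := fin_all_exists f_ex.
have f_inj : injective f.
  move=> a b E; have [ra ca] := fP a; have [rb cb] := fP b.
  by apply/val_inj/cell_inj; rewrite -?ra -?rb -?ca -?cb E.
have fS : cells_of mu = f @: setT.
  apply/setP => c; apply/idP/imsetP => [|[a _ ->]]; rewrite inE; last first.
    by have [-> ->] := fP a; apply: ltn_ord.
  move=> cm; have [|a ra ca] := @mk_skew _ [::] _ _ cm; first by rewrite nth_nil.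
  by exists a => //; apply: cell_inj; rewrite ?(fP a).1 ?(fP a).2.
apply: (@fill_transfer _ _ _ _ _ _ _ Y f) => //; last first.
- move=> T G GE; rewrite (fill_ss_image _ fS).
  apply: eq_forallb => a; apply: eq_forallb => b.
  have [ra ca] := fP a; have [rb cb] := fP b.
  have Glt c : late (G (f c)) = false by rewrite /late GE add0n leqNgt ltn_ord.
  rewrite /pre_row /pre_col ra ca rb cb /let_le Glt -!val_eqE /= !GE !add0n andbT andbF orbF.
  by rewrite orbC -leq_eqVlt skew_row_weak.
- by rewrite add0n ltnS leq_addr.
Qed.

Lemma skew_fill mu : is_sub mu ->
  skew_schur (conj_part lam) (conj_part (map val mu)) y =
  fill_gf rw cl late z (setT :\: cells_of mu) N.+1 (N.+1 + N.+1).
Proof.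
move=> smu; pose Y := skew (conj_part lam) (conj_part (map val mu)).
have smu' : sorted geq (map val mu) by case/andP: smu.
have f_ex (c : Y) : exists d : X, row d = col (val c) :> nat /\ col d = row (val c).
  have [|d rd cd] := @mk_cell lam (col (val c)) (row (val c)); last by exists d.
  by rewrite -conj_lt //; apply: ltn_ord.
have [f fP] := fin_all_exists f_ex.
have f_inj : injective f.
  move=> a b E; have [ra ca] := fP a; have [rb cb] := fP b.
  by apply/val_inj/cell_inj; rewrite -?ra -?rb -?ca -?cb E.
have fS : setT :\: cells_of mu = f @: setT.
  apply/setP => c; apply/idP/imsetP => [|[a _ ->]]; rewrite !inE andbT -leqNgt; last first.
    have [-> ->] := fP a; rewrite leqNgt /part_row -conj_lt // -leqNgt.
    exact: (valP a).
  move=> cm; have [||a ra ca] := @mk_skew (conj_part lam) (conj_part (map val mu)) (col c) (row c).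
  - by rewrite conj_lt // col_lt.
  - by rewrite leqNgt conj_lt // -leqNgt.
  by exists a => //; apply: cell_inj; rewrite ?(fP a).1 ?(fP a).2.
apply: (@fill_transfer _ _ _ _ _ _ _ Y f) => //; last first.
- move=> T G GE; rewrite (fill_ss_image _ fS).
  apply: eq_forallb => a; apply: eq_forallb => b.
  have [ra ca] := fP a; have [rb cb] := fP b.
  have Glt c : late (G (f c)) by rewrite /late GE leq_addr.
  rewrite /pre_row /pre_col ra ca rb cb /let_le !Glt -!val_eqE /= !GE andbT andbF orbF.
  by rewrite !ltn_add2l eqn_add2l orbC -leq_eqVlt andbC skew_row_weak.
Qed.

(** The even letters come first, so by splitting between the two kinds they fill
    a subdiagram mu; the sum over mu is the definition of the super Schur
    function. *)
Lemma super_schur_fill :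
  super_schur lam x y = fill_gf rw cl late z setT 0 (N.+1 + N.+1).
Proof.
rewrite (@fill_split _ _ _ _ _ _ _ _ 0 N.+1) ?leq_addr //.
rewrite (eq_bigl (fun S => lower_in rw cl setT S && predT S)) => [|S]; last by rewrite andbT.
rewrite big_lower; apply: eq_big => [mu|mu smu]; first by rewrite andbT.
by rewrite schur_fill // skew_fill.
Qed.

End SuperSchur.

End Shapes.

(** * Jacobi-Trudi determinants when a variable is added *)

Section JacobiTrudi.
Variables (R : comNzRingType) (l : nat).
Implicit Types (h : nat -> R) (a b : 'I_l -> nat) (z : R).

(** Multilinearity of the determinant in the rows. *)
Lemma det_expand (K : finType) (c : 'I_l -> K -> R) (v : 'I_l -> K -> 'I_l -> R) :
  \det (\matrix_(i, j) \sum_k c i k * v i k j) =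
  \sum_(f : {ffun 'I_l -> K}) (\prod_i c i (f i)) * \det (\matrix_(i, j) v i (f i) j).
Proof.
under [RHS]eq_bigr do rewrite [\det _]/determinant mulr_sumr.
rewrite exchange_big; apply: eq_bigr => s _ /=.
under eq_bigr do rewrite mxE.
rewrite bigA_distr_bigA /= mulr_sumr; apply: eq_bigr => f _.
rewrite big_split /= mulrCA; congr (_ * (_ * _)).
by apply: eq_bigr => i _; rewrite mxE.
Qed.

(** The index is shifted by l - 1, which keeps the entries h_(lam_i - i + j) of
    a Jacobi-Trudi matrix in terms of natural numbers: row i of lam enters
    through a_i = lam_i + (l - 1 - i), and column j adds j. *)
Definition shifted h (m : nat) : R := if (m < l.-1)%N then 0 else h (m - l.-1)%N.

Definition jt h a : R := \det (\matrix_(i, j < l) shifted h (a i + j)).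

Section Even.
Variables (z : R) (h h' : nat -> R).
Hypothesis h0 : h' 0%N = h 0%N.
Hypothesis hS : forall n, h' n.+1 = h n.+1 + z * h' n.

Lemma shifted_evenS m : shifted h' m.+1 = shifted h m.+1 + z * shifted h' m.
Proof.
rewrite /shifted; case: (ltngtP m.+1 l.-1) => [lt|lt|E].
- by rewrite mulr0 addr0.
- by rewrite subSn.
- by rewrite -E subnn h0 mulr0 addr0.
Qed.

Lemma shifted_even0 (j : 'I_l) : shifted h' j = shifted h j.
Proof.
rewrite /shifted; case: ltnP => // lj.
by have -> : (j - l.-1 = 0)%N by have := ltn_ord j; lia.
Qed.

(** The recursion for h' is unrolled from a down to a'. *)
Lemma shifted_even_diff (M a a' j : nat) : (a' <= a)%N -> (a < M)%N ->
  shifted h' (a + j) = \sum_(b < M | (a' < b <= a)%N) z ^+ (a - b) * shifted h (b + j)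
    + z ^+ (a - a') * shifted h' (a' + j).
Proof.
move=> le_a'a aM; elim: a le_a'a aM => [|a IH] le_a'a aM.
  move: le_a'a; rewrite leqn0 => /eqP ->; rewrite big_pred0 => [|b].
    by rewrite add0r mul1r.
  by lia.
move: le_a'a; rewrite leq_eqVlt => /predU1P[<-|le_a'a].
  rewrite big_pred0 => [|b]; first by rewrite subnn add0r mul1r.
  by lia.
rewrite addSn shifted_evenS IH //; last exact: ltnW.
rewrite [in RHS](bigD1 (Ordinal aM)) /=; last by rewrite le_a'a leqnn.
rewrite subnn mul1r addSn -addrA; congr (_ + _).
rewrite mulrDr mulrA -exprS subSn //; congr (_ + _).
rewrite mulr_sumr; apply: eq_big => [b|b /andP[_ ba]].
  by rewrite -val_eqE /=; lia.
by rewrite mulrA -exprS subSn.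
Qed.

Lemma shifted_even_last (M a : nat) (j : 'I_l) : (a < M)%N ->
  shifted h' (a + j) = \sum_(b < M | (b <= a)%N) z ^+ (a - b) * shifted h (b + j).
Proof.
move=> aM; rewrite (@shifted_even_diff M a 0) // add0n subn0 shifted_even0.
have M0 : (0 < M)%N by apply: leq_ltn_trans aM.
rewrite [RHS](bigD1 (Ordinal M0)) //= subn0 addrC add0n; congr (_ + _).
by apply: eq_bigl => b; rewrite -val_eqE /= lt0n andbC.
Qed.

(** The relation a_(i+1) < b_i <= a_i of the beta numbers of partitions that
    differ by a horizontal strip. *)
Definition interlace a b := [forall i : 'I_l, (b i <= a i)%N &&
  [forall k : 'I_l, (k == i.+1 :> nat) ==> (a k < b i)%N]].

(** Multiplying the generating series by 1 / (1 - z X).  Subtract from each row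
    z^(a_i - a_(i+1)) times the next: the difference is the combination of the
    rows for h with indices between a_(i+1) and a_i, and expanding by
    multilinearity gives the interlacing sequences. *)
Lemma jt_even M a : (forall i k : 'I_l, (i < k)%N -> (a k < a i)%N) -> (forall i, (a i < M)%N) ->
  jt h' a = \sum_(b : {ffun 'I_l -> 'I_M} | interlace a (fun i => b i))
     z ^+ (\sum_i (a i - b i))%N * jt h (fun i => b i).
Proof.
move=> a_dec aM; rewrite /jt.
pose A' := \matrix_(i, j < l) shifted h' (a i + j).
(* U subtracts from each row a multiple of the next one. *)
pose U := \matrix_(i, k < l) ((i == k)%:R - (k == i.+1 :> nat)%:R * z ^+ (a i - a k)).
have detU : \det U = 1.
  rewrite -det_tr det_trig.
    by apply: big1 => i _; rewrite !mxE eqxx (ltn_eqF (ltnSn _)) mul0r subr0.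
  apply/is_trig_mxP => i j ij; rewrite !mxE -val_eqE /= (gtn_eqF ij).
  by rewrite (ltn_eqF (leqW ij)) mul0r subr0.
pose c (i : 'I_l) (b : 'I_M) : R :=
  ((b <= a i)%N && [forall k : 'I_l, (k == i.+1 :> nat) ==> (a k < b)%N])%:R * z ^+ (a i - b).
transitivity (\det (U *m A')); first by rewrite det_mulmx detU mul1r.
have -> : U *m A' = \matrix_(i, j) \sum_b c i b * shifted h (b + j).
  apply/matrixP => i j; rewrite !mxE.
  under eq_bigr do rewrite !mxE mulrBl.
  rewrite sumrB (bigD1 i) //= eqxx mul1r big1 ?addr0 => [|k /negPf ki]; last first.
    by rewrite eq_sym ki mul0r.
  have cE : \sum_b c i b * shifted h (b + j) = \sum_(b < M | (b <= a i)%N &&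
     [forall k : 'I_l, (k == i.+1 :> nat) ==> (a k < b)%N]) z ^+ (a i - b) * shifted h (b + j).
    rewrite [RHS]big_mkcond; apply: eq_bigr => b _; rewrite /c.
    by case: ifP => _; rewrite ?mul1r // !mul0r.
  rewrite cE; have [il|il] := ltnP i.+1 l; last first.
    rewrite [X in _ - X]big1 => [|k _]; last first.
      by rewrite (ltn_eqF (leq_trans (ltn_ord k) il)) !mul0r.
    rewrite subr0 (shifted_even_last _ (aM i)); apply: eq_bigl => b.
    rewrite (_ : [forall _, _] = true) ?andbT //; apply/forallP => k.
    by rewrite (ltn_eqF (leq_trans (ltn_ord k) il)).
  rewrite (bigD1 (Ordinal il)) //= eqxx mul1r [X in _ - (_ + X)]big1 => [|k ki]; last first.
    by rewrite -val_eqE /= in ki; rewrite (negPf ki) !mul0r.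
  have lt : (a (Ordinal il) < a i)%N by apply: a_dec => /=.
  rewrite addr0 (shifted_even_diff _ (ltnW lt) (aM i)) addrK; apply: eq_bigl => b.
  rewrite andbC; congr (_ && _); apply/idP/forallP => [ab k|/(_ (Ordinal il))].
    by apply/implyP => /eqP ki; rewrite (_ : k = Ordinal il) //; apply: val_inj.
  by rewrite eqxx.
rewrite det_expand [RHS]big_mkcond; apply: eq_bigr => f _; rewrite /c big_split /= -expr_sum.
case: ifP => [/forallP H|H].
  by rewrite big1 ?mul1r // => i _; have := H i => ->.
have /existsP[i /negPf ni] : [exists i, ~~ ((f i <= a i)%N &&
    [forall k : 'I_l, (k == i.+1 :> nat) ==> (a k < f i)%N])].
  by rewrite -negb_forall; apply/negbT.
by rewrite (bigD1 i) //= ni !mul0r.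
Qed.

End Even.

Section Odd.
Variables (z : R) (h h' : nat -> R).
Hypothesis h0 : h' 0%N = h 0%N.
Hypothesis hS : forall n, h' n.+1 = h n.+1 + z * h n.

Lemma shifted_odd (a : nat) (j : 'I_l) :
  shifted h' (a + j) = shifted h (a + j) + (0 < a)%N%:R * z * shifted h (a.-1 + j).
Proof.
case: a => [|a]; rewrite /shifted.
  rewrite !mul0r addr0 add0n; case: ltnP => // lj.
  by have -> : (j - l.-1 = 0)%N by have := ltn_ord j; lia.
rewrite mul1r addSn /=; case: (ltngtP (a + j).+1 l.-1) => [lt|lt|E].
- by rewrite mulr0 addr0.
- by rewrite subSn.
- by rewrite -E subnn h0 mulr0 addr0.
Qed.

Lemma jt_eq0 a i k : i != k -> a i = a k -> jt h a = 0.
Proof.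
move=> ik E; apply/eqP; rewrite /jt (determinant_alternate ik) // => j.
by rewrite !mxE E.
Qed.

(** Multiplying the generating series by 1 + z X: each row is the sum of two
    rows for h.  The condition a_i > 0 is needed because of truncated
    subtraction; a row with a_i = 0 has no second summand, as its entries for a
    column j < l only involve h_0 and zeros. *)
Lemma jt_odd a : jt h' a = \sum_(e : {ffun 'I_l -> bool})
  (\prod_i (if e i then (0 < a i)%N%:R * z else 1)) * jt h (fun i => a i - e i)%N.
Proof.
rewrite /jt -(det_expand (fun i (e : bool) => if e then (0 < a i)%N%:R * z else 1)
   (fun i e j => shifted h (a i - e + j))).
congr (\det _); apply/matrixP => i j; rewrite !mxE shifted_odd big_bool /= mul1r addrC.
by rewrite subn1 subn0.
Qed.

End Odd.

End JacobiTrudi.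

(** * Fillings are counted by determinants *)

Section Strips.
Variable lam : seq nat.
Hypothesis lam_sorted : sorted geq lam.
Local Notation l := (size lam).
Local Notation M := (sumn lam).+1.
Local Notation rw := (fun c : cell lam => row c : nat).
Local Notation cl := (fun c : cell lam => col c).
Implicit Types (mu nu : l.-tuple 'I_M).

Definition hstrip nu mu := [forall i : 'I_l,
  (part_row nu i.+1 <= part_row mu i <= part_row nu i)%N].
Definition vstrip nu mu := [forall i : 'I_l,
  (part_row mu i <= part_row nu i <= (part_row mu i).+1)%N].
(** An odd letter may not repeat in a row, so that its cells form a vertical
    strip; an even one gives a horizontal strip. *)
Definition strip (b : bool) := if b then vstrip else hstrip.

Definition strip_size nu mu := (\sum_(i < l) (part_row nu i - part_row mu i))%N.

(** The strictly decreasing sequence of the partition, the row indices of its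
    Jacobi-Trudi matrix. *)
Definition beta nu (i : 'I_l) := (part_row nu i + (l.-1 - i))%N.

Lemma part_row_ltM mu i : (part_row mu i < M)%N.
Proof.
have [il|il] := ltnP i l; last by rewrite part_row_default.
by rewrite (part_rowE mu (Ordinal il)) ltn_ord.
Qed.

Lemma is_subP mu : reflect ((forall i, part_row mu i.+1 <= part_row mu i)%N /\
  forall i, (part_row mu i <= nth 0 lam i)%N) (is_sub mu).
Proof.
apply: (iffP idP) => [smu|[H1 H2]].
  by split=> i; [apply: (part_row_le smu)|apply: (part_row_lam _ smu)].
apply/andP; split; last by apply/forallP => i; apply: H2.
by apply/(sortedP 0%N) => i _; apply: H1.
Qed.

Section Reindex.
Variables (R : comNzRingType) (z : R) (h h' : nat -> R).

Lemma part_row_ext mu nu : (forall i : 'I_l, part_row mu i = part_row nu i) -> mu = nu.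
Proof. by move=> H; apply: eq_from_tnth => i; apply/val_inj; rewrite /= -!part_rowE. Qed.

Lemma beta_dec nu (i k : 'I_l) : is_sub nu -> (i < k)%N -> (beta nu k < beta nu i)%N.
Proof.
move=> snu ik; have := part_row_le snu (ltnW ik); rewrite /beta.
by have := ltn_ord k; lia.
Qed.

(** Interlacing of the beta sequences is the interlacing of rows that defines
    horizontal strips. *)
Lemma jt_hstrip nu : is_sub nu ->
  h' 0%N = h 0%N -> (forall n, h' n.+1 = h n.+1 + z * h' n) ->
  jt h' (beta nu) = \sum_(mu | is_sub mu && hstrip nu mu)
    z ^+ strip_size nu mu * jt h (beta mu).
Proof.
move=> snu h0 hS; pose K := (M + l)%N.
have betaK mu i : (beta mu i < K)%N.
  by rewrite /beta /K; have := part_row_ltM mu i; have := ltn_ord i; lia.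
rewrite (jt_even h0 hS (M := K)) //; last by move=> i k; apply: beta_dec.
pose f mu : {ffun 'I_l -> 'I_K} := [ffun i => Ordinal (betaK mu i)].
pose g (b : {ffun 'I_l -> 'I_K}) : l.-tuple 'I_M := [tuple inord (b i - (l.-1 - i))%N | i < l].
have gE (b : {ffun 'I_l -> 'I_K}) (i : 'I_l) : interlace (beta nu) (fun i => b i) ->
   [/\ (l.-1 - i <= b i)%N, part_row (g b) i = (b i - (l.-1 - i))%N &
    (part_row nu i.+1 <= b i - (l.-1 - i) <= part_row nu i)%N].
  move=> /forallP/(_ i)/andP[bi /forallP bk].
  have lb : ((l.-1 - i <= b i) && (part_row nu i.+1 <= b i - (l.-1 - i)))%N.
    have [il|il] := ltnP i.+1 l; last first.
      by rewrite part_row_default //; have := ltn_ord i; lia.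
    have := bk (Ordinal il); rewrite /beta eqxx /=.
    by move: il; lia.
  have ub : (b i - (l.-1 - i) <= part_row nu i)%N by move: bi; rewrite /beta; lia.
  case/andP: lb => lb1 lb2; split => //; last by rewrite lb2.
  rewrite part_rowE tnth_mktuple inordK //.
  exact: leq_ltn_trans ub (part_row_ltM nu i).
rewrite (reindex_onto f g) /=; last first.
  move=> b /gE H; apply/ffunP => i; apply/val_inj; rewrite ffunE /=.
  by have [lb e _] := H i; rewrite /beta e subnK.
have gf mu : g (f mu) = mu.
  apply: part_row_ext => i; rewrite part_rowE tnth_mktuple ffunE /= /beta addnK.
  by rewrite inordK // part_row_ltM.
apply: eq_big => [mu|mu _]; last first.
  congr (_ ^+ _ * _); last by rewrite /jt; congr (\det _); apply/matrixP => i j; rewrite !mxE ffunE.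
  by apply: eq_bigr => i _; rewrite ffunE /= /beta subnDr.
rewrite gf eqxx andbT; apply/idP/idP.
  move=> inter; have Hi := fun i => @gE (f mu) i inter.
  have hs : hstrip nu mu.
    by apply/forallP => i; have [_ e H] := Hi i; rewrite gf in e; rewrite e.
  rewrite hs andbT; apply/is_subP; have [_ nl] := is_subP _ snu.
  split=> i; have [il|il] := ltnP i l; try by rewrite part_row_default // (leqW il).
  - have /forallP/(_ (Ordinal il))/= /andP[le1 _] := hs.
    have [il'|il'] := ltnP i.+1 l; last by rewrite part_row_default.
    have /forallP/(_ (Ordinal il'))/= /andP[_ le2] := hs.
    exact: leq_trans le2 le1.
  - have /forallP/(_ (Ordinal il))/= /andP[_ le1] := hs.
    exact: leq_trans le1 (nl i).
case/andP => smu /forallP hs; apply/forallP => i; rewrite ffunE /=.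
have /andP[le1 le2] := hs i; apply/andP; split; first by rewrite /beta leq_add2r.
apply/forallP => k; apply/implyP => /eqP ki; rewrite /beta ki.
by have := ltn_ord k; move: le1; rewrite ki; lia.
Qed.

(** If some choice of rows to shorten does not give a partition, then two
    consecutive beta numbers become equal and the determinant vanishes.  If an
    empty row is to be shortened, consider the last such row: at the bottom its
    coefficient is 0, and elsewhere the next row is empty and kept, so that
    again two beta numbers agree. *)
Lemma jt_vstrip nu : is_sub nu ->
  h' 0%N = h 0%N -> (forall n, h' n.+1 = h n.+1 + z * h n) ->
  jt h' (beta nu) = \sum_(mu | is_sub mu && vstrip nu mu)
    z ^+ strip_size nu mu * jt h (beta mu).
Proof.
move=> snu h0 hS; rewrite (jt_odd h0 hS).
pose g (e : {ffun 'I_l -> bool}) : l.-tuple 'I_M := [tuple inord (part_row nu i - e i)%N | i < l].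
have gE e (i : 'I_l) : part_row (g e) i = (part_row nu i - e i)%N.
  rewrite part_rowE tnth_mktuple inordK //.
  exact: leq_ltn_trans (leq_subr _ _) (part_row_ltM nu i).
pose pos (e : {ffun 'I_l -> bool}) := [forall i, e i ==> (0 < part_row nu i)%N].
rewrite (bigID (fun e => is_sub (g e) && pos e)) /= [X in _ + X]big1 ?addr0; last first.
  move=> e; have [/forallP pe|ne] := boolP (pos e); last first.
    move=> _; move: ne; rewrite negb_forall => /existsP[i0 i0P].
    pose P (i : 'I_l) := e i && (part_row nu i == 0%N).
    have Pi0 : P i0 by move: i0P; rewrite negb_imply lt0n negbK.
    (* the last empty row that is to be shortened *)
    pose i := [arg max_(i > i0 | P i) (i : nat)].
    have [/andP[ei /eqP ni] imax] : P i /\ forall j, P j -> (j <= i)%N.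
      by rewrite /i; case: arg_maxnP => // j Pj mj.
    have [il|il] := ltnP i.+1 l; last first.
      rewrite (bigD1 i) //= ei /beta ni add0n.
      have -> : (l.-1 - i = 0)%N by move: il; have := ltn_ord i; lia.
      by rewrite ltnn !mul0r.
    have n1 : part_row nu i.+1 = 0%N.
      by apply/eqP; rewrite -leqn0 -ni; apply: (part_row_le snu).
    have e1 : e (Ordinal il) = false.
      apply/negbTE/negP => e1; have := imax (Ordinal il); rewrite /P e1 /= n1 eqxx.
      by rewrite ltnn => /(_ isT).
    rewrite (@jt_eq0 _ _ _ _ i (Ordinal il)) ?mulr0 //; first by rewrite -val_eqE /= (ltn_eqF (ltnSn _)).
    by rewrite /beta e1 ei ni n1 /=; lia.
  rewrite andbT => nsub.
  have [i il bad] : exists2 i, (i.+1 < l)%N & (part_row (g e) i < part_row (g e) i.+1)%N.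
    have [_ nl] := is_subP _ snu.
    case: (boolP [forall i : 'I_l, (i.+1 < l)%N ==> (part_row (g e) i.+1 <= part_row (g e) i)%N]).
      move=> /forallP H; case/negP: nsub; apply/is_subP; split=> i.
        have [il|il] := ltnP i.+1 l; last by rewrite part_row_default.
        by have /implyP := H (Ordinal (ltnW il)); apply.
      have [il|il] := ltnP i l; last by rewrite part_row_default.
      by rewrite (gE e (Ordinal il)); apply: leq_trans (leq_subr _ _) (nl i).
    rewrite negb_forall => /existsP[i]; rewrite negb_imply -ltnNge => /andP[? ?].
    by exists i.
  have bad' := bad; rewrite (gE e (Ordinal (ltnW il))) (gE e (Ordinal il)) /= in bad'.
  have := part_row_le snu (leqnSn i).
  rewrite (@jt_eq0 _ _ _ _ (Ordinal (ltnW il)) (Ordinal il)) ?mulr0 //.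
    by rewrite -val_eqE /= (ltn_eqF (ltnSn _)).
  have := part_row_le snu (leqnSn i); rewrite /beta /=.
  by move: bad'; case: (e _); case: (e _) => /=; lia.
pose f mu : {ffun 'I_l -> bool} := [ffun i : 'I_l => (part_row mu i < part_row nu i)%N].
rewrite (reindex_onto f g) /=; last first.
  move=> e /andP[_ /forallP pe]; apply/ffunP => i; rewrite ffunE gE.
  by have := pe i; case: (e i) => /=; lia.
apply: eq_big => [mu|mu].
  apply/idP/idP.
    case/andP => /andP[sg _] /eqP E; rewrite -{1}E sg /=; apply/forallP => i.
    by have := gE (f mu) i; rewrite E ffunE; case: ltnP => /=; lia.
  case/andP => smu /forallP vs; have E : g (f mu) = mu.
    by apply: part_row_ext => i; rewrite gE ffunE; have := vs i; case: ltnP => /=; lia.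
  rewrite E smu eqxx andbT /=; apply/forallP => i; rewrite ffunE.
  by apply/implyP; apply: leq_trans.
case/andP => /andP[_ /forallP pf] /eqP E.
have fE (i : 'I_l) : f mu i = (part_row nu i - part_row mu i)%N :> nat.
  have := pf i; have := gE (f mu) i; rewrite E ffunE.
  by case: ltnP => /=; lia.
congr (_ * _); last first.
  rewrite /jt; congr (\det _); apply/matrixP => i j; rewrite !mxE /beta.
  congr (shifted _ _ (_ + _)%N); have := gE (f mu) i; have := pf i.
  by rewrite E => + ->; case: (f mu i) => /=; lia.
rewrite /strip_size expr_sum; apply: eq_bigr => i _; rewrite -fE.
have := pf i; case: (f mu i) => //= n0.
by rewrite /beta addn_gt0 n0 mul1r.
Qed.

End Reindex.

Section FillJT.
Variables (R : comNzRingType) (B' : nat) (par : 'I_B'.+1 -> bool) (z : 'I_B'.+1 -> R).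
Local Notation gf nu K := (fill_gf rw cl par z (cells_of nu) 0 K).

Lemma lower_in_cells nu S : is_sub nu ->
  lower_in rw cl (cells_of nu) S = lower_in rw cl setT S && (S \subset cells_of nu).
Proof.
move=> snu; apply/lower_inP/andP => [[sub low]|[/lower_inP[_ low] sub]].
  split=> //; apply/lower_inP; split; first exact: subsetT.
  move=> c d cS _ dS; have [dn|dn] := boolP (d \in cells_of nu); first exact: low.
  have /lower_inP[_ /(_ c d)] := cells_lower snu.
  by apply=> //; apply: (subsetP sub).
by split=> // c d cS dn dS; apply: low.
Qed.

Lemma cells_card nu : is_sub nu -> #|cells_of nu| = (\sum_(i < l) part_row nu i)%N.
Proof.
move=> snu; rewrite -sum1_card (partition_big (fun c : cell lam => row c) predT) //=.
apply: eq_bigr => i _; rewrite -(cells_row_card i snu) /row_card -sum1_card.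
by apply: eq_bigl => c; rewrite !inE.
Qed.

Lemma cells_diff_card nu mu : is_sub nu -> is_sub mu -> cells_of mu \subset cells_of nu ->
  #|cells_of nu :\: cells_of mu| = strip_size nu mu.
Proof.
move=> snu smu sub; rewrite cardsD (setIidPr sub) !cells_card //.
move: sub; rewrite cells_of_sub // => /forallP sub.
by rewrite -sumnB.
Qed.

(** The difference has two cells in one row exactly when the lengths of the row
    in nu and mu differ by at least 2, and two cells in one column exactly when
    some row of mu is shorter than the next row of nu. *)
Lemma strip_cells b nu mu : is_sub nu -> is_sub mu -> cells_of mu \subset cells_of nu ->
  strip_set rw cl b (cells_of nu :\: cells_of mu) = strip b nu mu.
Proof.
move=> snu smu sub; have sub' := sub; rewrite cells_of_sub // in sub'.
have {}sub' (i : nat) : (part_row mu i <= part_row nu i)%N.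
  have [il|il] := ltnP i l; first by have /forallP/(_ (Ordinal il)) := sub'.
  by rewrite !part_row_default.
have inD c : (c \in cells_of nu :\: cells_of mu) =
    (part_row mu (row c) <= col c < part_row nu (row c))%N.
  by rewrite in_setD !cells_ofP -leqNgt.
have mkD i j : (part_row mu i <= j < part_row nu i)%N ->
    exists c, [/\ c \in cells_of nu :\: cells_of mu, row c = i :> nat & col c = j].
  move=> /andP[H1 H2]; have [|c rc cc] := @mk_cell lam i j.
    exact: leq_trans H2 (part_row_lam _ snu).
  by exists c; rewrite inD rc cc H1 H2.
rewrite /strip_set; case: b => /=.
  apply/forall_inP/forallP => [H i|vs c].
    rewrite sub' /=; rewrite leqNgt; apply/negP => lt.
    have [|c [cD rc cc]] := @mkD i (part_row mu i); first by rewrite leqnn (ltnW lt).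
    have [|d [dD rd cd]] := @mkD i (part_row mu i).+1; first by rewrite leqnSn lt.
    have /forall_inP/(_ d dD)/andP[+ _] := H c cD.
    by rewrite /pre_row rc rd cc cd eqxx ltnSn.
  rewrite inD => /andP[c1 c2]; apply/forall_inP => d; rewrite inD => /andP[d1 d2].
  rewrite implybT andbT; apply/implyP => /andP[/eqP rcd lt].
  have /andP[_ le] := vs (row c).
  by move: d1 d2; rewrite -rcd => d1 d2; lia.
apply/forall_inP/forallP => [H i|hs c].
  rewrite sub' andbT leqNgt; apply/negP => lt.
  have [|c [cD rc cc]] := @mkD i (part_row mu i).
    by rewrite leqnn /=; apply: leq_trans lt (part_row_le snu (leqnSn i)).
  have [|d [dD rd cd]] := @mkD i.+1 (part_row mu i).
    by rewrite lt andbT (part_row_le smu).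
  have /forall_inP/(_ d dD)/andP[_] := H c cD.
  by rewrite /pre_col rc rd cc cd eqxx ltnSn.
rewrite inD => /andP[c1 c2]; apply/forall_inP => d; rewrite inD => /andP[d1 d2].
rewrite implybT /=; apply/implyP => /andP[/eqP ccd lt].
have /andP[le _] := hs (row c).
have := part_row_le snu lt; rewrite -ccd in d2.
by lia.
Qed.

(** Remove the largest letter. *)
Lemma fill_rec nu (K : 'I_B'.+1) : is_sub nu ->
  gf nu K.+1 = \sum_(mu | is_sub mu && strip (par K) nu mu)
    z K ^+ strip_size nu mu * gf mu K.
Proof.
move=> snu; rewrite (@fill_split _ _ _ _ _ _ _ _ 0 K) ?leqnSn //.
rewrite (eq_bigl _ _ (fun S => lower_in_cells S snu)) (big_lower lam_sorted).
rewrite [LHS]big_mkcond [RHS]big_mkcond; apply: eq_bigr => mu _.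
case: (boolP (is_sub mu)) => smu //=; case: (boolP (_ \subset _)) => sub.
  rewrite fill_single strip_cells // cells_diff_card // mulrC.
  by case: ifP => _; rewrite ?mul0r // mul1r.
suff -> : strip (par K) nu mu = false by [].
apply: contraNF sub => st; rewrite cells_of_sub //; apply/forallP => i.
by move: st; rewrite /strip; case: (par K) => /forallP/(_ i)/andP[].
Qed.

Variable H : nat -> nat -> R.
Hypothesis H0 : forall n, H 0 n = (n == 0%N)%:R.
Hypothesis HS0 : forall K, H K.+1 0 = H K 0.
Hypothesis HS : forall (K : 'I_B'.+1) n,
  H K.+1 n.+1 = H K n.+1 + z K * (if par K then H K n else H K.+1 n).

(** The numbers H K m are the coefficients of the product over the first K
    letters z of 1 + z X for odd and 1 / (1 - z X) for even letters; the two
    recursions HS say this.  With no letters, the determinant is that of the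
    unit matrix for the empty partition, and has a zero first row otherwise. *)
Lemma fill_jt nu K : is_sub nu -> (K <= B'.+1)%N -> gf nu K = jt (H K) (beta nu).
Proof.
elim: K nu => [|K IH] nu snu KB.
  rewrite fill_empty; have [nu0|[c cn]] := set_0Vmem (cells_of nu).
    have n0 (i : 'I_l) : part_row nu i = 0%N.
      rewrite -(cells_row_card _ snu) nu0; apply: eq_card0 => c.
      by rewrite !inE.
    rewrite nu0 eqxx /jt -(det1 R l); congr (\det _); apply/matrixP => i j.
    rewrite !mxE /shifted /beta n0 add0n H0 -val_eqE /=.
    have := ltn_ord i; have := ltn_ord j; case: (ltnP (l.-1 - i + j) l.-1) => ? ? ?.
      by rewrite (_ : (i == j :> nat) = false) //; lia.
    by congr ((nat_of_bool _)%:R); lia.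
  have l0 : (0 < l)%N by apply: leq_ltn_trans (ltn_ord (row c)).
  have n0 : (0 < part_row nu 0)%N.
    apply: leq_trans (part_row_le snu (leq0n (row c))).
    by apply: leq_ltn_trans (leq0n (col c)) _; rewrite -cells_ofP.
  rewrite (_ : _ == set0 = false); last by apply/eqP => E; rewrite E inE in cn.
  apply/esym/eqP; rewrite /jt (expand_det_row _ (Ordinal l0)) big1 // => j _.
  rewrite !mxE /shifted /beta /= H0; have := ltn_ord j.
  case: (ltnP (part_row nu 0 + (l.-1 - 0) + j) l.-1) => ? ?; rewrite ?mul0r //.
  by rewrite (_ : (_ == _) = false) ?mul0r //; lia.
rewrite (fill_rec (Ordinal KB) snu) /=.
have HSK := HS (Ordinal KB); have E0 := HS0 K; move: HSK; rewrite /= /strip.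
case: (par _) => HSK.
  rewrite (jt_vstrip snu E0 HSK); apply: eq_bigr => mu /andP[smu _].
  by rewrite IH // ltnW.
rewrite (jt_hstrip snu E0 HSK); apply: eq_bigr => mu /andP[smu _].
by rewrite IH // ltnW.
Qed.

End FillJT.
End Strips.

(** * Hook lengths and the evaluation of the determinant *)

Section Hooks.
Variable lam : seq nat.
Hypothesis lam_sorted : sorted geq lam.
Local Notation l := (size lam).
Local Notation lr i := (nth 0 lam i).
Local Notation lc j := (nth 0 (conj_part lam) j).

Definition beta_nat i := (lr i + (l.-1 - i))%N.
Definition hook_nat i j := ((lr i - j.+1) + (lc j - i.+1)).+1.

Lemma lc_le j j' : (j <= j')%N -> (lc j' <= lc j)%N.
Proof.
move=> jj; rewrite leqNgt conj_lt // -leqNgt; apply: leq_trans jj.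
by rewrite leqNgt -conj_lt // ltnn.
Qed.

Lemma lr_le i i' : (i <= i')%N -> (lr i' <= lr i)%N.
Proof. exact: sorted_nth. Qed.

Lemma beta_nat_lt (i k : nat) : (i < k)%N -> (k < l)%N -> (beta_nat k < beta_nat i)%N.
Proof. by move=> ik kl; have := lr_le (ltnW ik); rewrite /beta_nat; lia. Qed.

(** If cell (k, j) is in the diagram then the hook of (i, j) reaches row k and
    is too long, and otherwise it is too short. *)
Lemma hook_neq (i j k : nat) : (i < k)%N -> (k < l)%N -> (j < lr i)%N ->
  hook_nat i j <> (beta_nat i - beta_nat k)%N.
Proof.
move=> ik kl ji; have := beta_nat_lt ik kl; have := lr_le (ltnW ik).
have : (i < lc j)%N by rewrite conj_lt.
rewrite /hook_nat /beta_nat.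
have kj : (k < lc j)%N = (j < lr k)%N by rewrite conj_lt.
move: kj ji kl ik; move: (lr i) (lr k) (lc j) l => a b c m.
by case: (ltnP k c); case: (ltnP j b) => // *; lia.
Qed.

Lemma hook_le (i j : nat) : (i < l)%N -> (j < lr i)%N -> (hook_nat i j <= beta_nat i)%N.
Proof.
move=> il jl; have : (lc j <= l)%N by rewrite leqNgt conj_lt // nth_default.
have : (i < lc j)%N by rewrite conj_lt.
by rewrite /hook_nat /beta_nat; move: (lc j) (lr i) l il jl; lia.
Qed.

(** Hook lengths decrease strictly along row i, the differences of beta numbers
    increase strictly, and the two sequences are disjoint; together they are
    beta_i numbers between 1 and beta_i. *)
Lemma hook_perm i : (i < l)%N ->
  perm_eq ([seq hook_nat i j | j <- iota 0 (lr i)] ++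
           [seq (beta_nat i - beta_nat k)%N | k <- iota i.+1 (l.-1 - i)])
          (iota 1 (beta_nat i)).
Proof.
move=> il.
have lcP j : (j < lr i)%N -> (i < lc j)%N by rewrite conj_lt.
have ubeta k := @beta_nat_lt i k.
have inj1 : {in iota 0 (lr i) &, injective (hook_nat i)}.
  have lt j j' : (j < j')%N -> (j' < lr i)%N -> (hook_nat i j' < hook_nat i j)%N.
    move=> jj j'l; have := lc_le (ltnW jj); have := lcP _ j'l.
    by rewrite /hook_nat; lia.
  move=> j j'; rewrite !mem_iota !add0n /= => jl j'l E.
  case: (ltngtP j j') => // jj; first by have := lt _ _ jj j'l; rewrite E ltnn.
  by have := lt _ _ jj jl; rewrite E ltnn.
have inj2 : {in iota i.+1 (l.-1 - i) &, injective (fun k => beta_nat i - beta_nat k)%N}.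
  have lt k k' : (k < k')%N -> (i < k)%N -> (k' < l)%N -> (beta_nat i - beta_nat k < beta_nat i - beta_nat k')%N.
    move=> kk ik k'l; have := lr_le (ltnW kk); have := beta_nat_lt (ltn_trans ik kk) k'l.
    by rewrite /beta_nat; lia.
  move=> k k'; rewrite !mem_iota => /andP[k1 k2] /andP[k1' k2'] E.
  case: (ltngtP k k') => // kk.
    have k'l : (k' < l)%N by move: k2'; lia.
    by have := lt _ _ kk k1 k'l; rewrite E ltnn.
  have kl : (k < l)%N by move: k2; lia.
  by have := lt _ _ kk k1' kl; rewrite E ltnn.
have un : uniq ([seq hook_nat i j | j <- iota 0 (lr i)] ++
           [seq (beta_nat i - beta_nat k)%N | k <- iota i.+1 (l.-1 - i)]).
  rewrite cat_uniq !map_inj_in_uniq ?iota_uniq //= andbT.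
  apply/hasPn => m /mapP[k]; rewrite mem_iota => /andP[k1 k2] ->.
  apply/negP => /mapP[j]; rewrite mem_iota add0n /= => jl.
  have kl : (k < l)%N by move: k2; lia.
  by move/esym; apply: hook_neq.
have sz : size (iota 1 (beta_nat i)) = size ([seq hook_nat i j | j <- iota 0 (lr i)] ++
           [seq (beta_nat i - beta_nat k)%N | k <- iota i.+1 (l.-1 - i)]).
  by rewrite size_cat !size_map !size_iota.
have sub : {subset [seq hook_nat i j | j <- iota 0 (lr i)] ++
           [seq (beta_nat i - beta_nat k)%N | k <- iota i.+1 (l.-1 - i)] <= iota 1 (beta_nat i)}.
  move=> m; rewrite mem_cat => /orP[/mapP[j]|/mapP[k]]; rewrite !mem_iota add1n.
    by rewrite add0n /= => jl ->; rewrite ltnS hook_le.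
  move=> /andP[k1 k2] ->; have kl : (k < l)%N by move: k2; lia.
  by rewrite ltnS leq_subr subn_gt0 ubeta.
apply: uniq_perm => //; first exact: iota_uniq.
by have [] := uniq_min_size un sub; rewrite ?sz.
Qed.

End Hooks.

Section ProductFormula.
Variables (K : fieldType) (q u : K).
Hypothesis q_neq1 : forall m, 1 - q ^+ m.+1 != 0.
Hypothesis q_neq0 : q != 0.
Hypothesis u_neq : forall c : int, 1 - u * q ^ c != 0.

Definition qfact m : K := \prod_(i < m) (1 - q ^+ i.+1).
Definition upoch m : K := \prod_(i < m) (1 - u * q ^+ i).
(** By the q-binomial theorem, the coefficient of X^m in the formal product over
    i of (1 - u q^i X) / (1 - q^i X). *)
Definition hspec m : K := upoch m / qfact m.

Lemma qfact_neq0 m : qfact m != 0.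
Proof. by apply/prodf_neq0 => i _. Qed.

Section Eval.
Variable l : nat.
Local Notation L := l.-1.

(** The product of 1 - u q^i over - L <= i < a - L, with L = l - 1.  Starting at
    - L makes the numerators of all entries, whose indices are a + j - L, split
    off a factor that depends on the row only. *)
Definition ushift a : K := \prod_(i < a) (1 - u * q ^ (i%:Z - L%:Z)).
Definition rowfac a : K := ushift a / ushift L / qfact a.
Definition colpoly (j : nat) : {poly K} :=
  (\prod_(i < j) (1 - (u * q ^ (i%:Z - L%:Z)) *: 'X)) *
  (\prod_(i < L - j) (1 - q ^- i *: 'X)).

Lemma ushift_neq0 a : ushift a != 0.
Proof. by apply/prodf_neq0 => i _. Qed.

Lemma ushiftD a j : ushift (a + j) =
  ushift a * \prod_(i < j) (1 - u * q ^ (i%:Z - L%:Z) * q ^+ a).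
Proof.
rewrite /ushift big_split_ord /=; congr (_ * _); apply: eq_bigr => i _.
by rewrite PoszD -mulrA [q ^+ a]exprnP -expfzDr //; congr (_ - _ * _ ^ _); ring.
Qed.

Lemma ushift_upoch m : ushift (L + m) = ushift L * upoch m.
Proof.
rewrite ushiftD; congr (_ * _); apply: eq_bigr => i _.
by rewrite -mulrA [q ^+ L]exprnP -expfzDr // subrK.
Qed.

Lemma qfactD m k : qfact (m + k) = qfact m * \prod_(i < k) (1 - q ^- i * q ^+ (m + k)).
Proof.
rewrite /qfact big_split_ord /=; congr (_ * _).
rewrite [RHS](reindex_inj rev_ord_inj) /=; apply: eq_bigr => i _; congr (_ - _).
have -> : (m + k = (k - i.+1) + (m + i).+1)%N by have := ltn_ord i; lia.
by rewrite exprD mulKf ?expf_neq0.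
Qed.

(** Where the entry vanishes because its index is negative, the column
    polynomial has q^a among the roots of its second product. *)
Lemma shifted_hspec a j : (j <= L)%N ->
  shifted l hspec (a + j) = rowfac a * (colpoly j).[q ^+ a].
Proof.
move=> jL; rewrite /colpoly hornerM !horner_prod.
under eq_bigr do rewrite !hornerE.
under [X in _ * (_ * X)]eq_bigr do rewrite !hornerE.
rewrite /shifted; case: ltnP => aj.
  have aLj : (a < L - j)%N by lia.
  rewrite [X in _ * (_ * X)](bigD1 (Ordinal aLj)) //= mulVf ?expf_neq0 // subrr.
  by rewrite mul0r !mulr0.
rewrite mulrA /rowfac; set P := \prod_(i < j) _; set Q := \prod_(i < L - j) _.
have EP : ushift a * P = ushift L * upoch (a + j - L).
  by rewrite -ushift_upoch subnKC // ushiftD.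
have EQ : qfact a = qfact (a + j - L) * Q.
  have {1}-> : (a = (a + j - L) + (L - j))%N by lia.
  rewrite qfactD; congr (_ * _); apply: eq_bigr => i _; congr (1 - _ * _ ^+ _); lia.
have Q0 : Q != 0 by have := qfact_neq0 a; rewrite EQ mulf_eq0 negb_or => /andP[].
rewrite /hspec EQ; have := ushift_neq0 L; have := qfact_neq0 (a + j - L).
move=> f0 u0; have -> : upoch (a + j - L) = ushift a * P / ushift L.
  by rewrite EP mulrAC mulfV ?mul1r.
by field; rewrite ?f0 ?u0 ?Q0.
Qed.

Lemma size_colpoly j : (j <= L)%N -> (0 < l)%N -> (size (colpoly j) <= l)%N.
Proof.
move=> jL l0.
have lin (c : K) : (size (1 - c *: 'X : {poly K})%R <= 2)%N.
  apply: leq_trans (size_polyD _ _) _; rewrite size_polyN size_poly1 geq_max /=.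
  by apply: leq_trans (size_scale_leq _ _) _; rewrite size_polyX.
have linp m (c : 'I_m -> K) : (size (\prod_(i < m) (1 - c i *: 'X) : {poly K})%R <= m.+1)%N.
  apply: leq_trans (size_poly_prod_leq _ _) _; rewrite card_ord leq_subLR addnS ltnS.
  apply: leq_trans (leq_sum _ (fun i _ => lin (c i))) _.
  by rewrite sum_nat_const card_ord; lia.
apply: leq_trans (size_polyMleq _ _) _.
have := linp j (fun i => u * q ^ (i%:Z - L%:Z)).
have := linp (L - j)%N (fun i => q ^- i).
move=> H1 H2; rewrite -subn1 leq_subLR; apply: leq_trans (leq_add H2 H1) _.
by clear -jL l0; lia.
Qed.

Definition qvand (a : 'I_l -> nat) : K :=
  \prod_(i < l) \prod_(j < l | (i < j)%N) (q ^+ a j - q ^+ a i).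

Definition colcoef : 'M[K]_l := \matrix_(k, j) (colpoly j)`_k.

(** The matrix is the product of the diagonal matrix of row factors, a
    Vandermonde matrix in the q^(a_i), and the matrix of coefficients of the
    column polynomials, which does not depend on a. *)
Lemma jt_hspec (a : 'I_l -> nat) :
  jt hspec a = (\prod_i rowfac (a i)) * (qvand a * \det colcoef).
Proof.
pose y := \row_(i < l) q ^+ a i.
have -> : qvand a = \det (Vandermonde l y)^T.
  rewrite det_tr det_Vandermonde; apply: eq_bigr => i _; apply: eq_bigr => j _.
  by rewrite !mxE.
rewrite -det_mulmx -[\prod_i _](_ : \det (diag_mx (\row_i rowfac (a i))) = _); last first.
  by rewrite det_diag; apply: eq_bigr => i _; rewrite mxE.
rewrite -det_mulmx /jt; congr (\det _); apply/matrixP => i j.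
rewrite mul_diag_mx !mxE shifted_hspec; last by have := ltn_ord j; lia.
congr (_ * _); rewrite (horner_coef_wide _ (size_colpoly _ _)); first last.
- by apply: leq_ltn_trans (ltn_ord i).
- by have := ltn_ord j; lia.
by apply: eq_bigr => k _; rewrite !mxE mulrC.
Qed.

Lemma jt_empty (h : nat -> K) : h 0%N = 1 -> jt h (fun i : 'I_l => L - i)%N = 1.
Proof.
move=> h0; rewrite /jt -det_tr det_trig.
  apply: big1 => i _; rewrite !mxE subnK; last by have := ltn_ord i; lia.
  by rewrite /shifted ltnn subnn.
apply/is_trig_mxP => i j ij; rewrite !mxE /shifted.
by rewrite (_ : (L - j + i < L)%N) //; have := ltn_ord j; lia.
Qed.

(** The determinant of coefficients is the same for the empty partition, whose
    Jacobi-Trudi matrix is unitriangular; dividing by that case eliminates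
    it. *)
Lemma jt_ratio (a : 'I_l -> nat) : jt hspec a =
  \prod_i (rowfac (a i) / rowfac (L - i)) * (qvand a / qvand (fun i => L - i)%N).
Proof.
have := jt_hspec (fun i : 'I_l => L - i)%N.
rewrite jt_empty; last by rewrite /hspec /upoch /qfact !big_ord0 divr1.
set P0 := \prod_i _; set V0 := qvand _ => E.
have /andP[/andP[P0n V0n] Cn] : (P0 != 0) && (V0 != 0) && (\det colcoef != 0).
  by have := oner_neq0 K; rewrite E !mulf_eq0 !negb_or andbA.
have -> : \prod_i (rowfac (a i) / rowfac (L - i)) = (\prod_i rowfac (a i)) / P0.
  by rewrite big_split /= prodfV.
rewrite jt_hspec; set A := \prod_i _; set D := \det _ in E Cn *.
have -> : D = (P0 * V0)^-1.
  by rewrite -[LHS]mul1r -(mulVf (mulf_neq0 P0n V0n)) -!mulrA -E mulr1.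
by rewrite invfM; ring.
Qed.

Lemma qvandE (a : 'I_l -> nat) : (forall i j : 'I_l, (i < j)%N -> (a j < a i)%N) ->
  qvand a = q ^+ (\sum_(j < l) j * a j)%N *
    \prod_(i < l) \prod_(j < l | (i < j)%N) (1 - q ^+ (a i - a j)).
Proof.
move=> a_dec; rewrite /qvand.
have -> : q ^+ (\sum_(j < l) j * a j)%N = \prod_(i < l) \prod_(j < l | (i < j)%N) q ^+ a j.
  rewrite (exchange_big_dep predT) //= expr_sum; apply: eq_bigr => j _.
  rewrite prodr_const mulnC exprM; congr (_ ^+ _).
  by rewrite -sum1_card (big_ord_narrow (ltnW (ltn_ord j))) sum1_card card_ord.
rewrite -big_split; apply: eq_bigr => i _; rewrite -big_split; apply: eq_bigr => j ij /=.
by rewrite mulrBr mulr1 -exprD subnKC // ltnW // a_dec.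
Qed.

End Eval.

Variable lam : seq nat.
Hypothesis lam_sorted : sorted geq lam.
Local Notation l := (size lam).
Local Notation L := l.-1.

Lemma prod_cell (F : nat -> nat -> K) :
  \prod_(c : cell lam) F (row c) (col c) = \prod_(i < l) \prod_(j < nth 0 lam i) F i j.
Proof. by rewrite sig_big_dep. Qed.

Lemma qfact_iota m : qfact m = \prod_(k <- iota 1 m) (1 - q ^+ k).
Proof.
rewrite /qfact -(big_mkord predT (fun i => 1 - q ^+ i.+1)) /index_iota subn0.
by rewrite (iotaDl 1 0) big_map.
Qed.

Lemma prod_after m (i : 'I_m) (F : nat -> K) :
  \prod_(k < m | (i < k)%N) F k = \prod_(k <- iota i.+1 (m.-1 - i)) F k.
Proof.
rewrite -(big_mkord (fun k => i < k)%N F) /index_iota subn0 -big_filter; congr bigop.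
have -> : iota 0 m = iota 0 i.+1 ++ iota i.+1 (m.-1 - i).
  by rewrite -[X in _ ++ iota X _]add0n -iotaD; congr iota; have := ltn_ord i; lia.
rewrite filter_cat (@eq_in_filter _ _ pred0) => [|k]; last first.
  by rewrite mem_iota add0n ltnS => /andP[_]; rewrite leqNgt => /negPf ->.
rewrite filter_pred0 (@eq_in_filter _ _ predT) ?filter_predT // => k.
by rewrite mem_iota => /andP[].
Qed.

(** The q-analogue of hook_perm. *)
Lemma qfact_hooks (i : 'I_l) : qfact (beta_nat lam i) =
  (\prod_(j < nth 0 lam i) (1 - q ^+ hook_nat lam i j)) *
  \prod_(k < l | (i < k)%N) (1 - q ^+ (beta_nat lam i - beta_nat lam k)).
Proof.
rewrite qfact_iota -(perm_big _ (hook_perm lam_sorted (ltn_ord i))) big_cat !big_map /=.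
congr (_ * _); first by rewrite -(big_mkord predT (fun j => 1 - q ^+ hook_nat lam i j)) /index_iota subn0.
by rewrite (prod_after i (fun k => 1 - q ^+ (beta_nat lam i - beta_nat lam k))).
Qed.

Lemma qfact_stairs (i : 'I_l) : qfact (L - i) =
  \prod_(k < l | (i < k)%N) (1 - q ^+ ((L - i) - (L - k))).
Proof.
rewrite (prod_after i (fun k => 1 - q ^+ (L - i - (L - k)))) qfact_iota.
rewrite -[i.+1]addn1 iotaDl big_map !big_seq; apply: eq_bigr => k.
rewrite mem_iota => /andP[k0 kL]; congr (1 - _ ^+ _).
by move: (k : nat) k0 kL; have := ltn_ord i; lia.
Qed.

(** The row factors give the contents in the numerator and the q-factorials of
    the beta numbers in the denominator; by qfact_hooks the Vandermonde factors
    cancel those of the q-factorials that are not hook lengths.  The powers of q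
    taken out of the Vandermonde determinants leave the exponent n(lam). *)
Lemma jt_product : jt hspec (fun i : 'I_l => beta_nat lam i) =
  q ^+ nfun lam * \prod_(c : cell lam) ((1 - u * q ^ content c) / (1 - q ^+ hook c)).
Proof.
rewrite jt_ratio.
rewrite (@qvandE _ (fun i => beta_nat lam i)); last first.
  by move=> i j ij; apply: beta_nat_lt.
rewrite (@qvandE _ (fun i => L - i)%N); last first.
  by move=> i j ij; have := ltn_ord j; lia.
pose s := (\sum_(j < l) j * (L - j))%N.
have -> : (\sum_(j < l) j * beta_nat lam j = nfun lam + s)%N.
  by rewrite /nfun /s -big_split; apply: eq_bigr => j _; rewrite /beta_nat mulnDr.
rewrite (prod_cell (fun i j => (1 - u * q ^ (j%:Z - i%:Z)) / (1 - q ^+ hook_nat lam i j))).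
rewrite exprD -/s.
pose C (i : 'I_l) := \prod_(j < nth 0 lam i) (1 - u * q ^ (j%:Z - i%:Z)).
pose Hk (i : 'I_l) := \prod_(j < nth 0 lam i) (1 - q ^+ hook_nat lam i j).
pose W (i : 'I_l) := \prod_(k < l | (i < k)%N) (1 - q ^+ (beta_nat lam i - beta_nat lam k)).
have rowE (i : 'I_l) : rowfac l (beta_nat lam i) / rowfac l (L - i) =
    C i * (qfact (L - i) / (Hk i * W i)).
  rewrite /rowfac -qfact_hooks /beta_nat addnC ushiftD.
  have -> : \prod_(i0 < nth 0 lam i) (1 - u * q ^ (i0%:Z - L%:Z) * q ^+ (L - i)) = C i.
    apply: eq_bigr => j _; rewrite -mulrA [q ^+ (L - i)]exprnP -expfzDr //.
    by congr (1 - u * q ^ _); have := ltn_ord i; lia.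
  have := ushift_neq0 l (L - i); have := ushift_neq0 l L; have := qfact_neq0 (L - i).
  have := qfact_neq0 (L - i + nth 0 lam i).
  by move=> n1 n2 n3 n4; field; rewrite ?n1 ?n2 ?n3 ?n4.
rewrite (eq_bigr _ (fun i _ => rowE i)).
have -> : \prod_(i < l) \prod_(j < l | (i < j)%N) (1 - q ^+ (beta_nat lam i - beta_nat lam j)) = \prod_i W i by [].
have -> : \prod_(i < l) \prod_(j < l | (i < j)%N) (1 - q ^+ (L - i - (L - j))) = \prod_(i < l) qfact (L - i).
  by apply: eq_bigr => i _; rewrite qfact_stairs.
have -> : \prod_(i < l) \prod_(j < nth 0 lam i) ((1 - u * q ^ (j%:Z - i%:Z)) / (1 - q ^+ hook_nat lam i j)) =
    \prod_i (C i / Hk i).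
  by apply: eq_bigr => i _; rewrite big_split /= prodfV.
have HW i : Hk i * W i != 0 by rewrite -qfact_hooks qfact_neq0.
rewrite !big_split /= !prodfV big_split /=.
have := expf_neq0 s q_neq0.
have : \prod_i Hk i * \prod_i W i != 0.
  by rewrite -big_split /=; apply/prodf_neq0 => i _; apply: HW.
have : \prod_(i < l) qfact (L - i) != 0 by apply/prodf_neq0 => i _; apply: qfact_neq0.
rewrite mulf_eq0 negb_or.
move: (\prod_i C i) (\prod_i Hk i) (\prod_i W i) (\prod_(i < l) _) (q ^+ s) (q ^+ _).
by move=> c h w f x y f0 /andP[h0 w0] x0; field; rewrite ?f0 ?h0 ?w0 ?x0.
Qed.

End ProductFormula.

(** * The graded multiplicity as a super Schur polynomial *)

Section Multiplicity.
Variables (F : fieldType) (n : nat) (lam : seq nat).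
Hypothesis charF : forall m, m.+1%:R != 0 :> F.
Hypothesis lamP : is_partition n.+1 lam.

Lemma lam_sorted : sorted geq lam. Proof. by case/and3P: lamP. Qed.

Lemma card_cell : #|cell lam| = n.+1.
Proof.
have <- : sumn lam = n.+1 by case/and3P: lamP => _ _ /eqP.
have E : (\sum_(i < size lam) \sum_(j < nth 0 lam i) 1 = \sum_(c : cell lam) 1)%N.
  by rewrite sig_big_dep.
rewrite -sum1_card -E sumnE (big_nth 0%N) big_mkord; apply: eq_bigr => i _.
by rewrite sum1_card card_ord.
Qed.

Definition tableau0 : {ffun 'I_n.+1 -> cell lam} :=
  [ffun i => enum_val (cast_ord (esym card_cell) i)].

Lemma tableau0P : is_tableau tableau0.
Proof.
apply/andP; split.
  by apply/injectiveP => i j; rewrite !ffunE => /enum_val_inj/cast_ord_inj.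
apply/forallP => c; apply/codomP; exists (cast_ord card_cell (enum_rank c)).
by rewrite ffunE cast_ordK enum_rankK.
Qed.

Variable N : nat.
Local Notation B' := (N + N.+1)%N.

(** Even letters come first, as in the definition of the super Schur
    function. *)
Definition letter_deg (s : nat) := (if s < N.+1 then 2 * s else 2 * (s - N.+1) + 1)%N.

Lemma letter_deg_odd (s : 'I_B'.+1) : odd (letter_deg s) = late s.
Proof. by rewrite /letter_deg /late; case: ltnP => _; rewrite ?addn1 /= mul2n odd_double. Qed.

Lemma letter_deg_inj : injective (fun s : 'I_B'.+1 => letter_deg s).
Proof.
move=> s t E; apply/val_inj => /=; have := congr1 odd E; rewrite !letter_deg_odd /late.
move: (nat_of_ord s) (nat_of_ord t) E => {}s {}t; rewrite /letter_deg.
by case: (ltnP s N.+1); case: (ltnP t N.+1); lia.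
Qed.

Lemma letter_deg_onto k : (k <= N)%N -> forall d, (d <= k)%N ->
  exists s : 'I_B'.+1, letter_deg s = d.
Proof.
move=> kN d dk; have [od|od] := boolP (odd d).
  have lt : (N.+1 + d./2 < B'.+1)%N by have := odd_double_half d; lia.
  exists (Ordinal lt); rewrite /letter_deg /=.
  by have := odd_double_half d; rewrite od; case: ltnP; lia.
have lt : (d./2 < B'.+1)%N by have := odd_double_half d; lia.
exists (Ordinal lt); rewrite /letter_deg /=.
by have := odd_double_half d; rewrite (negPf od); case: ltnP; lia.
Qed.

Definition xvar (i : 'I_N.+1) : {poly int} := 'X^(2 * i).
Definition yvar (i : 'I_N.+1) : {poly int} := 'X^(2 * i + 1).
Definition zvar (s : 'I_B'.+1) : {poly int} := 'X^(letter_deg s).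

Lemma zvar_x (t : 'I_N.+1) (s : 'I_B'.+1) : s = t :> nat -> xvar t = zvar s.
Proof. by rewrite /xvar /zvar /letter_deg => ->; rewrite ltn_ord. Qed.

Lemma zvar_y (t : 'I_N.+1) (s : 'I_B'.+1) : s = (N.+1 + t)%N :> nat -> yvar t = zvar s.
Proof.
rewrite /yvar /zvar /letter_deg => ->.
by rewrite ltnNge leq_addr /= addKn.
Qed.

Local Notation rw := (fun c : cell lam => row c : nat).
Local Notation cl := (fun c : cell lam => col c).
Local Notation gf := (fill_gf rw cl (@late N) zvar setT 0 B'.+1).

Lemma super_schur_gf : super_schur lam xvar yvar = gf.
Proof. by rewrite (super_schur_fill lam_sorted zvar_x zvar_y) addSn. Qed.

(** The letters up to 2N + 1 include all exponents up to k, and the order of the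
    letters is free in dim_eqHom; so the words counted there are the fillings
    counted by the generating function. *)
Lemma graded_mult_coef k : (k <= N)%N -> (graded_mult F n lam k)%:Z = gf`_k.
Proof.
move=> kN; rewrite /graded_mult dim_superHom.
rewrite (dim_eqHom charF letter_deg_inj (letter_deg_onto kN) lam_sorted tableau0P).
have gfE : gf = \sum_(T : {ffun cell lam -> 'I_B'.+1} | fill_ss rw cl (@late N) setT T)
    'X^(\sum_c letter_deg (T c)).
  rewrite /fill_gf; apply: eq_big => [T|T _].
    rewrite (_ : fill_in _ _ _ _ = true) //; apply/fill_inP => c.
    by rewrite in_setT /= ltn_ord.
  by rewrite expr_sum; apply: eq_big => [c|c _]; rewrite ?in_setT.
have [inv invP] := fin_all_exists (T0_onto tableau0P).
have invK i : inv (tableau0 i) = i.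
  by case/andP: tableau0P => /injectiveP tinj _; apply: tinj; rewrite invP.
pose h (w : {ffun 'I_n.+1 -> 'I_B'.+1}) : {ffun cell lam -> 'I_B'.+1} :=
  [ffun c => w (inv c)].
pose h' (T : {ffun cell lam -> 'I_B'.+1}) : {ffun 'I_n.+1 -> 'I_B'.+1} :=
  [ffun i => T (tableau0 i)].
rewrite gfE coef_sum (reindex h) /=; last first.
  exists h' => [w _|T _]; apply/ffunP => x; rewrite ffunE ffunE ?invK ?invP //.
under eq_bigr do rewrite coefXn.
rewrite -natr_sum natz -sum1_card; congr Posz.
rewrite big_mkcond [RHS]big_mkcond /=; apply: eq_bigr => w _.
rewrite inE.
have -> : (\sum_c letter_deg (h w c) = wdeg (fun s : 'I_B'.+1 => letter_deg s) w)%N.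
  rewrite (reindex tableau0) /=; first by apply: eq_bigr => i _; rewrite [h w _]ffunE invK.
  by exists inv => [i _|c _]; [apply: invK|apply: invP].
have -> : word_ss (fun x : 'I_B'.+1 => odd (letter_deg x)) (trow tableau0) (tcol tableau0) w =
    fill_ss rw cl (@late N) setT (h w).
  have E b x y : let_le (fun x : 'I_B'.+1 => odd (letter_deg x)) b x y = let_le (@late N) b x y.
    by rewrite /let_le letter_deg_odd.
  apply/'forall_forallP/fill_ssP => [H c d _ _|H i j].
    have := H (inv c) (inv d); rewrite !E /trow /tcol !invP ![h w _]ffunE.
    by move=> /andP[/implyP ? /implyP ?].
  have := H (tableau0 i) (tableau0 j) (in_setT _) (in_setT _).
  rewrite !E ![h w _]ffunE !invK => -[? ?]; by apply/andP; split; apply/implyP.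
by case: (fill_ss _ _ _ _ _) => //=; rewrite eq_sym; case: eqP.
Qed.

End Multiplicity.

(** * The principal specialization *)

Section Letters.
Variable R : comNzRingType.
Implicit Types (h g : nat -> R) (z q : R).

(** add_odd and add_even multiply the series with coefficients h by 1 + z X and
    by 1 / (1 - z X). *)
Definition add_odd z h (n : nat) : R := h n + z * (if n is n'.+1 then h n' else 0).
Fixpoint add_even z h (n : nat) : R :=
  if n is n'.+1 then h n + z * add_even z h n' else h 0%N.

Lemma add_odd_comm z z' h : add_odd z (add_odd z' h) =1 add_odd z' (add_odd z h).
Proof. by move=> [|[|n]]; rewrite /add_odd; ring. Qed.

Lemma eq_add_odd z h g : h =1 g -> add_odd z h =1 add_odd z g.
Proof. by move=> E [|n]; rewrite /add_odd !E. Qed.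

(** The factors are accumulated with the last letter outermost, which is the
    order in which letters are added; add_oddsSl takes out the first letter
    instead. *)
Fixpoint add_odds (y : nat -> R) s r h : nat -> R :=
  if r is r'.+1 then add_odd (y (s + r')%N) (add_odds y s r' h) else h.

Lemma add_oddsSl y s r h : add_odds y s r.+1 h =1 add_odd (y s) (add_odds y s.+1 r h).
Proof.
elim: r => [|r IH] n; first by rewrite /= addn0.
transitivity (add_odd (y (s + r.+1)%N) (add_odd (y s) (add_odds y s.+1 r h)) n).
  exact: eq_add_odd IH n.
by rewrite add_odd_comm /= addnS.
Qed.

Definition qpoch q n : R := \prod_(i < n) (1 - q ^+ i.+1).

Lemma qpochS q n : qpoch q n.+1 = qpoch q n * (1 - q ^+ n.+1).
Proof. by rewrite /qpoch big_ord_recr. Qed.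

(** The complete homogeneous polynomials of 1, q, ..., q^(K-1) are the Gaussian
    binomial coefficients. *)
Lemma even_closed (E : nat -> nat -> R) q M :
  (forall n, E 0%N n = (n == 0%N)%:R) -> (forall K, (K < M)%N -> E K.+1 = add_even (q ^+ K) (E K)) ->
  forall K n, (K <= M)%N -> E K n * qpoch q n = \prod_(i < n) (1 - q ^+ (K + i)).
Proof.
move=> E0 ES K n KM; elim: K KM n => [|K IHK] KM.
  case=> [|n]; first by rewrite E0 /qpoch !big_ord0 mulr1.
  by rewrite E0 mul0r big_ord_recl /= subrr mul0r.
elim=> [|n IHn]; first by have := IHK (ltnW KM) 0%N; rewrite ES // /qpoch !big_ord0.
have P1 : \prod_(i < n.+1) (1 - q ^+ (K + i)) =
    (1 - q ^+ K) * \prod_(i < n) (1 - q ^+ (K.+1 + i)).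
  rewrite big_ord_recl addn0; congr (_ * _); apply: eq_bigr => i _.
  by rewrite /= /bump add1n addnS addSn.
have -> : E K.+1 n.+1 = E K n.+1 + q ^+ K * E K.+1 n by rewrite ES.
rewrite mulrDl (IHK (ltnW KM)) P1 -mulrA qpochS (mulrA (E K.+1 n)) IHn big_ord_recr /=.
by move: (\prod_(_ < n) _) => P; rewrite addSn !exprS exprD; ring.
Qed.

End Letters.

Section PolyCong.
Variable m : nat.
Implicit Types a b c d : {poly int}.

(** Congruence of polynomials modulo X^m, that is up to the precision to which
    finitely many letters determine the series. *)
Definition pcong a b := exists c, a = b + 'X^m * c.

Lemma pcong_refl a : pcong a a. Proof. by exists 0; rewrite mulr0 addr0. Qed.
Lemma pcongD a b c d : pcong a b -> pcong c d -> pcong (a + c) (b + d).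
Proof. by move=> [x ->] [y ->]; exists (x + y); ring. Qed.
Lemma pcongM a b c d : pcong a b -> pcong c d -> pcong (a * c) (b * d).
Proof. by move=> [x ->] [y ->]; exists (b * y + x * d + 'X^m * x * y); ring. Qed.
Lemma pcong_trans a b c : pcong a b -> pcong b c -> pcong a c.
Proof. by move=> [x ->] [y ->]; exists (x + y); ring. Qed.
Lemma pcong_sym a b : pcong a b -> pcong b a.
Proof. by move=> [x ->]; exists (- x); ring. Qed.
Lemma pcong_sum I (r : seq I) (P : pred I) (f g : I -> {poly int}) :
  (forall i, P i -> pcong (f i) (g i)) ->
  pcong (\sum_(i <- r | P i) f i) (\sum_(i <- r | P i) g i).
Proof. by move=> H; apply: big_ind2 => //; [exact: pcong_refl|exact: pcongD]. Qed.
Lemma pcong_prod I (r : seq I) (P : pred I) (f g : I -> {poly int}) :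
  (forall i, P i -> pcong (f i) (g i)) ->
  pcong (\prod_(i <- r | P i) f i) (\prod_(i <- r | P i) g i).
Proof. by move=> H; apply: big_ind2 => //; [exact: pcong_refl|exact: pcongM]. Qed.
Lemma pcong_prod1 I (r : seq I) (P : pred I) (f : I -> {poly int}) :
  (forall i, P i -> pcong (f i) 1) -> pcong (\prod_(i <- r | P i) f i) 1.
Proof.
move=> H; apply: (big_ind (fun a => pcong a 1)) => //; first exact: pcong_refl.
by move=> a b a1 b1; rewrite -[X in pcong _ X]mulr1; apply: pcongM.
Qed.
Lemma pcong_det l (A B : 'M[{poly int}]_l) : (forall i j, pcong (A i j) (B i j)) ->
  pcong (\det A) (\det B).
Proof.
move=> H; apply: pcong_sum => s _; apply: pcongM; first exact: pcong_refl.
by apply: pcong_prod => i _; apply: H.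
Qed.
Lemma pcong_coef a b i : (i < m)%N -> pcong a b -> a`_i = b`_i.
Proof. by move=> im [c ->]; rewrite coefD coefXnM im addr0. Qed.
End PolyCong.

Section Specialization.
Variable N : nat.
Local Notation B' := (N + N.+1)%N.
Local Notation m := (2 * N.+1)%N.

(** The coefficients of the product over the first K letters, as required in
    fill_jt. *)
Fixpoint hseq (K : nat) : nat -> {poly int} :=
  if K is K'.+1 then
    if (N < K')%N then add_odd 'X^(letter_deg N K') (hseq K')
    else add_even 'X^(letter_deg N K') (hseq K')
  else fun n => (n == 0%N)%:R.

Lemma hseqS K : hseq K.+1 = if (N < K)%N then add_odd 'X^(letter_deg N K) (hseq K)
  else add_even 'X^(letter_deg N K) (hseq K).
Proof. by []. Qed.

Definition uodd s n : {poly int} := \prod_(i < n) (1 + 'X^(2 * (s + i) + 1)).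
Definition qden n : {poly int} := qpoch 'X^2 n.

Lemma hseq_even n : hseq N.+1 n * qden n = \prod_(i < n) (1 - 'X^2 ^+ (N.+1 + i)).
Proof.
apply: (even_closed (M := N.+1)) => // K KN.
by rewrite /= ltnNge -ltnS KN /letter_deg KN exprM.
Qed.

Lemma hseq_odd r : hseq (N.+1 + r) = add_odds (fun i => 'X^(2 * i + 1)) 0 r (hseq N.+1).
Proof.
elim: r => [|r IH]; first by rewrite addn0.
rewrite addnS hseqS IH (_ : (N < N.+1 + r)%N) ?addSn ?ltnS ?leq_addr //.
by rewrite /letter_deg -addSn ltnNge leq_addr addKn.
Qed.

(** Induction on the number of odd letters, of which the last r ones are
    present: adding the next smaller one is add_odd, and the right-hand sides
    satisfy uodd s (n + 1) = uodd (s + 1) (n + 1) + t^(2s + 1) uodd (s + 1) n (1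
    - q^(n + 1)).  Without odd letters all factors on both sides are 1 at this
    precision. *)
Lemma odd_cong r s n : (s + r = N.+1)%N ->
  pcong m (add_odds (fun i => 'X^(2 * i + 1)) s r (hseq N.+1) n * qden n) (uodd s n).
Proof.
elim: r s n => [|r IH] s n E.
  rewrite /= hseq_even; apply: (@pcong_trans _ _ 1).
    apply: pcong_prod1 => i _; rewrite -exprM; exists (- 'X^(2 * i)).
    by rewrite mulrN -exprD mulnDr.
  apply: pcong_sym; apply: pcong_prod1 => i _; exists ('X^(2 * i + 1)).
  by rewrite -exprD -E addn0 mulnDr addnA.
rewrite (add_oddsSl _ _ _ _ n); case: n => [|n].
  rewrite /add_odd mulr0 addr0; apply: pcong_trans (IH s.+1 0%N _) _; first by rewrite addSnnS.
  by rewrite /uodd !big_ord0; apply: pcong_refl.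
have E' : (s.+1 + r = N.+1)%N by rewrite addSnnS.
rewrite /add_odd mulrDl.
have -> : uodd s n.+1 = uodd s.+1 n.+1 + 'X^(2 * s + 1) * uodd s.+1 n * (1 - 'X^2 ^+ n.+1).
  have -> : uodd s n.+1 = (1 + 'X^(2 * s + 1)) * uodd s.+1 n.
    rewrite /uodd big_ord_recl addn0; congr (_ * _); apply: eq_bigr => i _.
    by rewrite lift0; congr (1 + 'X^_); lia.
  have -> : uodd s.+1 n.+1 = uodd s.+1 n * (1 + 'X^(2 * s + 1) * 'X^2 ^+ n.+1).
    rewrite /uodd big_ord_recr /=; congr (_ * (1 + _)).
    by rewrite -exprM -exprD; congr ('X^_); lia.
  by ring.
apply: pcongD; first exact: IH.
rewrite /qden qpochS -/(qden n) mulrA -[X in X * _]mulrA; apply: pcongM; last exact: pcong_refl.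
by apply: pcongM; [exact: pcong_refl|apply: IH].
Qed.

Lemma hseq_cong n : pcong m (hseq B'.+1 n * qden n) (uodd 0 n).
Proof.
have -> : (B'.+1 = N.+1 + N.+1)%N by rewrite addSn.
by rewrite hseq_odd; apply: odd_cong.
Qed.

End Specialization.

(** * The product formula *)

Section Conclusion.
Variables (n : nat) (lam : seq nat).
Hypothesis lamP : is_partition n.+1 lam.
Local Notation l := (size lam).
Local Notation L := l.-1.
Local Notation m0 := (sumn lam + l)%N.
Let lam_s := lam_sorted lamP.

Definition lam_tuple : l.-tuple 'I_(sumn lam).+1 := [tuple inord (nth 0 lam i) | i < l].

Lemma lam_tuple_row i : part_row lam_tuple i = nth 0 lam i.
Proof.
have [il|il] := ltnP i l; last by rewrite part_row_default // nth_default.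
by rewrite (part_rowE _ (Ordinal il)) tnth_mktuple inordK // ltnS nth_sumn.
Qed.

Lemma lam_tuple_sub : is_sub lam_tuple.
Proof.
by apply/is_subP; split=> i; rewrite !lam_tuple_row // sorted_nth.
Qed.

Lemma lam_tuple_cells : cells_of lam_tuple = setT.
Proof. by apply/setP => c; rewrite cells_ofP lam_tuple_row in_setT col_lt. Qed.

Lemma super_schur_jt N : super_schur lam (@xvar N) (@yvar N) =
  jt (hseq N (N + N.+1).+1) (fun i : 'I_l => beta_nat lam i).
Proof.
rewrite (super_schur_gf lamP) -lam_tuple_cells.
have H0 k : hseq N 0 k = (k == 0%N)%:R by [].
have HS0 K : hseq N K.+1 0 = hseq N K 0.
  by rewrite hseqS; case: ifP => _; rewrite /= /add_odd ?mulr0 ?addr0.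
have HS (K : 'I_(N + N.+1).+1) k : hseq N K.+1 k.+1 = hseq N K k.+1 +
    zvar K * (if late K then hseq N K k else hseq N K.+1 k).
  by rewrite hseqS /late; case: ifP.
rewrite (fill_jt lam_s H0 HS0 HS lam_tuple_sub) //.
by rewrite /jt; congr (\det _); apply/matrixP => i j; rewrite !mxE /beta lam_tuple_row.
Qed.

(** Numerator of h_k over the common denominator of all entries of the
    matrix. *)
Definition num_coef k : {poly int} := uodd 0 k * \prod_(k <= i < m0) (1 - 'X^2 ^+ i.+1).
Definition num_poly : {poly int} := jt num_coef (fun i : 'I_l => beta_nat lam i).
Definition den_poly : {poly int} := qden m0 ^+ l.

Lemma qden_split k : (k <= m0)%N -> qden m0 = qden k * \prod_(k <= i < m0) (1 - 'X^2 ^+ i.+1).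
Proof.
move=> km; rewrite /qden /qpoch -!(big_mkord predT (fun i => 1 - 'X^2 ^+ i.+1)).
exact: big_cat_nat.
Qed.

Lemma bound_arith (a b c d k : nat) : (a <= b)%N -> (c < k)%N -> (d < k)%N ->
  (a + (k.-1 - c) + d - k.-1 <= b + k)%N.
Proof. by lia. Qed.

Lemma beta_bound (i j : 'I_l) : (beta_nat lam i + j - L <= m0)%N.
Proof.
exact: bound_arith (nth_sumn lam i) (ltn_ord i) (ltn_ord j).
Qed.

(** At the precision of finitely many letters, the super Schur polynomial is the
    quotient of num_poly by den_poly; multiplying each of the l rows of the
    determinant by the common denominator of its entries clears the
    fractions. *)
Lemma den_super_schur N : pcong (2 * N.+1)
  (den_poly * super_schur lam (@xvar N) (@yvar N)) num_poly.
Proof.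
rewrite super_schur_jt /den_poly /num_poly /jt -detZ; apply: pcong_det => i j.
rewrite !mxE /shifted; have := beta_bound i j; case: ltnP => _ kb.
  by rewrite mulr0; apply: pcong_refl.
rewrite (qden_split kb) -mulrA [X in _ * X]mulrC mulrA [X in X * _]mulrC.
by apply: pcongM; [apply: hseq_cong|apply: pcong_refl].
Qed.

Local Notation "x %:F" := (@FracField.tofrac _ x).

Lemma tofrac_neq0 (p : {poly int}) : p != 0 -> p%:F != 0.
Proof. by rewrite tofrac_eq0. Qed.

Lemma tvarX k : tvar ^+ k = ('X^k)%:F.
Proof. by rewrite /tvar tofracXn. Qed.

Lemma one_pm_Xn (e : bool) k : (1 + (-1) ^+ e * 'X^(k.+1) : {poly int}) != 0.
Proof.
apply/eqP => /polyP/(_ 0%N); rewrite coefD coef1 coef0 mulrC coefXnM /=.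
by [].
Qed.

Lemma tvar_neq0 : tvar != 0.
Proof. by apply: tofrac_neq0; rewrite polyX_eq0. Qed.

Lemma q_neq1 k : 1 - (tvar ^+ 2) ^+ k.+1 != 0.
Proof.
rewrite -exprM tvarX mulnS -tofrac1 -tofracB.
by apply: tofrac_neq0; have := one_pm_Xn true (2 * k).+1; rewrite expr1 mulN1r.
Qed.

Lemma one_add_tvar k : 1 + tvar ^+ k.+1 != 0.
Proof.
rewrite tvarX -tofrac1 -tofracD.
by apply: tofrac_neq0; have := one_pm_Xn false k; rewrite mul1r.
Qed.

Lemma u_powE c : 1 - (- tvar) * (tvar ^+ 2) ^ c = 1 + tvar ^ (2 * c + 1).
Proof.
rewrite mulNr opprK [tvar ^+ 2]exprnP exprz_exp addrC expfzDr ?tvar_neq0 //.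
by rewrite expr1z mulrC addrC.
Qed.

Lemma u_neq c : 1 - (- tvar) * (tvar ^+ 2) ^ c != 0.
Proof.
have ne : (2 * c + 1)%R != 0 :> int by lia.
rewrite u_powE; move: (2 * c + 1)%R ne => d; case: (intP d) => [|k|k] // _.
- exact: one_add_tvar.
- rewrite (_ : 1 + _ = tvar ^ (- k.+1%:Z) * (1 + tvar ^+ k.+1)).
    by rewrite mulf_neq0 ?expfz_neq0 ?tvar_neq0 ?one_add_tvar.
  by rewrite mulrDr mulr1 -exprnN mulVf ?expf_neq0 ?tvar_neq0 // addrC.
Qed.

Lemma num_den_frac : num_poly%:F / den_poly%:F =
  tvar ^+ (2 * nfun lam) *
     \prod_(c : cell lam)
        ((1 + tvar ^ (2 * content c + 1)) / (1 - tvar ^+ (2 * hook c))).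
Proof.
have q0 : tvar ^+ 2 != 0 by rewrite expf_neq0 ?tvar_neq0.
have := jt_product q_neq1 q0 u_neq lam_s.
rewrite -exprM => E.
have -> : \prod_(c : cell lam) ((1 + tvar ^ (2 * content c + 1)) / (1 - tvar ^+ (2 * hook c)))
  = \prod_(c : cell lam) ((1 - (- tvar) * (tvar ^+ 2) ^ content c) / (1 - (tvar ^+ 2) ^+ hook c)).
  by apply: eq_bigr => c _; rewrite u_powE -exprM.
rewrite -{}E.
have qd k : (qden k)%:F = qfact (tvar ^+ 2) k.
  rewrite /qden /qpoch rmorph_prod; apply: eq_bigr => i _.
  by rewrite tvarX rmorphB rmorph1 rmorphXn.
have uo k : (uodd 0 k)%:F = upoch (tvar ^+ 2) (- tvar) k.
  rewrite /uodd rmorph_prod; apply: eq_bigr => i _; rewrite add0n mulNr opprK.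
  by rewrite -exprM -exprS tvarX rmorphD rmorph1 addn1.
have qden0 k : (qden k)%:F != 0 by rewrite qd; apply: (qfact_neq0 q_neq1).
rewrite /den_poly rmorphXn.
suff -> : num_poly%:F = (qden m0)%:F ^+ l *
    jt (hspec (tvar ^+ 2) (- tvar)) (fun i : 'I_l => beta_nat lam i).
  by move: (jt _ _) (expf_neq0 l (qden0 m0)) => J D0; rewrite [_ * J]mulrC mulfK.
rewrite /num_poly /jt -det_map_mx -detZ; congr (\det _); apply/matrixP => i j.
rewrite !mxE /shifted; have := beta_bound i j; case: ltnP => _ kb.
  by rewrite mulr0 rmorph0.
rewrite /num_coef /hspec (qden_split kb) -uo -qd !rmorphM /=.
set k := (_ - _)%N; have := qden0 k; move: (qden k)%:F => D D0.
move: (uodd 0 k)%:F (\prod_(k <= _ < m0) _)%:F => U P.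
by rewrite [U / D]mulrC mulrA [D * P]mulrC mulfK // mulrC.
Qed.

Lemma den_poly_neq0 : den_poly != 0.
Proof.
rewrite /den_poly expf_neq0 //; apply/prodf_neq0 => i _.
by rewrite -exprM mulnS; have := one_pm_Xn true (2 * i).+1; rewrite expr1 mulN1r.
Qed.

End Conclusion.

From mathcomp Require Import reals complex.

Theorem theorem5p7 (R : realType) (n : nat) (lam : seq nat)
    (lamP : is_partition n.+1 lam) :
  let H : nat -> int := fun k => (graded_mult R[i] n lam k)%:Z in
  tadic_lim
    (fun N => super_schur lam
       (fun i : 'I_N => 'X^(2 * i)) (fun i : 'I_N => 'X^(2 * i + 1))) H
  /\
  is_expansion
    (tvar ^+ (2 * nfun lam) *
     \prod_(c : cell lam)
        ((1 + tvar ^ (2 * content c + 1)) / (1 - tvar ^+ (2 * hook c)))) H.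
Proof.
move=> H.
have charF k : k.+1%:R != 0 :> R[i] by rewrite Num.Theory.pnatr_eq0.
have coefH k N : (k <= N)%N -> (super_schur lam (@xvar N) (@yvar N))`_k = H k.
  by move=> kN; rewrite (super_schur_gf lamP) -(graded_mult_coef charF lamP kN).
split.
  (* N + 1 variables of each kind stand for the letters up to 2N + 1. *)
  move=> k; exists k.+1 => N; case: N => // N kN.
  exact: coefH.
exists (num_poly lam), (den_poly lam); split.
- exact: den_poly_neq0.
- by rewrite (num_den_frac lamP).
move=> k; rewrite -(pcong_coef _ (den_super_schur lamP k) (i := k)); last by lia.
rewrite coefM; apply: eq_bigr => i _; rewrite coefH //.
exact: leq_subr.
Qed.
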